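(* Let $J,q,w,f$, the points $x_0<x_1<\dots<x_N<x_{N+1}$, the fundamental matrices $U_j$, and the quantities $B$, $\mathcal B$, $\mathcal U$, $\mathcal J$, $\mathcal R(f)$, $\mathcal I(f)$ be as defined in the context. If $u$ is any solution of $Ju'+qu=wf$ on $(x_0,x_{N+1})$, then $\tilde u=(u^+(x_0),\dots,u^+(x_N))^\diamond$ is a solution of $$B\tilde u=\mathcal R(f)-\mathcal B^*\mathcal U\mathcal J^{-1}\mathcal I(f).\qquad(\ast)$$ Conversely, a solution $\tilde u=(c_0,\dots,c_N)^\diamond$ of $(\ast)$ provides a solution $u$ of $Ju'+qu=wf$ on $(x_0,x_{N+1})$ given by $$u^-(x)=U_j^-(x)\Big(c_j+J^{-1}\int_{(x_j,x)}U_j^*wf\Big)\quad\text{for } x\in(x_j,x_{j+1}),\ j=0,\dots,N.$$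
   Context: $J$ is a constant, invertible, skew-Hermitian $n\times n$ matrix; $(a,b)$ is an open real interval; $q,w\in\mathcal D^{\prime0}((a,b))^{n\times n}$, $q$ Hermitian and $w$ non-negative. Here $\mathcal D^{\prime0}((a,b))$ is the space of distributions of order $0$ (distributional derivatives of functions of locally bounded variation, identified on compact subintervals with complex measures). $L^2(w)$ is the Hilbert space of (classes of) functions $f:(a,b)\to\mathbb C^n$ with $\int f^*wf<\infty$, inner product $\langle u,v\rangle=\int u^*wv$. Throughout $f\in L^2(w)$. A function $u$ of locally bounded variation has left- and right-hand limits $u^-$, $u^+$; it is balanced if $u=(u^++u^-)/2$. A solution of $Ju'+qu=wf$ on an open interval is a balanced function of locally bounded variation satisfying the equation as distributions (measures). It has limits at the endpoints of any interval $(\xi_1,\xi_2)$ with $[\xi_1,\xi_2]\subset(a,b)$ on which it is a solution. $Q,W$ are left-continuous anti-derivatives of $q,w$; $\Delta_q(x)=Q^+(x)-Q^-(x)$, $\Delta_w(x)=W^+(x)-W^-(x)$ are the jumps. Put $B_\pm(x)=J\pm\Delta_q(x)/2$; then $B_-(x)=-B_+(x)^*$. Fix $[\xi_1,\xi_2]\subset(a,b)$ and points $x_1<\dots<x_N$ in $(\xi_1,\xi_2)$, $N\ge2$, among which are all points of $(\xi_1,\xi_2)$ where $B_\pm$ is not invertible. Set $x_0=\xi_1$, $x_{N+1}=\xi_2$. For $j=0,\dots,N$ let $U_j$ be the balanced fundamental matrix of $Ju'+qu=0$ on $(x_j,x_{j+1})$ with $\lim_{x\downarrow x_j}U_j(x)=\mathrm{Id}$,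 and set $U_j(x_{j+1})=\lim_{x\uparrow x_{j+1}}U_j^-(x)$. For $c_1,\dots,c_k\in\mathbb C^n$, $(c_1,\dots,c_k)^\diamond=(c_1^\top,\dots,c_k^\top)^\top\in\mathbb C^{nk}$. Define the $nN\times nN$ block diagonal matrices $\mathcal B=\operatorname{diag}(B_+(x_1),\dots,B_+(x_N))$, $\mathcal U=\operatorname{diag}(U_0(x_1),\dots,U_{N-1}(x_N))$, $\mathcal J=\operatorname{diag}(J,\dots,J)$; the $nN\times n(N+1)$ matrices $E_\top=(0,\mathrm{Id})$ and $E_\bot=(\mathrm{Id},0)$, which strip the first, respectively last, $n$ coordinates off a vector; and $B=\mathcal B^*\mathcal UE_\bot+\mathcal BE_\top$. Let $I_j(f)=\int_{(x_j,x_{j+1})}U_j^*wf$, $\mathcal R(f)=(\Delta_w(x_1)f(x_1),\dots,\Delta_w(x_N)f(x_N))^\diamond$ and $\mathcal I(f)=(I_0(f),\dots,I_{N-1}(f))^\diamond$. Since $u$ is balanced, specifying $u^-$ on each $(x_j,x_{j+1})$ determines $u$ everywhere on $(x_0,x_{N+1})$, with $u(x_j)=(u^+(x_j)+u^-(x_j))/2$ and with $u^\pm(x_j)$ the one-sided limits. *)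

(* Defs.v *)
From mathcomp Require Import all_boot all_order all_algebra.
From mathcomp Require Import complex.
From mathcomp Require Import all_classical all_reals all_analysis.

Set Implicit Arguments.
Unset Strict Implicit.
Unset Printing Implicit Defensive.

Import Order.TTheory GRing.Theory Num.Theory.
Import numFieldTopology.Exports numFieldNormedType.Exports.

#[global] Open Scope classical_set_scope.
#[global] Open Scope ring_scope.
#[global] Open Scope complex_scope.
#[global] Open Scope sesquilinear_scope.

(* Limits, variation and integrals of C^(m x k)-valued functions are taken
   entrywise, on real and imaginary parts. *)

Section MatrixFunctions.
Context {R : realType} {m k : nat}.
Implicit Types (u : R -> 'M[R[i]]_(m, k)) (a b : \bar R).

(* u^- and u^+; as always with [lim], only meaningful where the one-sided
   limits exist. *)
Definition llim u (x : R) : 'M[R[i]]_(m, k) :=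
  \matrix_(i, j) (lim (complex.Re (u t i j) @[t --> x^'-])
                  +i* lim (complex.Im (u t i j) @[t --> x^'-])).

Definition rlim u (x : R) : 'M[R[i]]_(m, k) :=
  \matrix_(i, j) (lim (complex.Re (u t i j) @[t --> x^'+])
                  +i* lim (complex.Im (u t i j) @[t --> x^'+])).

Definition cvg_right u (x : R) (l : 'M[R[i]]_(m, k)) : Prop :=
  forall i j, (complex.Re (u t i j) @[t --> x^'+] --> complex.Re (l i j)) /\
              (complex.Im (u t i j) @[t --> x^'+] --> complex.Im (l i j)).

Definition oint a b : set R := [set t | (a < t%:E)%E /\ (t%:E < b)%E].

Definition locally_BV a b u : Prop :=
  forall c d, oint a b c -> oint a b d -> c <= d ->
  forall i j, bounded_variation c d (fun t => complex.Re (u t i j)) /\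
              bounded_variation c d (fun t => complex.Im (u t i j)).

Definition balanced a b u : Prop :=
  forall x, oint a b x -> u x = 2^-1 *: (rlim u x + llim u x).

Definition left_continuous a b u : Prop :=
  forall x, oint a b x -> u x = llim u x.

Definition mx_measurable (D : set R) u : Prop :=
  forall i j,
    measurable_fun (D : set (measurableTypeR R)) (fun t => complex.Re (u t i j)) /\
    measurable_fun (D : set (measurableTypeR R)) (fun t => complex.Im (u t i j)).

Definition mx_integrable (mu : {measure set (measurableTypeR R) -> \bar R})
    (D : set R) u : Prop :=
  forall i j,
    mu.-integrable D (fun t => (complex.Re (u t i j))%:E) /\
    mu.-integrable D (fun t => (complex.Im (u t i j))%:E).

Definition mx_int (mu : {measure set (measurableTypeR R) -> \bar R})
    (D : set R) u : 'M[R[i]]_(m, k) :=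
  \matrix_(i, j) (Rintegral mu D (fun t => complex.Re (u t i j))
                  +i* Rintegral mu D (fun t => complex.Im (u t i j))).

End MatrixFunctions.

(* The space D'^0((a,b))^(m x k): matrix-valued measures which are complex
   measures on every compact subinterval of (a,b).  Such a measure is given in
   the form D mu, with mu a positive Borel measure that is finite on compact
   subintervals and D a density locally integrable with respect to mu.  By the
   Radon-Nikodym theorem every element has this form (take for mu the sum of
   the total variations of the entries, or, for a non-negative w, its trace).
   The pair (mu, D) is not unique, but [d0_val] and [d0_int] on bounded sets
   depend only on the matrix-valued measure D mu. *)
Record dist0 (R : realType) (a b : \bar R) (m k : nat) := Dist0 {
  d0_mu : {measure set (measurableTypeR R) -> \bar R} ;
  d0_den : R -> 'M[R[i]]_(m, k) ;
  d0_den_measurable : mx_measurable (oint a b) d0_den ;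
  d0_mu_finite : forall c d : R, oint a b c -> oint a b d ->
    (d0_mu `[c, d]%classic < +oo)%E ;
  d0_den_integrable : forall c d : R, oint a b c -> oint a b d ->
    mx_integrable d0_mu `[c, d] d0_den }.

Section Dist0.
Context {R : realType} {a b : \bar R}.

(* \int_A X q Y.  For q = D mu this is \int_A (X D Y) dmu; entries of X, Y need
   not be integrable against the individual entries of q, which is what makes
   \int U^* w f meaningful for every f in L^2(w). *)
Definition d0_int {p m k r : nat} (q : dist0 a b m k) (A : set R)
    (X : R -> 'M[R[i]]_(p, m)) (Y : R -> 'M[R[i]]_(k, r)) : 'M[R[i]]_(p, r) :=
  mx_int (d0_mu q) A (fun t => X t *m d0_den q t *m Y t).

Definition d0_val {m k : nat} (q : dist0 a b m k) (A : set R) :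
  'M[R[i]]_(m, k) := mx_int (d0_mu q) A (d0_den q).

(* The measure q u. *)
Definition d0_mul {m k r : nat} (q : dist0 a b m k)
    (u : R -> 'M[R[i]]_(k, r)) (A : set R) : 'M[R[i]]_(m, r) :=
  d0_int q A (fun=> 1%:M) u.

Definition bounded_borel (A : set R) : Prop :=
  measurable (A : set (measurableTypeR R)) /\
  exists c d : R, [/\ oint a b c, oint a b d & A `<=` `[c, d]].

(* u' = v in D'^0((a,b)), i.e. v is the Lebesgue-Stieltjes measure of u. *)
Definition is_derivative {m k : nat} (u : R -> 'M[R[i]]_(m, k))
    (v : dist0 a b m k) : Prop :=
  locally_BV a b u /\
  forall s t : R, oint a b s -> oint a b t -> s <= t ->
    d0_val v `[s, t[ = llim u t - llim u s.

Definition left_antiderivative {m k : nat} (q : dist0 a b m k)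
    (Q : R -> 'M[R[i]]_(m, k)) : Prop :=
  left_continuous a b Q /\ is_derivative Q q.

Definition d0_hermitian {n : nat} (q : dist0 a b n n) : Prop :=
  forall A, bounded_borel A -> (d0_val q A) ^t* = d0_val q A.

Definition d0_nonneg {n : nat} (w : dist0 a b n n) : Prop :=
  forall A, bounded_borel A ->
  forall v : 'cV[R[i]]_n, 0 <= (v ^t* *m d0_val w A *m v) 0 0.

(* f in L^2(w).  When w is non-negative, f^* w f is a non-negative measure, and
   its density f^* D f is real and non-negative mu-almost everywhere. *)
Definition in_L2 {n : nat} (w : dist0 a b n n) (f : R -> 'cV[R[i]]_n) : Prop :=
  mx_measurable (oint a b) f /\
  (\int[d0_mu w]_(t in (oint a b : set (measurableTypeR R)))
     (complex.Re ((f t ^t* *m d0_den w t *m f t) 0 0))%:E < +oo)%E.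

End Dist0.
Arguments bounded_borel {R} a b A.

Definition jump {R : realType} {m k : nat} (Q : R -> 'M[R[i]]_(m, k)) (x : R) :
  'M[R[i]]_(m, k) := rlim Q x - llim Q x.

(* u is a (balanced) solution of J u' + q u = g on (al,be), where the measure g
   is given by its values on Borel sets; u may have several columns, so that
   this also covers fundamental matrices. *)
Definition solution {R : realType} {a b : \bar R} {n k : nat} (J : 'M[R[i]]_n)
    (q : dist0 a b n n) (g : set R -> 'M[R[i]]_(n, k)) (al be : R)
    (u : R -> 'M[R[i]]_(n, k)) : Prop :=
  [/\ locally_BV al%:E be%:E u,
      balanced al%:E be%:E u &
      exists2 u' : dist0 al%:E be%:E n k, is_derivative u u' &
        forall A, bounded_borel al%:E be%:E A ->
          J *m d0_val u' A + d0_mul q u A = g A].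

Section Blocks.
Context {R : realType} {a b : \bar R} {n : nat}.
Variables (J : 'M[R[i]]_n) (w : dist0 a b n n) (Q W : R -> 'M[R[i]]_n).
Variables (N : nat) (x : nat -> R) (U : nat -> R -> 'M[R[i]]_n).
Variable (f : R -> 'cV[R[i]]_n).

Definition Bplus (y : R) : 'M[R[i]]_n := J + 2^-1 *: jump Q y.
Definition Bminus (y : R) : 'M[R[i]]_n := J - 2^-1 *: jump Q y.

(* U_j(x_{j+1}), the limit of U_j^- from the left. *)
Definition Uend (j : nat) : 'M[R[i]]_n := llim (llim (U j)) (x j.+1).

Local Notation dimN := (\sum_(i < N) n)%N.
Local Notation dimN1 := (\sum_(j < N.+1) n)%N.

Definition calB : 'M[R[i]]_dimN := \mxdiag_(i < N) Bplus (x i.+1).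
Definition calU : 'M[R[i]]_dimN := \mxdiag_(i < N) Uend i.
Definition calJ : 'M[R[i]]_dimN := \mxdiag_(i < N) J.

Definition Etop : 'M[R[i]]_(dimN, dimN1) :=
  \mxblock_(i < N, j < N.+1)
    (if j == i.+1 :> nat then 1%:M else 0 : 'M[R[i]]_n).
Definition Ebot : 'M[R[i]]_(dimN, dimN1) :=
  \mxblock_(i < N, j < N.+1)
    (if j == i :> nat then 1%:M else 0 : 'M[R[i]]_n).

Definition Bmx : 'M[R[i]]_(dimN, dimN1) :=
  calB ^t* *m calU *m Ebot + calB *m Etop.

Definition Uint (j : nat) (A : set R) : 'cV[R[i]]_n :=
  d0_int w A (fun t => (U j t) ^t*) f.

Definition calI : 'cV[R[i]]_dimN :=
  \mxcol_(i < N) Uint i `]x i, x i.+1[.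

Definition calR : 'cV[R[i]]_dimN :=
  \mxcol_(i < N) (jump W (x i.+1) *m f (x i.+1)).

End Blocks.

(* Main.v *)
From mathcomp Require Import all_boot all_order all_algebra.
From mathcomp Require Import complex.
From mathcomp Require Import all_classical all_reals all_analysis.
From mathcomp Require Import measurable_realfun.
From mathcomp Require Import ring lra.
Require Import Defs.

(** Why the theorem holds.

    Everything takes place on the compact interval [x_0, x_{N+1}].  There the
    measures of q and w are absolutely continuous with respect to one finite
    positive measure lam, say q = P lam and w = D lam, and P may be taken
    Hermitian at every point (common_density_reduction).  The product w f
    is again a matrix measure there because w >= 0 and f lies in L^2(w): by
    Cauchy-Schwarz the entries of D f are dominated by D_ii + f^* D f
    (density_mul_integrable).

    A solution of J u' + q u = g lam on an interval (c, d) is the same thing as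
    a balanced primitive of its own right-hand side,
      u(t) = l + (F(t-) + F(t+)) / 2,  F' = J^-1 (g - P u) lam,  F(c+) = 0
    (solution_bp and bp_solution).  The delicate point is that the density is
    integrable up to the ends of (c, d): u is only known to be locally of
    bounded variation there.  A Gronwall argument settles it, since lam-mass
    near an end is small (ode_bounded).

    For two balanced primitives the Leibniz rule holds without a jump term
    (Rintegral_by_parts, product_rule).  Applied to U^* J u, where U is the
    fundamental matrix on (c, d), it gives (U^* J u)' = U^* g, because J is
    skew-Hermitian and P Hermitian (lagrange).  With u = U this says that the
    one-sided limits of U satisfy U^* J U = J, so they are invertible, and the
    general case becomes u^-(t) = U^-(t) (u^+(c) + J^-1 int_(c,t) U^* w f)
    (variation_of_constants).

    At a grid point y the atom of the equation reads
    J (u^+ - u^-) + Delta_q (u^+ + u^-) / 2 = Delta_w f, that is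
    B_+ u^+ + B_+^* u^- = Delta_w f (jump_equation).  Inserting for u^- the
    value that variation of constants transports from the previous grid point
    gives one row of the block system (block_system, jump_relations).  This
    proves the direct part.

    For the converse, the formula for u^- together with the analogous one for
    u^+ defines u on each cell, balanced values being imposed inside.  That
    the product U (c_j + J^-1 int U^* w f) solves the equation is again the
    Leibniz rule; at an atom, however, the balanced value of a product is not
    the product of the balanced values.  The defect is a quarter of the product
    of the jumps (quarter_jump), and it is absorbed exactly because both
    one-sided limits of U are J-unitary (midpoint_identity,
    balanced_product_rhs).  Finally the rows of the system say that the jump
    between adjacent cells is the one required at the grid point, so the pieces
    form one balanced primitive on (x_0, x_{N+1})
    (jump_relations_solution). *)

Set Implicit Arguments.
Unset Strict Implicit.
Unset Printing Implicit Defensive.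

Import Order.TTheory GRing.Theory Num.Theory.
Import numFieldTopology.Exports numFieldNormedType.Exports.

(** * Integrals over intervals with a moving end *)

Section RealIntegrals.
Context {R : realType} (mu : {measure set (measurableTypeR R) -> \bar R}).
Implicit Types (D A : set R) (h g : R -> R).

Local Notation intble D h := (mu.-integrable D (EFin \o h)).

(** Dominated convergence with a fixed integrand and varying domains; all
    one-sided limits of primitives come from it. *)
Lemma cvg_Rintegral_sets D A (An : nat -> set R) h :
  measurable (D : set (measurableTypeR R)) ->
  measurable (A : set (measurableTypeR R)) ->
  (forall n, measurable (An n : set (measurableTypeR R))) ->
  A `<=` D -> (forall n, An n `<=` D) -> intble D h ->
  (forall t, D t -> \forall n \near \oo, An n t <-> A t) ->
  \int[mu]_(t in An n) h t @[n --> \oo] --> \int[mu]_(t in A) h t.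
Proof.
move=> mD mA mAn AD AnD ih lim.
have mh : measurable_fun (D : set (measurableTypeR R)) h.
  by apply/measurable_EFinP; exact: measurable_int ih.
have eqr B : B `<=` D ->
    \int[mu]_(t in B) h t = fine (\int[mu]_(t in D) ((h \_ B) t)%:E).
  by move=> BD; rewrite -[in LHS](setIidr BD) Rintegral_mkcondr.
rewrite (eqr _ AD); under eq_fun do rewrite (eqr _ (AnD _)).
have mr (B : set R) : measurable (B : set (measurableTypeR R)) ->
    measurable_fun (D : set (measurableTypeR R)) (h \_ B).
  move=> mB; apply/(measurable_restrict h mB mD).
  by apply: measurable_funS mh => //; exact: subIsetl.
have [|||||] := @dominated_convergence _ _ R mu D mD
    (fun n t => ((h \_ (An n)) t)%:E)
    (fun t => ((h \_ A) t)%:E) (fun t => `|h t|%:E).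
- by move=> n; apply/measurable_EFinP; exact: mr.
- by apply/measurable_EFinP; exact: mr.
- apply/aeW => t Dt; apply: cvg_near_cst.
  apply: filterS (lim _ Dt) => n Hn; congr (_%:E).
  rewrite !patchE; have [HA|HA] := boolP (t \in An n); have [HA'|HA'] := boolP (t \in A) => //.
  - by move: HA HA'; rewrite inE notin_setE => /Hn.1.
  - by move: HA HA'; rewrite inE notin_setE => + /Hn.2.
- exact: integrable_norm.
- apply/aeW => t n Dt /=; rewrite lee_fin patchE.
  by case: ifP => _ //; rewrite normr0.
move=> iA _ cv; apply: fine_cvg; rewrite fineK //.
exact: integrable_fin_num.
Qed.

(** Always open at c. The flag decides the end t: open for true, closed for
    false, following the convention of BSide. Hence t |-> the integral over Iv
    true c t is the left-continuous primitive, and Iv false gives the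
    right-continuous one. *)
Definition Iv (b : bool) (c t : R) : set R :=
  [set` Interval (BRight c) (BSide b t)].

Lemma IvE b c t s : Iv b c t s <-> c < s /\ (if b then s < t else s <= t).
Proof.
by rewrite /Iv /=; case: b; rewrite in_itv /=; split => [/andP[]|[-> ->]].
Qed.

Lemma measurable_Iv b c t : measurable (Iv b c t : set (measurableTypeR R)).
Proof. exact: measurable_itv. Qed.
#[local] Hint Resolve measurable_Iv : core.

Lemma Iv_sub (b b' : bool) (c c' t t' : R) : c' <= c ->
  (t < t' \/ (t <= t' /\ (b' -> b))) -> Iv b c t `<=` Iv b' c' t'.
Proof.
move=> cc tt s /IvE[cs st]; apply/IvE; split; first exact: le_lt_trans cs.
case: tt => [tt|[tt bb]].
  have : s < t' by case: b st => st; [exact: lt_trans tt|exact: le_lt_trans tt].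
  by case: b' => // /ltW.
case: b' bb => [/(_ isT) bb|_]; first by rewrite bb in st; exact: lt_le_trans tt.
by case: b st => st; [apply/ltW; exact: lt_le_trans tt|exact: le_trans tt].
Qed.

(** The atom at y is lost when y is approached from the left, whichever
    primitive is used; this is why the limit does not depend on b. *)
Lemma cvg_Iv_left b c d y h : c < y -> y <= d -> intble (Iv true c d) h ->
  \int[mu]_(t in Iv b c s) h t @[s --> y^'-] -->
  \int[mu]_(t in Iv true c y) h t.
Proof.
move=> cy yd ih; apply/cvg_at_leftP => u [uy ucvg].
apply: (@cvg_Rintegral_sets (Iv true c d)) => //.
- by apply: Iv_sub => //; right.
- by move=> n; apply: Iv_sub => //; left; exact: lt_le_trans yd.
move=> t _; have [ty|yt] := ltP t y.
  apply: filterS (cvgr_gt y ucvg _ ty) => n /= tun.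
  split => /IvE [ct _]; apply/IvE; split => //.
  by case: b => //; exact: ltW.
near=> n; split => /IvE [ct tu]; last by move: tu; rewrite ltNge yt.
exfalso; move: (uy n); rewrite ltNge => /negP; apply.
by apply: (le_trans yt); case: b tu => // /ltW.
Unshelve. all: by end_near. Qed.

(** Approached from the right, the atom at y is kept. *)
Lemma cvg_Iv_right b c d y h : c <= y -> y < d -> intble (Iv true c d) h ->
  \int[mu]_(t in Iv b c s) h t @[s --> y^'+] -->
  \int[mu]_(t in Iv false c y) h t.
Proof.
move=> cy yd ih; apply/cvg_at_rightP => u [uy ucvg].
have ud : \forall n \near \oo, u n < d by exact: (cvgr_lt y).
have [N _ uN] := ud.
rewrite -(cvg_shiftn N).
apply: (@cvg_Rintegral_sets (Iv true c d)) => //.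
- by apply: Iv_sub => //; left.
- by move=> n; apply: Iv_sub => //; left; apply: uN => /=; rewrite leq_addl.
move=> t _; have [yt|ty] := ltP y t.
  have tu : \forall n \near \oo, u n < t by exact: (cvgr_lt y).
  case: tu => M _ uM; exists M => // n /= Mn.
  have {uM}unt : u (n + N)%N < t.
    by apply: uM => /=; exact: leq_trans Mn (leq_addr _ _).
  split => /IvE [ct tu]; exfalso.
    by case: b tu => tu; move: unt tu; lra.
  by move: tu yt; lra.
near=> n; split => /IvE [ct tu]; apply/IvE; split => //.
have := uy (n + N)%N => yu.
by case: b; [exact: le_lt_trans yu|apply: ltW; exact: le_lt_trans yu].
Unshelve. all: by end_near. Qed.

Lemma Rintegral_itv_split (a x y : itv_bound R) h :
  (a <= x)%O -> (x <= y)%O -> intble [set` Interval a y] h ->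
  \int[mu]_(t in [set` Interval a y]) h t =
  \int[mu]_(t in [set` Interval a x]) h t +
  \int[mu]_(t in [set` Interval x y]) h t.
Proof.
move=> ax xy; rewrite (itv_bndbnd_setU ax xy) => ih.
rewrite Rintegral_setU //; apply/disj_setPS => t /=.
rewrite !itv_boundlr => -[/andP[_ h1] /andP[h2 _]].
by have := le_trans h1 h2; rewrite bnd_simp ltxx.
Qed.

Lemma Rintegral_set1E (t : R) h : \int[mu]_(s in [set t]) h s =
  fine (mu [set t]) * h t.
Proof.
have -> : \int[mu]_(s in [set t]) h s = \int[mu]_(s in [set t]) h t.
  by apply: eq_Rintegral => s; rewrite inE /= => ->.
rewrite Rintegral_cst; last exact: measurable_set1.
by rewrite mulrC.
Qed.

Lemma integrable_mul_bounded D h (k : measurableTypeR R -> R) (M : R) :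
  measurable (D : set (measurableTypeR R)) -> intble D h ->
  measurable_fun (D : set (measurableTypeR R)) k -> (forall x, D x -> `|k x| <= M) ->
  intble D (fun x => h x * k x).
Proof.
move=> mD ih mk k1.
have bk : [bounded k x | x in (D : set (measurableTypeR R))].
  exists M; split; first exact: num_real.
  by move=> M' M1 x Dx /=; apply: le_trans (ltW M1); exact: k1.
by have := @integrableMl _ _ _ mu D mD (EFin \o h) k; apply.
Qed.

End RealIntegrals.

#[global] Hint Extern 0 (measurable (Iv _ _ _)) =>
  solve [exact: measurable_Iv] : core.

(** * Integration by parts for a measure with atoms *)

Section IBP.
Context {R : realType} (mu : {finite_measure set (measurableTypeR R) -> \bar R}).
Implicit Types (D A : set R) (h g : R -> R).

Local Notation intble D h := (mu.-integrable D (EFin \o h)).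

Definition Rless (b : bool) (x : R) : set R := [set` Interval -oo%O (BSide b x)].

Lemma RlessE b x s : Rless b x s <-> (if b then s < x else s <= x).
Proof. by rewrite /Rless /=; case: b; rewrite in_itv /=. Qed.

(** The balanced primitive vanishing at minus infinity. *)
Definition mean_primitive h (x : R) : R :=
  2^-1 * (\int[mu]_(t in Rless true x) h t + \int[mu]_(t in Rless false x) h t).

Lemma measurable_Rless b x : measurable (Rless b x : set (measurableTypeR R)).
Proof. exact: measurable_itv. Qed.
Hint Resolve measurable_Rless : core.

(** Half of the diagonal is counted: integrating against this kernel gives the
    balanced primitive, and the kernel and its transpose sum to 1. *)
Definition balanced_kernel (p : measurableTypeR R * measurableTypeR R) : R :=
  if p.2 < p.1 then 1 else if p.2 <= p.1 then 2^-1 else 0.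

Lemma measurable_balanced_kernel : measurable_fun setT balanced_kernel.
Proof.
apply: measurable_fun_ifT; first exact: measurable_fun_ltr.
  exact: measurable_cst.
apply: measurable_fun_ifT; first exact: measurable_fun_ler.
  exact: measurable_cst.
exact: measurable_cst.
Qed.

Lemma balanced_kernelE x y : balanced_kernel (x, y) =
  2^-1 * (\1_(Rless true x) y + \1_(Rless false x) y).
Proof.
rewrite /balanced_kernel /= !indicE !mem_setE !in_itv /=.
by case: (ltgtP y x) => _ /=; lra.
Qed.

Lemma balanced_kernel_sym x y :
  balanced_kernel (x, y) = 1 - balanced_kernel (y, x).
Proof. by rewrite /balanced_kernel /=; case: (ltgtP y x) => _; lra. Qed.

Lemma Rintegral_indic h A : measurable (A : set (measurableTypeR R)) ->
  \int[mu]_t (h t * \1_A t) = \int[mu]_(t in A) h t.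
Proof.
by move=> mA; rewrite [RHS]Rintegral_mkcond; apply: eq_Rintegral => t _;
  rewrite patchE indicE; case: ifP => _; rewrite ?mulr1 ?mulr0.
Qed.

Lemma integrable_mul_indic h A : measurable (A : set (measurableTypeR R)) ->
  intble setT h -> intble setT (fun t => h t * \1_A t).
Proof.
move=> mA ih.
have mh : measurable_fun setT h by apply/measurable_EFinP; exact: measurable_int ih.
apply: le_integrable ih => //.
  apply/measurable_EFinP; apply: measurable_funM => //.
move=> t _ /=; rewrite lee_fin normrM indicE.
by case: (_ \in _); rewrite ?normr1 ?mulr1 ?normr0 ?mulr0.
Qed.

Lemma Rintegral_balanced_kernel h x : intble setT h ->
  \int[mu]_y (h y * balanced_kernel (x, y)) = mean_primitive h x.
Proof.
move=> ih; under eq_Rintegral do rewrite balanced_kernelE mulrCA mulrDr.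
rewrite RintegralZl //; last first.
  by apply: (@integrableD _ _ _ mu setT _ (EFin \o _) (EFin \o _)) => //;
    apply: integrable_mul_indic.
rewrite RintegralD //; [|exact: integrable_mul_indic..].
by rewrite !Rintegral_indic.
Qed.

Lemma Rintegral_balanced_kernel_tr h y : intble setT h ->
  \int[mu]_x (h x * balanced_kernel (x, y)) = \int[mu]_x h x - mean_primitive h y.
Proof.
move=> ih; under eq_Rintegral do rewrite balanced_kernel_sym mulrBr mulr1.
rewrite RintegralB // ?Rintegral_balanced_kernel //.
have := @integrableMl _ _ _ mu setT measurableT (EFin \o h) (fun x => balanced_kernel (y, x)).
apply => //.
  by apply: measurableT_comp measurable_balanced_kernel _; exact: measurable_fun_pair.
exists 1; split => // M M1 x _ /=; apply: le_trans (ltW M1).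
by rewrite /balanced_kernel /=; case: ifP => _; [|case: ifP => _]; rewrite ger0_norm; lra.
Qed.

Lemma balanced_kernel_le1 p : `|balanced_kernel p| <= 1.
Proof.
by rewrite /balanced_kernel /=; case: ifP => _; [|case: ifP => _]; rewrite ger0_norm; lra.
Qed.

Lemma measurable_balanced_kernel_l x :
  measurable_fun setT (fun y => balanced_kernel (x, y)).
Proof. by apply: measurableT_comp measurable_balanced_kernel _; exact: measurable_fun_pair. Qed.

Lemma measurable_balanced_kernel_r y :
  measurable_fun setT (fun x => balanced_kernel (x, y)).
Proof. by apply: measurableT_comp measurable_balanced_kernel _; exact: measurable_fun_pair. Qed.

Definition kernel_prod h g (p : measurableTypeR R * measurableTypeR R) :=
  h p.1 * g p.2 * balanced_kernel p.

Lemma integrable_kernel_prod h g : intble setT h -> intble setT g ->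
  (mu \x mu)%E.-integrable setT (EFin \o kernel_prod h g).
Proof.
move=> ih ig.
have mh : measurable_fun setT h by apply/measurable_EFinP; exact: measurable_int ih.
have mg : measurable_fun setT g by apply/measurable_EFinP; exact: measurable_int ig.
set f := kernel_prod h g.
have mf : measurable_fun setT f.
  apply: measurable_funM; last exact: measurable_balanced_kernel.
  apply: measurable_funM.
    exact: measurableT_comp mh _.
  exact: measurableT_comp mg _.
apply/integrable12ltyP; first exact/measurable_EFinP.
apply: (@le_lt_trans _ _ (\int[mu]_x (`|h x|%:E * \int[mu]_y (`|g y|%:E)))%E).
  apply: ge0_le_integral => //.
  - by move=> x _; apply: integral_ge0.
  - have mF : measurable_fun setT (EFin \o (fun p => `|f p|)).
      by apply/measurable_EFinP; exact: measurableT_comp.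
    have := @measurable_fun_fubini_tonelli_F _ _ _ _ R mu _ mF.
    by apply=> p; rewrite lee_fin.
  - apply: emeasurable_funM => //; apply/measurable_EFinP.
    exact: measurableT_comp.
  - move=> x _; rewrite -ge0_integralZl //.
      apply: ge0_le_integral => //=.
      - by apply/measurable_EFinP; apply: measurableT_comp => //;
          apply: measurableT_comp mf _; exact: measurable_fun_pair.
      - by apply/measurable_EFinP; apply: measurable_funM => //;
          apply: measurableT_comp.
      - by move=> y _; rewrite lee_fin /f /kernel_prod /= !normrM ler_piMr // ?balanced_kernel_le1.
    by apply/measurable_EFinP; apply: measurableT_comp.
under eq_integral do rewrite muleC.
have /integrableP[_] := ig; have /integrableP[_] := ih.
move=> hy gy; rewrite ge0_integralZl //; last 2 first.
- by apply/measurable_EFinP; apply: measurableT_comp.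
- by apply: integral_ge0.
by apply: lte_mul_pinfty => //;
  [exact: integral_ge0|rewrite ge0_fin_numE //; exact: integral_ge0].
Qed.

Lemma kernel_prod_int2 h g x : intble setT h -> intble setT g ->
  (\int[mu]_y (EFin \o kernel_prod h g) (x, y))%E = (h x * mean_primitive g x)%:E.
Proof.
move=> ih ig.
rewrite -Rintegral_balanced_kernel // -RintegralZl //; last by apply (integrable_mul_bounded measurableT ig (@measurable_balanced_kernel_l _) (fun y _ => balanced_kernel_le1 _)).
  rewrite /Rintegral fineK; last first.
    apply: integrable_fin_num => //.
    apply: (@integrableZl _ _ _ mu setT measurableT (h x) (EFin \o (fun y => g y * balanced_kernel (x, y)))).
    exact: (integrable_mul_bounded measurableT ig (@measurable_balanced_kernel_l _) (fun y _ => balanced_kernel_le1 _)).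
  by apply: eq_integral => y _; rewrite /kernel_prod /= mulrA.
Qed.

Lemma kernel_prod_int1 h g y : intble setT h -> intble setT g ->
  (\int[mu]_x (EFin \o kernel_prod h g) (x, y))%E =
    ((\int[mu]_x h x)%R * g y - mean_primitive h y * g y)%:E.
Proof.
move=> ih ig.
rewrite -mulrBl -Rintegral_balanced_kernel_tr // -RintegralZr //; last by apply (integrable_mul_bounded measurableT ih (@measurable_balanced_kernel_r _) (fun y _ => balanced_kernel_le1 _)).
  rewrite /Rintegral fineK; last first.
    apply: integrable_fin_num => //.
    apply: (@integrableZr _ _ _ mu setT measurableT (g y) (EFin \o (fun x => h x * balanced_kernel (x, y)))).
    exact: (integrable_mul_bounded measurableT ih (@measurable_balanced_kernel_r _) (fun y _ => balanced_kernel_le1 _)).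
  by apply: eq_integral => x _; rewrite /kernel_prod /= mulrAC.
Qed.

Lemma integrable_mean_primitive h g : intble setT h -> intble setT g ->
  intble setT (fun x => h x * mean_primitive g x).
Proof.
move=> ih ig; have := integrable_fubini_F (integrable_kernel_prod ih ig).
rewrite /fubini_F; apply: eq_integrable => // x _.
exact: kernel_prod_int2.
Qed.

(** Both sides compute the double integral of h(x) g(y) balanced_kernel(x, y),
    in the two orders of integration. Since the kernel treats the diagonal
    symmetrically, atoms produce no jump term. *)
Lemma Rintegral_by_parts h g : intble setT h -> intble setT g ->
  \int[mu]_x (h x * mean_primitive g x) =
  \int[mu]_x h x * \int[mu]_x g x - \int[mu]_x (mean_primitive h x * g x).
Proof.
move=> ih ig; rewrite {1}/Rintegral.
under eq_integral do rewrite -(kernel_prod_int2 _ ih ig).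
rewrite (Fubini (integrable_kernel_prod ih ig)).
under eq_integral do rewrite (kernel_prod_int1 _ ih ig).
rewrite -/(Rintegral mu setT (fun y => (\int[mu]_x h x)%R * g y - mean_primitive h y * g y)).
rewrite RintegralB ?RintegralZl //.
  by apply: (@integrableZl _ _ _ mu setT measurableT _ (EFin \o g)).
by under eq_fun do rewrite mulrC; exact: integrable_mean_primitive.
Qed.
End IBP.

(** * Functions of bounded variation *)

Section BV.
Context {R : realType}.
Implicit Types (f g : R -> R).

Lemma bounded_variation_ext a b f g : {in `[a, b], f =1 g} ->
  bounded_variation a b f -> bounded_variation a b g.
Proof.
move=> fg [M fM]; exists M => _ [s abs <-].
suff -> : variation a b g s = variation a b f s by apply: fM; exists s.
rewrite /variation !big_nat; apply: eq_bigr => k /andP[_ ks].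
have E m : (m < (size s).+1)%N -> g (nth b (a :: s) m) = f (nth b (a :: s) m).
  move=> ms; rewrite fg // in_itv /=.
  by rewrite itv_partition_nth_ge // itv_partition_nth_le.
by rewrite /= (E k.+1) // (E k) // ltnS ltnW.
Qed.

(** Jordan decomposition; clamping the argument to [a, b] makes the two parts
    monotone on the whole line, where the results on monotone functions
    apply. *)
Lemma bounded_variation_decomp a b f : a <= b -> bounded_variation a b f ->
  exists p n : R -> R, [/\ nondecreasing_fun p, nondecreasing_fun n &
    {in `[a, b], forall t, f t = p t - n t}].
Proof.
move=> ab bvf.
pose c t := Num.max a (Num.min t b).
have cin t : c t \in `[a, b].
  by rewrite in_itv /= /c le_max lexx /= ge_max ab /= ge_min lexx orbT.
have cmono s t : s <= t -> c s <= c t.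
  by move=> st; rewrite /c; apply: le_max2 => //; exact: le_min2.
exists ((fine \o pos_tv a f) \o c), ((fine \o neg_tv a f) \o c); split.
- move=> s t st; rewrite /= /pos_tv.
  by apply: (fine_neg_tv_nondecreasing (bounded_variationN bvf)) => //; exact: cmono.
- by move=> s t st; apply: (fine_neg_tv_nondecreasing bvf) => //; exact: cmono.
move=> t tab; have := bounded_variation_pos_neg_tvE bvf tab => /= ->.
suff -> : c t = t by [].
move: tab; rewrite in_itv /= => /andP[at_ tb].
by rewrite /c (min_idPl tb) (max_idPr at_).
Qed.

Lemma bounded_variation_bounded a b f : a <= b -> bounded_variation a b f ->
  exists M : R, forall t, t \in `[a, b] -> `|f t| <= M.
Proof.
move=> ab /(bounded_variation_decomp ab)[p [n [pm nm fE]]].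
exists (`|p a| + `|p b| + (`|n a| + `|n b|)) => t tab.
rewrite fE //; move: tab; rewrite in_itv /= => /andP[at_ tb].
apply: le_trans (ler_normB _ _) _; apply: lerD.
  have h1 := pm _ _ at_; have h2 := pm _ _ tb.
  rewrite ler_norml; have := ler_norm (p b); have := ler_norm (- p a).
  have := normr_ge0 (p a); have := normr_ge0 (p b); rewrite normrN.
  move=> ? ? ? ?; apply/andP; split; lra.
have h1 := nm _ _ at_; have h2 := nm _ _ tb.
rewrite ler_norml; have := ler_norm (n b); have := ler_norm (- n a).
have := normr_ge0 (n a); have := normr_ge0 (n b); rewrite normrN.
move=> ? ? ? ?; apply/andP; split; lra.
Qed.

Lemma bounded_variation_measurable a b f : a <= b -> bounded_variation a b f ->
  measurable_fun (`[a, b]%classic : set (measurableTypeR R)) f.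
Proof.
move=> ab /(bounded_variation_decomp ab)[p [n [pm nm fE]]].
apply: (@eq_measurable_fun _ _ _ _ _ (p \- n)).
  by move=> t /[!inE] tab; rewrite fE.
by apply: measurable_funB; apply: nondecreasing_measurable.
Qed.

Lemma nondecreasing_cvg_left (p : R -> R) (x : R) :
  nondecreasing_fun p -> cvg (p t @[t --> x^'-]).
Proof.
move=> pm; apply: nondecreasing_at_left_is_cvgr.
  by near=> y => s t _ _; exact: pm.
near=> y; exists (p x) => _ [t /= + <-].
by rewrite in_itv /= => /andP[_ /ltW]; exact: pm.
Unshelve. all: by end_near. Qed.

Lemma nondecreasing_cvg_right (p : R -> R) (x : R) :
  nondecreasing_fun p -> cvg (p t @[t --> x^'+]).
Proof.
move=> pm; apply: nondecreasing_at_right_is_cvgr.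
  by near=> y => s t _ _; exact: pm.
near=> y; exists (p x) => _ [t /= + <-].
by rewrite in_itv /= => /andP[/ltW + _]; exact: pm.
Unshelve. all: by end_near. Qed.

Lemma bounded_variation_cvg_left a b f x : a < x -> x <= b ->
  bounded_variation a b f -> cvg (f t @[t --> x^'-]).
Proof.
move=> ax xb bvf; have ab : a <= b by apply: (le_trans (ltW ax)).
have [p [n [pm nm fE]]] := bounded_variation_decomp ab bvf.
have /cvg_ex[lp plp] := @nondecreasing_cvg_left p x pm.
have /cvg_ex[ln pln] := @nondecreasing_cvg_left n x nm.
apply/cvg_ex; exists (lp - ln).
apply: cvg_trans (cvgB plp pln); apply: near_eq_cvg.
near=> t; rewrite [RHS]fE // in_itv /=; apply/andP; split.
  by apply: ltW; near: t; exact: nbhs_left_gt.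
by apply: le_trans xb; apply: ltW; near: t; exact: nbhs_left_lt.
Unshelve. all: by end_near. Qed.

Lemma bounded_variation_cvg_right a b f x : a <= x -> x < b ->
  bounded_variation a b f -> cvg (f t @[t --> x^'+]).
Proof.
move=> ax xb bvf; have ab : a <= b by apply: (le_trans ax (ltW _)).
have [p [n [pm nm fE]]] := bounded_variation_decomp ab bvf.
have /cvg_ex[lp plp] := @nondecreasing_cvg_right p x pm.
have /cvg_ex[ln pln] := @nondecreasing_cvg_right n x nm.
apply/cvg_ex; exists (lp - ln).
apply: cvg_trans (cvgB plp pln); apply: near_eq_cvg.
near=> t; rewrite [RHS]fE // in_itv /=; apply/andP; split.
  by apply: le_trans ax _; apply: ltW; near: t; exact: nbhs_right_gt.
by apply: ltW; near: t; exact: nbhs_right_lt.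
Unshelve. all: by end_near. Qed.

(** A right limit of f is also the right limit of its left-hand limits. For u
    of bounded variation this recovers u^+ from u^-. *)
Lemma cvg_right_of_left_limits f g x l :
  f t @[t --> x^'+] --> l ->
  (\forall t \near x^'+, f s @[s --> t^'-] --> g t) ->
  g t @[t --> x^'+] --> (l : R).
Proof.
move=> fl fg; apply/cvgrPdist_le => e e0.
have e20 : 0 < e / 2 by rewrite divr_gt0.
have [/= d d0 fe] := (cvgrPdist_le _ _).1 fl _ e20.
near=> t; have xt : x < t by near: t; exact: nbhs_right_gt.
have td : t < x + d by near: t; apply: nbhs_right_lt; lra.
have gt : f s @[s --> t^'-] --> g t by near: t; exact: fg.
near t^'- => s.
have xs : x < s by near: s; exact: nbhs_left_gt.
have st : s < t by near: s; exact: nbhs_left_lt.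
have h1 : `|l - f s| <= e / 2.
  by apply: fe => //=; rewrite /ball_ /= ltr_norml; apply/andP; split; lra.
have h2 : `|g t - f s| <= e / 2.
  near: s; exact: (cvgrPdist_le _ _).1.
rewrite -(subrKA (f s)) [e]splitr; apply: le_trans (ler_normD _ _) _.
by rewrite lerD // distrC.
Unshelve. all: by end_near. Qed.

End BV.

(** * Real primitives on an interval *)

Section PrimitiveReal.
Context {R : realType} (mu : {finite_measure set (measurableTypeR R) -> \bar R}).
Implicit Types (D A : set R) (h g : R -> R).
Local Notation intble D h := (mu.-integrable D (EFin \o h)).

Definition mean_primitive_from c h (x : R) : R :=
  2^-1 * (\int[mu]_(t in Iv true c x) h t + \int[mu]_(t in Iv false c x) h t).

Lemma Rintegral_Iv_nondecreasing h (c d : R) (b : bool) : (forall t, 0 <= h t) ->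
  intble (Iv true c d) h ->
  {in `]c, d[ &, {homo (fun x => \int[mu]_(t in Iv b c x) h t) : s t / s <= t}}.
Proof.
move=> h0 ih s t; rewrite !in_itv /= => /andP[cs sd] /andP[ct td] st.
have E : Iv b c t = Iv b c s `|` [set` Interval (BSide b s) (BSide b t)].
  by apply: itv_bndbnd_setU; case: b; rewrite bnd_simp // ltW.
rewrite [X in _ <= X](@Rintegral_itv_split _ mu _ (BSide b s)).
- by rewrite lerDl; apply: Rintegral_ge0.
- by case: b {E}; rewrite bnd_simp // ltW.
- by case: b {E}; rewrite bnd_simp.
by apply: integrableS ih => //; apply: Iv_sub => //; left.
Qed.

(** The positive and negative parts of h have monotone primitives. *)
Lemma bounded_variation_prim h (b : bool) c d s t : intble (Iv true c d) h ->
  c < s -> s <= t -> t < d ->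
  bounded_variation s t (fun x => \int[mu]_(y in Iv b c x) h y).
Proof.
move=> ih cs; rewrite le_eqVlt => /predU1P[<- _|st td].
  exact: bounded_variationxx.
have ip : intble (Iv true c d) h^\+ by exact: integrable_funrpos.
have iN : intble (Iv true c d) h^\- by exact: integrable_funrneg.
pose F g x := \int[mu]_(y in Iv b c x) g y.
apply: (@bounded_variation_ext _ _ _ (F h^\+ \+ (\- F h^\-))).
  move=> x; rewrite in_itv /= => /andP[sx xt].
  have sub : Iv b c x `<=` Iv true c d by apply: Iv_sub => //; left; exact: le_lt_trans td.
  rewrite /F /= -RintegralB; [|exact: measurable_Iv|exact: integrableS ip|exact: integrableS iN].
  by apply: eq_Rintegral => y _; rewrite -[in RHS](funrposBneg h).
have nd g : (forall t, 0 <= g t) -> intble (Iv true c d) g ->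
    bounded_variation s t (F g).
  move=> g0 ig; apply: nondecreasing_bounded_variation => x y xst yst.
  apply: (Rintegral_Iv_nondecreasing _ g0 ig); move: xst yst; rewrite !in_itv /=.
  - by move=> /andP[sx xt] _; rewrite (lt_le_trans cs sx) (le_lt_trans xt td).
  - by move=> _ /andP[sx xt]; rewrite (lt_le_trans cs sx) (le_lt_trans xt td).
apply: bounded_variationD => //; first by apply: nd => // x; exact: funrpos_ge0.
by apply: bounded_variationN; apply: nd => // x; exact: funrneg_ge0.
Qed.

Lemma mean_primitive_restrict b c t h x : Iv b c t x ->
  mean_primitive mu (h \_ (Iv b c t)) x = mean_primitive_from c h x.
Proof.
move=> /IvE[cx xt]; rewrite /mean_primitive /mean_primitive_from.
suff E b' : Rless b' x `&` Iv b c t = Iv b' c x by rewrite -!Rintegral_mkcondr !E.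
apply/seteqP; split => s.
  by move=> [/RlessE sx /IvE[cs _]]; apply/IvE.
move=> /IvE[cs sx]; split; first exact/RlessE.
apply/IvE; split => //.
by move: b xt => [] xt; move: b' sx => [] sx; lra.
Qed.

Lemma integrable_restrictT D h : measurable (D : set (measurableTypeR R)) ->
  intble D h -> intble setT (h \_ D).
Proof.
by move=> mD ih; rewrite -restrict_EFin; apply/(integrable_mkcond _ mD).
Qed.

Lemma integrable_mean_primitive_from b c t h g :
  intble (Iv b c t) h -> intble (Iv b c t) g ->
  intble (Iv b c t) (fun x => h x * mean_primitive_from c g x).
Proof.
move=> ih ig; have mD := measurable_Iv b c t.
have := integrable_mean_primitive (integrable_restrictT mD ih) (integrable_restrictT mD ig).
move=> /(integrableS measurableT mD (@subsetT _ _)).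
apply: eq_integrable => // x; rewrite inE => Dx.
by rewrite /= mean_primitive_restrict // patchE mem_set.
Qed.

Lemma Rintegral_by_parts_Iv b c t h g :
  intble (Iv b c t) h -> intble (Iv b c t) g ->
  \int[mu]_(x in Iv b c t) h x * \int[mu]_(x in Iv b c t) g x =
  \int[mu]_(x in Iv b c t) (h x * mean_primitive_from c g x) +
  \int[mu]_(x in Iv b c t) (mean_primitive_from c h x * g x).
Proof.
move=> ih ig; have mD := measurable_Iv b c t.
have := Rintegral_by_parts (integrable_restrictT mD ih) (integrable_restrictT mD ig).
rewrite -!Rintegral_mkcond => /esym/eqP; rewrite subr_eq => /eqP ->.
rewrite [in RHS]Rintegral_mkcond [X in _ = _ + X]Rintegral_mkcond.
congr (_ + _); apply: eq_Rintegral => x _; rewrite !patchE.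
  case: ifPn => [/set_mem Dx|_]; last by rewrite mul0r.
  by rewrite (mean_primitive_restrict _ Dx).
case: ifPn => [/set_mem Dx|_]; last by rewrite mulr0.
by rewrite (mean_primitive_restrict _ Dx).
Qed.
End PrimitiveReal.

(** * Complex matrices in real coordinates *)

Section Parts.
Context {R : realType}.
Implicit Types (z w : R[i]).

(** Imaginary part for true, real part for false. Indexing the two parts by a
    boolean lets every entrywise statement be proved once. *)
Definition cpart (b : bool) z : R := if b then complex.Im z else complex.Re z.

Lemma cpart_inj z w : (forall b, cpart b z = cpart b w) -> z = w.
Proof.
move=> E; have := E true; have := E false; rewrite /cpart.
by case: z w {E} => [? ?] [? ?] /= -> ->.
Qed.

Lemma cpartD b z w : cpart b (z + w) = cpart b z + cpart b w.
Proof. by case: b z w => -[? ?] []. Qed.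

Lemma cpartN b z : cpart b (- z) = - cpart b z.
Proof. by case: b z => -[]. Qed.

Lemma cpart0 b : cpart b 0 = 0.
Proof. by case: b. Qed.

Lemma cpart_sum b I (r : seq I) (P : pred I) (F : I -> R[i]) :
  cpart b (\sum_(i <- r | P i) F i) = \sum_(i <- r | P i) cpart b (F i).
Proof. exact: (big_morph _ (cpartD b) (cpart0 b)). Qed.

(** The sign in front of the product of the c-part of z and the (b + c)-part
    of w in the b-part of z w; it is -1 only for the product of two imaginary
    parts. *)
Definition csgn (b c : bool) : R := if c && ~~ b then -1 else 1.

Lemma cpartM b z w :
  cpart b (z * w) = \sum_(c : bool) csgn b c * (cpart c z * cpart (b (+) c) w).
Proof.
rewrite big_bool /csgn; case: b z w => -[x y] [x' y'] /=; ring.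
Qed.

Lemma cpart_real b (r : R) z : cpart b (r%:C * z) = r * cpart b z.
Proof. by case: b z => -[x y] /=; ring. Qed.

Lemma cpart_conjC b z :
  cpart b (Num.conj z) = if b then - cpart b z else cpart b z.
Proof. by case: b z => -[x y]. Qed.

Lemma half_real : (2^-1 : R[i]) = (2^-1)%:C.
Proof. by rewrite fmorphV /= rmorph_nat. Qed.

Lemma cpart_half b z : cpart b (2^-1 * z) = 2^-1 * cpart b z.
Proof. by rewrite half_real cpart_real. Qed.

Lemma ctr_mxE m n (A : 'M[R[i]]_(m, n)) i j b :
  cpart b (A ^t* i j) = if b then - cpart b (A j i) else cpart b (A j i).
Proof. by rewrite !mxE cpart_conjC. Qed.

Lemma mx_parts m n (A B : 'M[R[i]]_(m, n)) :
  (forall i j b, cpart b (A i j) = cpart b (B i j)) -> A = B.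
Proof. by move=> E; apply/matrixP => i j; apply: cpart_inj => b. Qed.

(** A complex matrix product is a real bilinear expression in the coordinates,
    so real statements on products carry over term by term. *)
Lemma cpart_mulmx m n p (A : 'M[R[i]]_(m, n)) (B : 'M[R[i]]_(n, p)) i j b :
  cpart b ((A *m B) i j) =
  \sum_(e : 'I_n * bool) csgn b e.2 * (cpart e.2 (A i e.1) * cpart (b (+) e.2) (B e.1 j)).
Proof.
rewrite mxE cpart_sum; under eq_bigr do rewrite cpartM.
by rewrite pair_big.
Qed.

(** The real l^1 norm of all coordinates. It is real-valued, unlike the
    canonical complex norm, and directly compatible with entrywise
    integrability. *)
Definition norm1 m n (A : 'M[R[i]]_(m, n)) : R :=
  \sum_(e : 'I_m * 'I_n * bool) `|cpart e.2 (A e.1.1 e.1.2)|.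

Lemma norm1_ge0 m n (A : 'M[R[i]]_(m, n)) : 0 <= norm1 A.
Proof. exact: sumr_ge0. Qed.

Lemma le_norm1 m n (A : 'M[R[i]]_(m, n)) i j b : `|cpart b (A i j)| <= norm1 A.
Proof. by rewrite /norm1 (bigD1 (i, j, b)) //= lerDl sumr_ge0. Qed.

Lemma norm1_le m n (A : 'M[R[i]]_(m, n)) (M : R) :
  (forall i j b, `|cpart b (A i j)| <= M) -> norm1 A <= M *+ #|{: 'I_m * 'I_n * bool}|.
Proof.
by move=> h; rewrite -sumr_const; apply: ler_sum => -[[i j] b] _; exact: h.
Qed.

Lemma norm1D m n (A B : 'M[R[i]]_(m, n)) : norm1 (A + B) <= norm1 A + norm1 B.
Proof.
by rewrite -big_split; apply: ler_sum => e _; rewrite mxE cpartD ler_normD.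
Qed.

Lemma norm1N m n (A : 'M[R[i]]_(m, n)) : norm1 (- A) = norm1 A.
Proof. by apply: eq_bigr => e _; rewrite mxE cpartN normrN. Qed.

Lemma norm1B m n (A B : 'M[R[i]]_(m, n)) : norm1 (A - B) <= norm1 A + norm1 B.
Proof. by rewrite -(norm1N B); exact: norm1D. Qed.

Lemma norm1_half m n (A : 'M[R[i]]_(m, n)) : norm1 (2^-1 *: A) = 2^-1 * norm1 A.
Proof.
rewrite /norm1 mulr_sumr; apply: eq_bigr => e _.
by rewrite mxE cpart_half normrM ger0_norm.
Qed.

Lemma norm1M m n p : exists2 K : R, 0 < K &
  forall (A : 'M[R[i]]_(m, n)) (B : 'M[R[i]]_(n, p)),
    norm1 (A *m B) <= K * (norm1 A * norm1 B).
Proof.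
exists ((#|{: 'I_n * bool}| * #|{: 'I_m * 'I_p * bool}|)%:R + 1).
  by rewrite ltr_wpDl.
move=> A B; rewrite mulrDl mul1r ler_wpDr ?mulr_ge0 ?norm1_ge0 //.
rewrite mulr_natl mulrnA; apply: norm1_le => i j b.
rewrite cpart_mulmx -sumr_const; apply: le_trans (ler_norm_sum _ _ _) _.
apply: ler_sum => e _; rewrite !normrM.
have -> : `|csgn b e.2| = 1 by rewrite /csgn; case: ifP; rewrite ?normrN normr1.
by rewrite mul1r ler_pM // le_norm1.
Qed.

End Parts.

(** * Matrix-valued integrals *)

Section MatrixIntegral.
Context {R : realType}.
Variable mu : {measure set (measurableTypeR R) -> \bar R}.
Implicit Types (D A : set R).
Local Notation intble D h := (mu.-integrable D (EFin \o h)).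
Local Notation msr D := (measurable (D : set (measurableTypeR R))).

Lemma Rintegral_sum D I (r : seq I) (F : I -> R -> R) : msr D ->
  (forall i, intble D (F i)) ->
  intble D (fun t => \sum_(i <- r) F i t) /\
  \int[mu]_(t in D) (\sum_(i <- r) F i t) = \sum_(i <- r) \int[mu]_(t in D) F i t.
Proof.
move=> mD iF; elim: r => [|i r [ih1 ih2]].
  split; last by rewrite big_nil (_ : (fun=> _) = cst 0) ?Rintegral_cst ?mul0r //;
    apply/funext => t; rewrite big_nil.
  by under eq_fun do rewrite big_nil; exact: integrable0.
have E : (fun t => \sum_(j <- i :: r) F j t) = (fun t => F i t + \sum_(j <- r) F j t).
  by apply/funext => t; rewrite big_cons.
rewrite E big_cons RintegralD // ih2; split => //.
exact: (integrableD mD (iF i) ih1).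
Qed.

Lemma mx_integrableP m n D (u : R -> 'M[R[i]]_(m, n)) :
  mx_integrable mu D u <-> forall i j b, intble D (fun t => cpart b (u t i j)).
Proof.
split=> h i j; first by case; case: (h i j).
by split; [exact: (h i j false)|exact: (h i j true)].
Qed.

Lemma mx_measurableP m n D (u : R -> 'M[R[i]]_(m, n)) :
  mx_measurable D u <-> forall i j b,
    measurable_fun (D : set (measurableTypeR R)) (fun t => cpart b (u t i j)).
Proof.
split=> h i j; first by case; case: (h i j).
by split; [exact: (h i j false)|exact: (h i j true)].
Qed.

Lemma cpart_mx_int m n D (u : R -> 'M[R[i]]_(m, n)) i j b :
  cpart b (mx_int mu D u i j) = \int[mu]_(t in D) cpart b (u t i j).
Proof. by rewrite mxE; case: b. Qed.

Lemma mx_int_ext m n D (u v : R -> 'M[R[i]]_(m, n)) :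
  (forall t, D t -> u t = v t) -> mx_int mu D u = mx_int mu D v.
Proof.
move=> E; apply: mx_parts => i j b; rewrite !cpart_mx_int.
by apply: eq_Rintegral => t /[!inE] /E ->.
Qed.

Lemma mx_integrable_ext m n D (u v : R -> 'M[R[i]]_(m, n)) : msr D ->
  (forall t, D t -> u t = v t) -> mx_integrable mu D u -> mx_integrable mu D v.
Proof.
move=> mD E /mx_integrableP iu; apply/mx_integrableP => i j b.
by apply: eq_integrable (iu i j b) => // t /[!inE] /E /= ->.
Qed.

Lemma mx_integrable_measurable m n D (u : R -> 'M[R[i]]_(m, n)) :
  mx_integrable mu D u -> mx_measurable D u.
Proof.
move=> /mx_integrableP iu; apply/mx_measurableP => i j b.
by apply/measurable_EFinP; exact: measurable_int (iu i j b).
Qed.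

Lemma mx_integrableS m n D A (u : R -> 'M[R[i]]_(m, n)) : msr D -> msr A ->
  A `<=` D -> mx_integrable mu D u -> mx_integrable mu A u.
Proof.
move=> mD mA AD /mx_integrableP iu; apply/mx_integrableP => i j b.
exact: integrableS (iu i j b).
Qed.

Lemma mx_integrableD m n D (u v : R -> 'M[R[i]]_(m, n)) : msr D ->
  mx_integrable mu D u -> mx_integrable mu D v ->
  mx_integrable mu D (fun t => u t + v t).
Proof.
move=> mD /mx_integrableP iu /mx_integrableP iv; apply/mx_integrableP => i j b.
under eq_fun do rewrite mxE cpartD.
exact: (integrableD mD (iu i j b) (iv i j b)).
Qed.

Lemma mx_integrableN m n D (u : R -> 'M[R[i]]_(m, n)) : msr D ->
  mx_integrable mu D u -> mx_integrable mu D (fun t => - u t).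
Proof.
move=> mD /mx_integrableP iu; apply/mx_integrableP => i j b.
under eq_fun do rewrite mxE cpartN.
exact: (integrableN (iu i j b)).
Qed.

Lemma mx_integrableB m n D (u v : R -> 'M[R[i]]_(m, n)) : msr D ->
  mx_integrable mu D u -> mx_integrable mu D v ->
  mx_integrable mu D (fun t => u t - v t).
Proof. by move=> mD iu iv; apply: mx_integrableD => //; exact: mx_integrableN. Qed.

Lemma mx_intD m n D (u v : R -> 'M[R[i]]_(m, n)) : msr D ->
  mx_integrable mu D u -> mx_integrable mu D v ->
  mx_int mu D (fun t => u t + v t) = mx_int mu D u + mx_int mu D v.
Proof.
move=> mD /mx_integrableP iu /mx_integrableP iv; apply: mx_parts => i j b.
rewrite [in RHS]mxE cpartD !cpart_mx_int -RintegralD //.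
by apply: eq_Rintegral => t _; rewrite mxE cpartD.
Qed.

Lemma mx_intN m n D (u : R -> 'M[R[i]]_(m, n)) : msr D ->
  mx_integrable mu D u -> mx_int mu D (fun t => - u t) = - mx_int mu D u.
Proof.
move=> mD /mx_integrableP iu; apply: mx_parts => i j b.
rewrite [in RHS]mxE cpartN !cpart_mx_int -mulN1r -RintegralZl //.
by apply: eq_Rintegral => t _; rewrite mxE cpartN mulN1r.
Qed.

Lemma mx_intB m n D (u v : R -> 'M[R[i]]_(m, n)) : msr D ->
  mx_integrable mu D u -> mx_integrable mu D v ->
  mx_int mu D (fun t => u t - v t) = mx_int mu D u - mx_int mu D v.
Proof.
by move=> mD iu iv; rewrite mx_intD // ?mx_intN //; exact: mx_integrableN.
Qed.

Lemma mx_int_ctr m n D (u : R -> 'M[R[i]]_(m, n)) : msr D ->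
  mx_integrable mu D u -> mx_int mu D (fun t => (u t) ^t*) = (mx_int mu D u) ^t*.
Proof.
move=> mD /mx_integrableP iu; apply: mx_parts => i j b.
rewrite ctr_mxE !cpart_mx_int; under eq_Rintegral do rewrite ctr_mxE.
case: b => //; rewrite -[RHS]mulN1r -RintegralZl //.
by apply: eq_Rintegral => t _; rewrite mulN1r.
Qed.

Lemma mx_integrable_ctr m n D (u : R -> 'M[R[i]]_(m, n)) : msr D ->
  mx_integrable mu D u -> mx_integrable mu D (fun t => (u t) ^t*).
Proof.
move=> mD /mx_integrableP iu; apply/mx_integrableP => i j b.
under eq_fun do rewrite ctr_mxE.
case: b; last exact: (iu j i false).
exact: (integrableN (iu j i true)).
Qed.

Lemma mx_measurable_ctr m n D (u : R -> 'M[R[i]]_(m, n)) : msr D ->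
  mx_measurable D u -> mx_measurable D (fun t => (u t) ^t*).
Proof.
move=> mD /mx_measurableP iu; apply/mx_measurableP => i j b.
under eq_fun do rewrite ctr_mxE.
case: b; last by have := iu j i false.
by have := iu j i true; exact: measurable_funN.
Qed.

Lemma mx_measurableM m n p D (u : R -> 'M[R[i]]_(m, n))
    (v : R -> 'M[R[i]]_(n, p)) :
  mx_measurable D u -> mx_measurable D v -> mx_measurable D (fun t => u t *m v t).
Proof.
move=> /mx_measurableP mu_ /mx_measurableP mv; apply/mx_measurableP => i j b.
under eq_fun do rewrite cpart_mulmx.
apply: measurable_sum => e.
apply: measurable_funM; first exact: measurable_cst.
by apply: measurable_funM.
Qed.

Lemma mx_integrable_bddl m n p D (u : R -> 'M[R[i]]_(m, n))
    (v : R -> 'M[R[i]]_(n, p)) (M : R) : msr D ->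
  mx_measurable D u -> (forall t, D t -> norm1 (u t) <= M) ->
  mx_integrable mu D v -> mx_integrable mu D (fun t => u t *m v t).
Proof.
move=> mD /mx_measurableP mu_ bu /mx_integrableP iv; apply/mx_integrableP => i j b.
under eq_fun do rewrite cpart_mulmx.
apply: (Rintegral_sum _ mD _).1 => e.
apply: (@integrableZl _ _ _ mu D mD _ (EFin \o _)).
suff : intble D (fun t => cpart (b (+) e.2) (v t e.1 j) * cpart e.2 (u t i e.1)).
  by apply: eq_integrable => // t _ /=; rewrite mulrC.
apply: (@integrable_mul_bounded _ _ _ _ _ M) => // t Dt.
exact: le_trans (le_norm1 _ _ _ _) (bu _ Dt).
Qed.

Lemma mx_integrable_bddr m n p D (u : R -> 'M[R[i]]_(m, n))
    (v : R -> 'M[R[i]]_(n, p)) (M : R) : msr D ->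
  mx_integrable mu D u ->
  mx_measurable D v -> (forall t, D t -> norm1 (v t) <= M) ->
  mx_integrable mu D (fun t => u t *m v t).
Proof.
move=> mD /mx_integrableP iu /mx_measurableP mv bv; apply/mx_integrableP => i j b.
under eq_fun do rewrite cpart_mulmx.
apply: (Rintegral_sum _ mD _).1 => e.
apply: (@integrableZl _ _ _ mu D mD _ (EFin \o _)).
apply: (@integrable_mul_bounded _ _ _ _ _ M) => // t Dt.
exact: le_trans (le_norm1 _ _ _ _) (bv _ Dt).
Qed.

Lemma mx_integrableMl m n p D (A : 'M[R[i]]_(m, n)) (v : R -> 'M[R[i]]_(n, p)) :
  msr D ->
  mx_integrable mu D v -> mx_integrable mu D (fun t => A *m v t).
Proof.
move=> mD; apply: (@mx_integrable_bddl _ _ _ _ _ _ (norm1 A)) => //.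
Qed.

Lemma mx_integrableMr m n p D (B : 'M[R[i]]_(n, p)) (u : R -> 'M[R[i]]_(m, n)) :
  msr D ->
  mx_integrable mu D u -> mx_integrable mu D (fun t => u t *m B).
Proof.
move=> mD iu; apply: (@mx_integrable_bddr _ _ _ _ _ _ (norm1 B)) => //.
Qed.

Lemma mx_intMl m n p D (A : 'M[R[i]]_(m, n)) (v : R -> 'M[R[i]]_(n, p)) : msr D ->
  mx_integrable mu D v -> mx_int mu D (fun t => A *m v t) = A *m mx_int mu D v.
Proof.
move=> mD /mx_integrableP iv; apply: mx_parts => i j b.
rewrite cpart_mx_int cpart_mulmx; under eq_Rintegral do rewrite cpart_mulmx.
have iF (e : 'I_n * bool) : intble D (fun t => csgn b e.2 *
    (cpart e.2 (A i e.1) * cpart (b (+) e.2) (v t e.1 j))).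
  apply: (@integrableZl _ _ _ mu D mD _ (EFin \o _)).
  by apply: (@integrableZl _ _ _ mu D mD _ (EFin \o _)).
rewrite (Rintegral_sum _ mD iF).2; apply: eq_bigr => e _.
rewrite RintegralZl //; last by apply: (@integrableZl _ _ _ mu D mD _ (EFin \o _)).
by rewrite RintegralZl // cpart_mx_int.
Qed.

Lemma mx_intMr m n p D (B : 'M[R[i]]_(n, p)) (u : R -> 'M[R[i]]_(m, n)) : msr D ->
  mx_integrable mu D u -> mx_int mu D (fun t => u t *m B) = mx_int mu D u *m B.
Proof.
move=> mD /mx_integrableP iu; apply: mx_parts => i j b.
rewrite cpart_mx_int cpart_mulmx; under eq_Rintegral do rewrite cpart_mulmx.
have iF (e : 'I_n * bool) : intble D (fun t => csgn b e.2 *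
    (cpart e.2 (u t i e.1) * cpart (b (+) e.2) (B e.1 j))).
  apply: (@integrableZl _ _ _ mu D mD _ (EFin \o _)).
  by apply: (@integrableZr _ _ _ mu D mD _ (EFin \o _)).
rewrite (Rintegral_sum _ mD iF).2; apply: eq_bigr => e _.
rewrite RintegralZl //; last by apply: (@integrableZr _ _ _ mu D mD _ (EFin \o _)).
by rewrite RintegralZr // cpart_mx_int.
Qed.

Lemma mx_integrable_norm1 m n D (u : R -> 'M[R[i]]_(m, n)) : msr D ->
  mx_integrable mu D u -> intble D (fun t => norm1 (u t)).
Proof.
move=> mD /mx_integrableP iu; apply: (Rintegral_sum _ mD _).1 => e.
exact: integrable_norm.
Qed.

Lemma norm1_mx_int m n D (u : R -> 'M[R[i]]_(m, n)) : msr D ->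
  mx_integrable mu D u ->
  norm1 (mx_int mu D u) <= \int[mu]_(t in D) norm1 (u t).
Proof.
move=> mD /mx_integrableP iu; rewrite (Rintegral_sum _ mD _).2; last first.
  by move=> e; exact: integrable_norm.
by apply: ler_sum => e _; rewrite cpart_mx_int le_normr_Rintegral.
Qed.

Lemma mx_int_split m n (a x y : itv_bound R) (u : R -> 'M[R[i]]_(m, n)) :
  (a <= x)%O -> (x <= y)%O -> mx_integrable mu [set` Interval a y] u ->
  mx_int mu [set` Interval a y] u =
  mx_int mu [set` Interval a x] u + mx_int mu [set` Interval x y] u.
Proof.
move=> ax xy /mx_integrableP iu; apply: mx_parts => i j b.
by rewrite [in RHS]mxE cpartD !cpart_mx_int -Rintegral_itv_split.
Qed.

Lemma mx_int_set1 m n (x : R) (u : R -> 'M[R[i]]_(m, n)) :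
  mx_int mu [set x] u = (fine (mu [set x]))%:C *: u x.
Proof.
apply: mx_parts => i j b.
by rewrite [in RHS]mxE cpart_real cpart_mx_int Rintegral_set1E.
Qed.

End MatrixIntegral.

(** * One-sided limits of matrix functions *)

Section OneSidedLimits.
Context {R : realType} {m n : nat}.
Implicit Types (u v : R -> 'M[R[i]]_(m, n)) (l : 'M[R[i]]_(m, n)) (x : R).

Definition cvg_mx_left u x l : Prop := forall i j b,
  cpart b (u t i j) @[t --> x^'-] --> cpart b (l i j).
Definition cvg_mx_right u x l : Prop := forall i j b,
  cpart b (u t i j) @[t --> x^'+] --> cpart b (l i j).

Lemma cvg_mx_rightP u x l : cvg_right u x l <-> cvg_mx_right u x l.
Proof.
split=> h i j; first by case; case: (h i j).
by split; [exact: (h i j false)|exact: (h i j true)].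
Qed.

Lemma cvg_mx_left_llim u x l : cvg_mx_left u x l -> llim u x = l.
Proof.
move=> h; apply: mx_parts => i j b; rewrite mxE.
have := h i j true; have := h i j false.
by case: b => /= ? ?; exact: cvg_lim.
Qed.

Lemma cvg_mx_right_rlim u x l : cvg_mx_right u x l -> rlim u x = l.
Proof.
move=> h; apply: mx_parts => i j b; rewrite mxE.
have := h i j true; have := h i j false.
by case: b => /= ? ?; exact: cvg_lim.
Qed.

Lemma cvg_mx_left_near u v x l :
    (\forall t \near x^'-, u t = v t) -> cvg_mx_left u x l -> cvg_mx_left v x l.
Proof.
move=> uv h i j b; apply: cvg_trans (h i j b); apply: near_eq_cvg.
by apply: filterS uv => t ->.
Qed.

Lemma cvg_mx_right_near u v x l :
    (\forall t \near x^'+, u t = v t) -> cvg_mx_right u x l -> cvg_mx_right v x l.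
Proof.
move=> uv h i j b; apply: cvg_trans (h i j b); apply: near_eq_cvg.
by apply: filterS uv => t ->.
Qed.

Lemma cvg_mx_leftD u v x l k :
  cvg_mx_left u x l -> cvg_mx_left v x k -> cvg_mx_left (fun t => u t + v t) x (l + k).
Proof.
by move=> hu hv i j b; under eq_fun do rewrite mxE cpartD; rewrite mxE cpartD; apply: cvgD.
Qed.

Lemma cvg_mx_rightD u v x l k :
  cvg_mx_right u x l -> cvg_mx_right v x k -> cvg_mx_right (fun t => u t + v t) x (l + k).
Proof.
by move=> hu hv i j b; under eq_fun do rewrite mxE cpartD; rewrite mxE cpartD; apply: cvgD.
Qed.

Lemma cvg_mx_left_half u x l :
  cvg_mx_left u x l -> cvg_mx_left (fun t => 2^-1 *: u t) x (2^-1 *: l).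
Proof.
by move=> hu i j b; under eq_fun do rewrite mxE cpart_half; rewrite mxE cpart_half;
  apply: cvgMr.
Qed.

Lemma cvg_mx_right_half u x l :
  cvg_mx_right u x l -> cvg_mx_right (fun t => 2^-1 *: u t) x (2^-1 *: l).
Proof.
by move=> hu i j b; under eq_fun do rewrite mxE cpart_half; rewrite mxE cpart_half;
  apply: cvgMr.
Qed.

Lemma cvg_mx_left_cst x l : cvg_mx_left (fun=> l) x l.
Proof. by move=> i j b; exact: cvg_cst. Qed.

Lemma cvg_mx_right_cst x l : cvg_mx_right (fun=> l) x l.
Proof. by move=> i j b; exact: cvg_cst. Qed.

Lemma halfD (A : 'M[R[i]]_(m, n)) : 2^-1 *: (A + A) = A.
Proof.
have -> : A + A = (2%:R : R[i]) *: A by rewrite scaler_nat mulr2n.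
by rewrite scalerA mulVf ?scale1r // pnatr_eq0.
Qed.

End OneSidedLimits.

(** * Balanced primitives *)

Section Primitive.
Context {R : realType} (mu : {finite_measure set (measurableTypeR R) -> \bar R}).
Implicit Types (D A : set R) (c d s t : R).
Local Notation intble D h := (mu.-integrable D (EFin \o h)).

Definition prim {m n} c (h : R -> 'M[R[i]]_(m, n)) (b : bool) t :
  'M[R[i]]_(m, n) :=
  mx_int mu (Iv b c t) h.

Definition balanced_prim {m n} c (h : R -> 'M[R[i]]_(m, n)) t : 'M[R[i]]_(m, n) :=
  2^-1 *: (prim c h true t + prim c h false t).

Lemma cpart_balanced_prim m n c (h : R -> 'M[R[i]]_(m, n)) t i j b :
  cpart b (balanced_prim c h t i j) = mean_primitive_from mu c (fun t => cpart b (h t i j)) t.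
Proof. by rewrite mxE cpart_half mxE cpartD !cpart_mx_int. Qed.

(** Integration by parts in each pair of real coordinates, summed with the
    signs of the matrix product. *)
Lemma mx_int_by_parts m n p b c t (f : R -> 'M[R[i]]_(m, n))
    (g : R -> 'M[R[i]]_(n, p)) :
  mx_integrable mu (Iv b c t) f -> mx_integrable mu (Iv b c t) g ->
  [/\ mx_integrable mu (Iv b c t) (fun x => f x *m balanced_prim c g x),
      mx_integrable mu (Iv b c t) (fun x => balanced_prim c f x *m g x) &
      prim c f b t *m prim c g b t =
      mx_int mu (Iv b c t) (fun x => f x *m balanced_prim c g x) +
      mx_int mu (Iv b c t) (fun x => balanced_prim c f x *m g x)].
Proof.
move=> /mx_integrableP if_ /mx_integrableP ig; have mD := measurable_Iv b c t.
have i1 i j b' (e : 'I_n * bool) : intble (Iv b c t) (fun x => csgn b' e.2 *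
    (cpart e.2 (f x i e.1) * cpart (b' (+) e.2) (balanced_prim c g x e.1 j))).
  apply: (@integrableZl _ _ _ mu _ mD _ (EFin \o _)).
  under eq_fun do rewrite cpart_balanced_prim.
  exact: (integrable_mean_primitive_from (if_ _ _ _) (ig _ _ _)).
have i2 i j b' (e : 'I_n * bool) : intble (Iv b c t) (fun x => csgn b' e.2 *
    (cpart e.2 (balanced_prim c f x i e.1) * cpart (b' (+) e.2) (g x e.1 j))).
  apply: (@integrableZl _ _ _ mu _ mD _ (EFin \o _)).
  suff : intble (Iv b c t) (fun x => cpart (b' (+) e.2) (g x e.1 j) * cpart e.2 (balanced_prim c f x i e.1)).
    by apply: eq_integrable => // x _ /=; rewrite mulrC.
  under eq_fun do rewrite cpart_balanced_prim.
  exact: (integrable_mean_primitive_from (ig _ _ _) (if_ _ _ _)).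
split.
- apply/mx_integrableP => i j b'; under eq_fun do rewrite cpart_mulmx.
  exact: (Rintegral_sum _ mD (i1 i j b')).1.
- apply/mx_integrableP => i j b'; under eq_fun do rewrite cpart_mulmx.
  exact: (Rintegral_sum _ mD (i2 i j b')).1.
apply: mx_parts => i j b'; rewrite [in RHS]mxE cpartD !cpart_mx_int cpart_mulmx.
under eq_Rintegral do rewrite cpart_mulmx.
under [X in _ = _ + X]eq_Rintegral do rewrite cpart_mulmx.
rewrite (Rintegral_sum _ mD (i1 i j b')).2 (Rintegral_sum _ mD (i2 i j b')).2.
rewrite -big_split; apply: eq_bigr => e _ /=.
rewrite !cpart_mx_int (Rintegral_by_parts_Iv (if_ _ _ _) (ig _ _ _)) mulrDr.
under [X in _ = X + _]eq_Rintegral do rewrite cpart_balanced_prim.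
under [X in _ = _ + X]eq_Rintegral do rewrite cpart_balanced_prim.
rewrite !RintegralZl //; last exact: (integrable_mean_primitive_from (if_ _ _ _) (ig _ _ _)).
suff : intble (Iv b c t) (fun x => cpart (b' (+) e.2) (g x e.1 j) *
    mean_primitive_from mu c (fun t0 => cpart e.2 (f t0 i e.1)) x).
  by apply: eq_integrable => // x _ /=; rewrite mulrC.
exact: (integrable_mean_primitive_from (ig _ _ _) (if_ _ _ _)).
Qed.

Lemma sub_IvT (b : bool) c d t :
  t < d \/ (b /\ t <= d) -> Iv b c t `<=` Iv true c d.
Proof.
case=> [td|[bT td]]; apply: Iv_sub => //; first by left.
by right; split.
Qed.

(** Leibniz rule for balanced primitives: the derivative of the product is f G
    + F g with F and G at their balanced values, while the product on the left
    is taken at either one-sided limit. *)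
Lemma product_rule m n p (b : bool) c t (lf : 'M[R[i]]_(m, n))
    (lg : 'M[R[i]]_(n, p))
    (f : R -> 'M[R[i]]_(m, n)) (g : R -> 'M[R[i]]_(n, p)) :
  mx_integrable mu (Iv b c t) f -> mx_integrable mu (Iv b c t) g ->
  (lf + prim c f b t) *m (lg + prim c g b t) =
  lf *m lg + prim c (fun x => f x *m (lg + balanced_prim c g x) + (lf + balanced_prim c f x) *m g x) b t
  /\ mx_integrable mu (Iv b c t)
       (fun x => f x *m (lg + balanced_prim c g x) + (lf + balanced_prim c f x) *m g x).
Proof.
move=> if_ ig; have mD := measurable_Iv b c t.
have [i1 i2 E] := mx_int_by_parts if_ ig.
have i3 : mx_integrable mu (Iv b c t) (fun x => f x *m lg) by exact: mx_integrableMr.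
have i4 : mx_integrable mu (Iv b c t) (fun x => lf *m g x) by exact: mx_integrableMl.
have i13 := mx_integrableD mD i3 i1.
have i24 := mx_integrableD mD i4 i2.
have E1 : (fun x => f x *m (lg + balanced_prim c g x) + (lf + balanced_prim c f x) *m g x) =
    (fun x => (f x *m lg + f x *m balanced_prim c g x) + (lf *m g x + balanced_prim c f x *m g x)).
  by apply/funext => x; rewrite mulmxDr mulmxDl.
rewrite E1; split; last exact: mx_integrableD.
rewrite [X in _ = _ + X]/prim mx_intD // mx_intD // mx_intD //.
rewrite mx_intMr // mx_intMl // mulmxDr !mulmxDl E /prim -!addrA.
by congr (_ + (_ + _)); rewrite addrCA.
Qed.

Lemma prim_cvg_left m n (b : bool) c d y (h : R -> 'M[R[i]]_(m, n)) :
  c < y -> y <= d ->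
  mx_integrable mu (Iv true c d) h -> cvg_mx_left (prim c h b) y (prim c h true y).
Proof.
move=> cy yd /mx_integrableP ih i j b'; rewrite cpart_mx_int.
under eq_fun do rewrite cpart_mx_int.
exact: (cvg_Iv_left b cy yd (ih i j b')).
Qed.

Lemma prim_cvg_right m n (b : bool) c d y (h : R -> 'M[R[i]]_(m, n)) :
  c <= y -> y < d ->
  mx_integrable mu (Iv true c d) h -> cvg_mx_right (prim c h b) y (prim c h false y).
Proof.
move=> cy yd /mx_integrableP ih i j b'; rewrite cpart_mx_int.
under eq_fun do rewrite cpart_mx_int.
exact: (cvg_Iv_right b cy yd (ih i j b')).
Qed.

Lemma prim_cc m n c (h : R -> 'M[R[i]]_(m, n)) b : prim c h b c = 0.
Proof.
apply: mx_parts => i j b'; rewrite cpart_mx_int mxE cpart0.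
rewrite (_ : Iv b c c = set0) ?Rintegral_set0 //.
apply/seteqP; split => // x /IvE[cx]; case: b => ?; lra.
Qed.

(** On ]c, d[ the function u is balanced, has derivative h mu, and tends to l
    at c. Integrability of h on all of ]c, d[ is part of the notion; it gives
    limits at both ends. *)
Definition balanced_primitive {m n} c d l (h u : R -> 'M[R[i]]_(m, n)) : Prop :=
  mx_integrable mu (Iv true c d) h /\
  forall t, c < t -> t < d -> u t = l + balanced_prim c h t.

Section BalancedPrimitive.
Context {m n : nat}.
Variables (c d : R) (l : 'M[R[i]]_(m, n)) (h u : R -> 'M[R[i]]_(m, n)).
Hypothesis bp : balanced_primitive c d l h u.

Let ih : mx_integrable mu (Iv true c d) h. Proof. exact: bp.1. Qed.

Lemma bp_integrable (b : bool) t :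
  t < d \/ (b /\ t <= d) -> mx_integrable mu (Iv b c t) h.
Proof. by move=> td; apply: mx_integrableS ih => //; exact: sub_IvT. Qed.

Lemma bp_cvg_left t : c < t -> t <= d -> cvg_mx_left u t (l + prim c h true t).
Proof.
move=> ct td; apply: (@cvg_mx_left_near _ _ _ (fun s => l + balanced_prim c h s)).
  near=> s.
  have cs : c < s by near: s; exact: nbhs_left_gt.
  have sd : s < d by apply: lt_le_trans td; near: s; exact: nbhs_left_lt.
  by rewrite bp.2.
rewrite -[X in l + X]halfD.
apply: cvg_mx_leftD; first exact: cvg_mx_left_cst.
by apply: cvg_mx_left_half; apply: cvg_mx_leftD; exact: (prim_cvg_left _ ct td ih).
Unshelve. all: by end_near. Qed.

Lemma bp_cvg_right t : c <= t -> t < d -> cvg_mx_right u t (l + prim c h false t).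
Proof.
move=> ct td; apply: (@cvg_mx_right_near _ _ _ (fun s => l + balanced_prim c h s)).
  near=> s.
  have cs : c < s by apply: le_lt_trans ct _; near: s; exact: nbhs_right_gt.
  have sd : s < d by near: s; exact: nbhs_right_lt.
  by rewrite bp.2.
rewrite -[X in l + X]halfD.
apply: cvg_mx_rightD; first exact: cvg_mx_right_cst.
by apply: cvg_mx_right_half; apply: cvg_mx_rightD; exact: (prim_cvg_right _ ct td ih).
Unshelve. all: by end_near. Qed.

Lemma bp_llim t : c < t -> t <= d -> llim u t = l + prim c h true t.
Proof. by move=> ct td; apply/cvg_mx_left_llim/bp_cvg_left. Qed.

Lemma bp_rlim t : c <= t -> t < d -> rlim u t = l + prim c h false t.
Proof. by move=> ct td; apply/cvg_mx_right_rlim/bp_cvg_right. Qed.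

Lemma bp_llim_llim t : c < t -> t <= d -> llim (llim u) t = l + prim c h true t.
Proof.
move=> ct td; apply/cvg_mx_left_llim.
apply: (@cvg_mx_left_near _ _ _ (fun s => l + prim c h true s)).
  near=> s.
  have cs : c < s by near: s; exact: nbhs_left_gt.
  have sd : s <= d by apply: ltW; apply: lt_le_trans td; near: s; exact: nbhs_left_lt.
  by rewrite bp_llim.
by apply: cvg_mx_leftD; [exact: cvg_mx_left_cst|exact: prim_cvg_left ih].
Unshelve. all: by end_near. Qed.

Lemma bp_rlim_start : c < d -> rlim u c = l.
Proof. by move=> cd; rewrite bp_rlim // prim_cc addr0. Qed.

Lemma prim_split (b : bool) s t : c <= s -> (if b then s < t else s <= t) ->
  t < d \/ (b /\ t <= d) ->
  prim c h b t = prim c h false s + prim s h b t.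
Proof.
move=> cs st td; apply: (@mx_int_split _ _ _ _ _ (BRight s)).
- by rewrite bnd_simp.
- by case: b st {td}; rewrite bnd_simp.
- exact: (bp_integrable td).
Qed.

Lemma prim_jump t : c < t -> t < d ->
  prim c h false t = prim c h true t + (fine (mu [set t]))%:C *: h t.
Proof.
move=> ct td; rewrite -mx_int_set1.
have -> : [set t] = [set` Interval (BLeft t) (BRight t)].
  apply/seteqP; split => x /=; rewrite in_itv /=; first by move=> ->; rewrite lexx.
  by move=> ?; apply/eqP; rewrite eq_le andbC.
apply: (@mx_int_split _ _ _ _ _ (BLeft t)).
- by rewrite bnd_simp.
- by rewrite bnd_simp.
- by apply: bp_integrable; left.
Qed.

Lemma prim_itvco s t : c < s -> s <= t -> t <= d ->
  prim c h true t = prim c h true s + mx_int mu `[s, t[ h.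
Proof.
move=> ct st td; apply: (@mx_int_split _ _ _ _ _ (BLeft s)).
- by rewrite bnd_simp.
- by rewrite bnd_simp.
- by apply: bp_integrable; right.
Qed.

Lemma bp_restrict s e : c <= s -> e <= d ->
  balanced_primitive s e (l + prim c h false s) h u.
Proof.
move=> cs ed; split.
  apply: mx_integrableS ih => //; apply: Iv_sub => //.
  by right; split => //; exact: ed.
move=> t st te; have td : t < d by exact: lt_le_trans ed.
have ct : c < t by exact: (le_lt_trans cs st).
rewrite (bp.2 t ct td).
rewrite -addrA; congr (_ + _); rewrite /balanced_prim.
rewrite (@prim_split true s t) //; last by left.
rewrite (@prim_split false s t) //; [|exact: ltW|by left].
by rewrite addrACA scalerDr halfD.
Qed.

Lemma bp_norm1 t : c < t -> t < d ->
  norm1 (u t) <= norm1 l + \int[mu]_(s in Iv true c d) norm1 (h s).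
Proof.
move=> ct td; rewrite bp.2 //; apply: le_trans (norm1D _ _) _; rewrite lerD2l.
have P b : norm1 (prim c h b t) <= \int[mu]_(s in Iv true c d) norm1 (h s).
  have mI := measurable_Iv b c t; have mIT := measurable_Iv true c d.
  have sub : Iv b c t `<=` Iv true c d by apply: sub_IvT; left.
  apply: le_trans (norm1_mx_int mI _) _; first by apply: bp_integrable; left.
  have iN := mx_integrable_norm1 mIT ih.
  rewrite -lee_fin /Rintegral !fineK; [|exact: integrable_fin_num|].
    apply: ge0_subset_integral => //; first exact: measurable_int iN.
    by move=> x _; rewrite lee_fin norm1_ge0.
  by apply: integrable_fin_num => //; exact: integrableS iN.
rewrite norm1_half; have := norm1D (prim c h true t) (prim c h false t).
have := P true; have := P false; lra.
Qed.

Lemma bp_locally_BV : locally_BV c%:E d%:E u.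
Proof.
suff H s t i j b : c < s -> s <= t -> t < d ->
    bounded_variation s t (fun x => cpart b (u x i j)).
  move=> s t [cs _] [_ td] st i j; rewrite !lte_fin in cs td.
  by split; [exact: (H s t i j false)|exact: (H s t i j true)].
move=> cs; rewrite le_eqVlt => /predU1P[<- _|st td]; first exact: bounded_variationxx.
pose F b' x := \int[mu]_(y in Iv b' c x) cpart b (h y i j).
have bF b' : bounded_variation s t (F b').
  have /mx_integrableP H := ih.
  by apply: (bounded_variation_prim _ (H i j b)) => //; exact: ltW.
have bc k : bounded_variation s t (fun=> k : R).
  by apply: nondecreasing_bounded_variation => *.
pose G := (F true \+ F false).
have bG : bounded_variation s t G by exact: bounded_variationD.
have bhG : bounded_variation s t (fun x => 2^-1 * G x).
  case: bG => M HM; exists (2^-1 * M) => _ [r str <-].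
  have -> : variation s t (fun x => 2^-1 * G x) r = 2^-1 * variation s t G r.
    rewrite /variation mulr_sumr; apply: eq_bigr => k _ /=.
    by rewrite -mulrBr normrM [`|2^-1|]ger0_norm.
  by rewrite ler_pM2l ?invr_gt0 //; apply: HM; exists r.
apply: bounded_variation_ext (bounded_variationD st (bc (cpart b (l i j))) bhG).
move=> x; rewrite in_itv /= => /andP[sx xt].
rewrite bp.2; [|exact: lt_le_trans sx|exact: le_lt_trans td].
by rewrite [in RHS]mxE cpartD cpart_balanced_prim.
Qed.

End BalancedPrimitive.
End Primitive.

(** * Matrix functions locally of bounded variation *)

Section LocallyBV.
Context {R : realType} {m n : nat}.
Variables (c d : R) (u : R -> 'M[R[i]]_(m, n)).
Hypothesis bv : locally_BV c%:E d%:E u.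

Lemma locally_BV_cpart s t i j b : c < s -> s <= t -> t < d ->
  bounded_variation s t (fun x => cpart b (u x i j)).
Proof.
move=> cs st td; have [] := @bv s t _ _ st i j.
- by split; rewrite lte_fin //; exact: le_lt_trans td.
- by split; rewrite lte_fin //; exact: lt_le_trans st.
by case: b.
Qed.

Lemma locally_BV_cvg_left t : c < t -> t < d -> cvg_mx_left u t (llim u t).
Proof.
move=> ct td i j b.
have [s cs st] : exists2 s, c < s & s < t by exists ((c + t) / 2); lra.
have := bounded_variation_cvg_left st (lexx t) (locally_BV_cpart i j b cs (ltW st) td).
by rewrite mxE; case: b.
Qed.

Lemma locally_BV_cvg_right t : c < t -> t < d -> cvg_mx_right u t (rlim u t).
Proof.
move=> ct td i j b.
have [s ts sd] : exists2 s, t < s & s < d by exists ((t + d) / 2); lra.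
have := bounded_variation_cvg_right (lexx t) ts (locally_BV_cpart i j b ct (ltW ts) sd).
by rewrite mxE; case: b.
Qed.

Lemma locally_BV_bounded s t : c < s -> s <= t -> t < d ->
  exists M : R, forall r, s <= r -> r <= t -> norm1 (u r) <= M.
Proof.
move=> cs st td.
have /choice[M HM] : forall e : 'I_m * 'I_n * bool, exists M : R,
    forall r, r \in `[s, t] -> `|cpart e.2 (u r e.1.1 e.1.2)| <= M.
  move=> e; apply: bounded_variation_bounded => //.
  exact: locally_BV_cpart.
exists (\sum_e M e) => r sr rt; apply: ler_sum => e _; apply: HM.
by rewrite in_itv /= sr.
Qed.

Lemma locally_BV_measurable_itv s t : c < s -> s <= t -> t < d ->
  mx_measurable `[s, t] u.
Proof.
move=> cs st td; apply/mx_measurableP => i j b.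
exact: bounded_variation_measurable (locally_BV_cpart _ _ _ _ _ _).
Qed.

Lemma locally_BV_measurable : mx_measurable (Iv true c d) u.
Proof.
pose F (k : nat) : set (measurableTypeR R) := `[c + k.+1%:R^-1, d - k.+1%:R^-1]%classic.
have -> : Iv true c d = \bigcup_k F k.
  apply/seteqP; split => x.
    move=> /IvE[cx xd].
    pose e := Num.min (x - c) (d - x).
    have e0 : 0 < e by rewrite lt_min !subr_gt0 cx.
    have [k _ Hk] := near_infty_natSinv_lt (PosNum e0).
    have := Hk k (leqnn _) => /= ke.
    exists k => //; rewrite /F /= in_itv /=.
    have : k.+1%:R^-1 < x - c by apply: lt_le_trans ke _; rewrite /e ge_min lexx.
    have : k.+1%:R^-1 < d - x by apply: lt_le_trans ke _; rewrite /e ge_min lexx orbT.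
    by move: (k.+1%:R^-1) => e1 ? ?; apply/andP; split; lra.
  move=> [k _]; rewrite /F /= in_itv /= => /andP[h1 h2]; apply/IvE.
  have : 0 < k.+1%:R^-1 :> R by rewrite invr_gt0.
  by move: (k.+1%:R^-1) h1 h2 => e h1 h2 e0; split; lra.
apply/mx_measurableP => i j b; apply/measurable_fun_bigcup.
  by move=> k; exact: measurable_itv.
move=> k.
have : 0 < k.+1%:R^-1 :> R by rewrite invr_gt0.
rewrite /F; move: (k.+1%:R^-1) => e e0.
have [h|h] := leP (c + e) (d - e).
  have ce : c < c + e by lra.
  have de : d - e < d by lra.
  by have /mx_measurableP H := locally_BV_measurable_itv ce h de; exact: H.
rewrite set_itv_ge; first exact: measurable_fun_set0.
by rewrite bnd_simp -ltNge.
Qed.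

End LocallyBV.

(** A function is determined by its increments up to its value at one interior
    point; integrability up to c turns that value into a constant of
    integration at c. *)
Lemma primitive_of_increments {R : realType}
    (mu : {finite_measure set (measurableTypeR R) -> \bar R}) {m n : nat} (c d : R)
    (h v : R -> 'M[R[i]]_(m, n)) :
  c < d -> mx_integrable mu (Iv true c d) h ->
  (forall s t, c < s -> s <= t -> t < d -> mx_int mu `[s, t[ h = v t - v s) ->
  exists L, forall t, c < t -> t < d -> v t = L + prim mu c h true t.
Proof.
move=> cd ih incr.
have bp0 : balanced_primitive mu c d 0 h (fun t => 0 + balanced_prim mu c h t) by split.
pose s0 := (c + d) / 2; exists (v s0 - prim mu c h true s0) => t ct td.
suff H s r : c < s -> s <= r -> r < d ->
    v r - prim mu c h true r = v s - prim mu c h true s.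
  apply/eqP; rewrite -subr_eq; apply/eqP.
  have cs0 : c < s0 by rewrite /s0; lra.
  have sd0 : s0 < d by rewrite /s0; lra.
  have [h1|/ltW h1] := leP t s0; first by symmetry; apply: H.
  exact: H.
move=> cs sr rd; rewrite (prim_itvco bp0 cs sr (ltW rd)) incr //.
by rewrite opprD opprB addrCA [X in _ + X]addrCA subrr addr0 addrC.
Qed.

(** * Linear equations driven by a measure *)

Section LinearMeasureODE.
Context {R : realType} (mu : {finite_measure set (measurableTypeR R) -> \bar R}).
Context {m n : nat}.
Local Notation intble D h := (mu.-integrable D (EFin \o h)).
Variables (c d : R) (A : R -> 'M[R[i]]_m) (k u : R -> 'M[R[i]]_(m, n)).
Hypothesis cd : c < d.
Hypothesis bv : locally_BV c%:E d%:E u.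
Hypothesis bal : balanced c%:E d%:E u.
Hypothesis iA : mx_integrable mu (Iv true c d) A.
Hypothesis ik : mx_integrable mu (Iv true c d) k.
Let h t : 'M[R[i]]_(m, n) := k t - A t *m u t.
Hypothesis ode : forall s t, c < s -> s <= t -> t < d ->
  mx_int mu `[s, t[ h = llim u t - llim u s.

(** Here integrability of the density is assumed. The left limits of u have
    the right increments, hence are a primitive; the right limits follow from
    them, and balance gives u itself. *)
Lemma ode_balanced_primitive_local c' d' : c <= c' -> c' < d' -> d' <= d ->
  mx_integrable mu (Iv true c' d') h ->
  exists l, balanced_primitive mu c' d' l h u.
Proof.
move=> cc' cd' dd' ih.
have [L LE] : exists L, forall t, c' < t -> t < d' -> llim u t = L + prim mu c' h true t.
  apply: primitive_of_increments => // s t cs st td; apply: ode => //.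
  - exact: le_lt_trans cs.
  - exact: lt_le_trans dd'.
exists L; split => // t ct td.
have ct' : c < t by exact: le_lt_trans ct.
have td' : t < d by exact: lt_le_trans dd'.
rewrite bal //; have -> : rlim u t = L + prim mu c' h false t.
  apply: cvg_mx_right_rlim => i j b.
  have cvP := @prim_cvg_right _ mu _ _ true _ _ _ h (ltW ct) td ih.
  have cvD := cvg_mx_rightD (@cvg_mx_right_cst _ _ _ t L) cvP.
  have cv := cvD i j b.
  have cuD := locally_BV_cvg_right bv ct' td'.
  have cu := cuD i j b.
  suff -> : cpart b ((L + prim mu c' h false t) i j) = cpart b (rlim u t i j) by [].
  apply: (cvg_unique _ cv) => //.
  apply: (@cvg_trans _ (cpart b (llim u x i j) @[x --> t^'+])).
    apply: near_eq_cvg; near=> x.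
    have cx : c' < x by apply: lt_trans ct _; near: x; exact: nbhs_right_gt.
    have xd : x < d' by near: x; exact: nbhs_right_lt.
    by rewrite LE.
  apply: (cvg_right_of_left_limits cu); near=> x.
  have cx : c < x by apply: lt_trans ct' _; near: x; exact: nbhs_right_gt.
  have xd : x < d by near: x; exact: nbhs_right_lt.
  have cl := locally_BV_cvg_left bv cx xd; exact: (cl i j b).
rewrite LE // addrACA scalerDr halfD; congr (_ + _).
by rewrite /balanced_prim addrC.
Unshelve. all: by end_near. Qed.

Let mu_u : mx_measurable (Iv true c d) u. Proof. exact: locally_BV_measurable bv. Qed.

Lemma ode_integrable e f (M : R) : c <= e -> f <= d ->
  (forall t, e < t -> t < f -> norm1 (u t) <= M) -> mx_integrable mu (Iv true e f) h.
Proof.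
move=> ce fd uM; have mI := measurable_Iv true e f.
have sub : Iv true e f `<=` Iv true c d by apply: Iv_sub => //; right; split.
apply: mx_integrableB => //; first exact: mx_integrableS ik.
apply: (@mx_integrable_bddr _ _ _ _ _ _ _ _ M) => //.
- exact: mx_integrableS iA.
- move=> i j; have [m1 m2] := mu_u i j.
  by split; [exact: measurable_funS m1|exact: measurable_funS m2].
- by move=> t /IvE[et tf]; exact: uM.
Qed.

Lemma le_Rintegral_Iv e f (g : R -> R) : c <= e -> f <= d ->
  intble (Iv true c d) g -> (forall t, 0 <= g t) ->
  \int[mu]_(t in Iv true e f) g t <= \int[mu]_(t in Iv true c d) g t.
Proof.
move=> ce fd ig g0; have mI := measurable_Iv true e f.
have sub : Iv true e f `<=` Iv true c d by apply: Iv_sub => //; right; split.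
rewrite -lee_fin /Rintegral !fineK; [|exact: integrable_fin_num|].
  apply: ge0_subset_integral => //; first exact: measurable_int ig.
  by move=> x _; rewrite lee_fin.
by apply: integrable_fin_num => //; exact: integrableS ig.
Qed.

Lemma norm1_prim e (g : R -> 'M[R[i]]_(m, n)) (b : bool) f t :
  e < t -> t < f \/ (b /\ t <= f) -> mx_integrable mu (Iv true e f) g ->
  norm1 (prim mu e g b t) <= \int[mu]_(s in Iv true e f) norm1 (g s).
Proof.
move=> et tf ig; have mI := measurable_Iv b e t; have mIT := measurable_Iv true e f.
have sub : Iv b e t `<=` Iv true e f by exact: sub_IvT.
apply: le_trans (norm1_mx_int mI _) _; first exact: mx_integrableS ig.
have iN := mx_integrable_norm1 mIT ig.
rewrite -lee_fin /Rintegral !fineK; [|exact: integrable_fin_num|].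
  apply: ge0_subset_integral => //; first exact: measurable_int iN.
  by move=> x _; rewrite lee_fin norm1_ge0.
by apply: integrable_fin_num => //; exact: integrableS iN.
Qed.

(** On an interval of small mass a bound M for u improves to a constant plus M
    / 2. Indeed u(t) differs from its left limit at s0 by two primitives of
    the right-hand side, and each of these is at most the integral of k plus K
    M times the mass of A, which is at most M / 4. *)
Lemma ode_gronwall_step K e f s0 M : 0 < K ->
  (forall (B : 'M[R[i]]_m) (v : 'M[R[i]]_(m, n)), norm1 (B *m v) <= K * (norm1 B * norm1 v)) ->
  c <= e -> f <= d -> e < s0 -> s0 < f ->
  \int[mu]_(t in Iv true e f) norm1 (A t) <= (4 * K)^-1 ->
  (forall t, e < t -> t < f -> norm1 (u t) <= M) -> 0 <= M ->
  forall t, e < t -> t < f -> norm1 (u t) <=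
    norm1 (llim u s0) + 2 * \int[mu]_(t in Iv true c d) norm1 (k t) + M / 2.
Proof.
move=> K0 HK ce fd es sf small uM M0 t et tf.
have ih := ode_integrable ce fd uM.
have [L bp] := ode_balanced_primitive_local ce (lt_trans es sf) fd ih.
have mI := measurable_Iv true e f.
have sub : Iv true e f `<=` Iv true c d by apply: Iv_sub => //; right; split.
have ik' : mx_integrable mu (Iv true e f) k by exact: mx_integrableS ik.
have iA' : mx_integrable mu (Iv true e f) A by exact: mx_integrableS iA.
have iNk := mx_integrable_norm1 mI ik'.
have iNA := mx_integrable_norm1 mI iA'.
have iNh := mx_integrable_norm1 mI ih.
have Hh : \int[mu]_(r in Iv true e f) norm1 (h r) <=
    \int[mu]_(t in Iv true c d) norm1 (k t) + M / 4.
  have iKA : intble (Iv true e f) (fun r => (K * M) * norm1 (A r)).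
    by apply: (@integrableZl _ _ _ mu _ mI _ (EFin \o _)).
  apply: (@le_trans _ _ (\int[mu]_(r in Iv true e f) (norm1 (k r) + (K * M) * norm1 (A r)))).
    apply: le_Rintegral => //; first exact: (integrableD mI iNk iKA).
    move=> r /IvE[er rf]; rewrite /h; apply: le_trans (norm1B _ _) _; rewrite lerD2l.
    apply: le_trans (HK _ _) _; rewrite -mulrA ler_pM2l // mulrC.
    by apply: ler_wpM2r; [exact: norm1_ge0|exact: uM].
  rewrite RintegralD // RintegralZl //; apply: lerD.
    apply: le_Rintegral_Iv => //; last by move=> r; exact: norm1_ge0.
    exact: mx_integrable_norm1.
  apply: (@le_trans _ _ (K * M * (4 * K)^-1)).
    by apply: ler_wpM2l => //; apply: mulr_ge0 => //; exact: ltW.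
  by rewrite invfM [K * M]mulrC -!mulrA [X in M * X]mulrCA mulfV ?gt_eqF // mulr1.
have P b r : e < r -> r < f -> norm1 (prim mu e h b r) <= \int[mu]_(s in Iv true e f) norm1 (h s).
  by move=> er rf; apply: norm1_prim => //; left.
have -> : u t = llim u s0 + (balanced_prim mu e h t - prim mu e h true s0).
  by rewrite (bp_llim bp es (ltW sf)) bp.2 // addrACA subrr addr0.
apply: le_trans (norm1D _ _) _; rewrite -addrA lerD2l.
apply: le_trans (norm1B _ _) _; rewrite norm1_half.
have := norm1D (prim mu e h true t) (prim mu e h false t).
have := P true t et tf; have := P false t et tf; have := P true s0 es sf.
lra.
Qed.

(** The improvement is applied with M the supremum of u over a compact
    subinterval, which is finite by bounded variation. The resulting bound
    does not depend on the subinterval, so it holds up to the ends. *)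
Lemma ode_bounded_small e f s0 : c <= e -> f <= d -> e < s0 -> s0 < f ->
  (exists K, [/\ 0 < K,
  (forall (B : 'M[R[i]]_m) (v : 'M[R[i]]_(m, n)), norm1 (B *m v) <= K * (norm1 B * norm1 v)) &
  \int[mu]_(t in Iv true e f) norm1 (A t) <= (4 * K)^-1]) ->
  forall t, e < t -> t < f -> norm1 (u t) <=
    2 * (norm1 (llim u s0) + 2 * \int[mu]_(t in Iv true c d) norm1 (k t)).
Proof.
move=> ce fd es sf [K [K0 HK small]] t et tf.
set C := norm1 (llim u s0) + _.
(* A compact subinterval of ]e, f[ containing s0 and t; on it u is bounded. *)
pose e' := (e + Num.min s0 t) / 2; pose f' := (f + Num.max s0 t) / 2.
have [h1 h2] : Num.min s0 t <= s0 /\ Num.min s0 t <= t by rewrite !ge_min !lexx orbT.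
have [h3 h4] : s0 <= Num.max s0 t /\ t <= Num.max s0 t by rewrite !le_max !lexx orbT.
have h5 : e < Num.min s0 t by rewrite lt_min es et.
have h6 : Num.max s0 t < f by rewrite gt_max sf tf.
have ee' : e < e' by rewrite /e'; lra.
have e's : e' < s0 by rewrite /e'; lra.
have e't : e' < t by rewrite /e'; lra.
have ff' : f' < f by rewrite /f'; lra.
have sf' : s0 < f' by rewrite /f'; lra.
have tf' : t < f' by rewrite /f'; lra.
clear h1 h2 h3 h4 h5 h6; clearbody e' f'.
have [M HM] := locally_BV_bounded bv (le_lt_trans ce ee') (ltW (lt_trans e's sf')) (lt_le_trans ff' fd).
have small' : \int[mu]_(t in Iv true e' f') norm1 (A t) <= (4 * K)^-1.
  apply: le_trans small.
  have mI := measurable_Iv true e f.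
  have sub : Iv true e' f' `<=` Iv true e f by apply: Iv_sub; [exact: ltW|left].
  have sub' : Iv true e f `<=` Iv true c d by apply: Iv_sub => //; right; split.
  have iN := integrableS (measurable_Iv _ _ _) mI sub' (mx_integrable_norm1 (measurable_Iv _ _ _) iA).
  rewrite -lee_fin /Rintegral !fineK; [|exact: integrable_fin_num|].
    apply: ge0_subset_integral => //; first exact: measurable_int iN.
    by move=> x _; rewrite lee_fin norm1_ge0.
  by apply: integrable_fin_num => //; exact: integrableS iN.
(* The best bound satisfies sup S <= C + sup S / 2, hence sup S <= 2 C. *)
pose S := [set norm1 (u r) | r in Iv true e' f'].
have S_ub : has_ubound S by exists M => _ [r /IvE[er rf] <-]; apply: HM; exact: ltW.
have S0 : S !=set0 by exists (norm1 (u t)); exists t => //; apply/IvE.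
have supS r : e' < r -> r < f' -> norm1 (u r) <= sup S.
  by move=> er rf; apply: ub_le_sup => //; exists r => //; apply/IvE.
have supS0 : 0 <= sup S by apply: le_trans (norm1_ge0 _) (supS t _ _).
have : sup S <= C + sup S / 2.
  apply: ge_sup => // _ [r /IvE[er rf] <-].
  apply: (ode_gronwall_step K0 HK (e := e') (f := f')) => //.
  - exact: le_trans (ltW ee').
  - exact: le_trans (ltW ff') _.
have := supS t e't tf'; lra.
Qed.

(** A finite measure has small mass near each end of ]c, d[, where
    ode_bounded_small applies; in between, bounded variation suffices. *)
Lemma ode_bounded : exists M : R, forall t, c < t -> t < d -> norm1 (u t) <= M.
Proof.
have [K K0 HK] := @norm1M R m m n.
have K40 : 0 < (4 * K)^-1 by rewrite invr_gt0 mulr_gt0.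
have mI := measurable_Iv true c d.
have iN := mx_integrable_norm1 mI iA.
have [s1 [cs1 s1d small1]] : exists s, [/\ c < s, s < d &
    \int[mu]_(t in Iv true c s) norm1 (A t) <= (4 * K)^-1].
  have := @cvg_Iv_right _ mu true c d c _ (lexx c) cd iN.
  rewrite (_ : Iv false c c = set0) ?Rintegral_set0; last first.
    by apply/seteqP; split => // x /IvE[]; lra.
  move=> cv; near c^'+ => s; exists s; split.
  - by near: s; exact: nbhs_right_gt.
  - by near: s; exact: nbhs_right_lt.
  - apply: ltW; near: s; exact: (cvgr_lt _ cv).
have [s2 [cs2 s2d small2]] : exists s, [/\ c < s, s < d &
    \int[mu]_(t in Iv true s d) norm1 (A t) <= (4 * K)^-1].
  have cv := @cvg_Iv_left _ mu false c d d _ cd (lexx d) iN.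
  near d^'- => s.
  have cs : c < s by near: s; exact: nbhs_left_gt.
  have sd : s < d by near: s; exact: nbhs_left_lt.
  exists s; split => //.
  have E := @Rintegral_itv_split _ mu (BRight c) (BRight s) (BLeft d) _ (ltW cs) sd iN.
  have : \int[mu]_(t in Iv true c d) norm1 (A t) - (4 * K)^-1 <
     \int[mu]_(t in Iv false c s) norm1 (A t).
    near: s; apply: (cvgr_gt _ cv); lra.
  by move: E; rewrite /Iv; lra.
have [M HM] : exists M : R, forall t, s1 <= t -> t <= s2 -> norm1 (u t) <= M.
  have [h12|h21] := leP s1 s2; first exact: (locally_BV_bounded bv).
  by exists 0 => t; lra.
have m1 : c < (c + s1) / 2 /\ (c + s1) / 2 < s1 by split; lra.
have m2 : s2 < (s2 + d) / 2 /\ (s2 + d) / 2 < d by split; lra.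
have B1 := @ode_bounded_small c s1 _ (lexx c) (ltW s1d) m1.1 m1.2
  (ex_intro _ K (And3 K0 HK small1)).
have B2 := @ode_bounded_small s2 d _ (ltW cs2) (lexx d) m2.1 m2.2
  (ex_intro _ K (And3 K0 HK small2)).
move: (2 * (norm1 (llim u ((c + s1) / 2)) + _)) B1 => x1 B1.
move: (2 * (norm1 (llim u ((s2 + d) / 2)) + _)) B2 => x2 B2.
exists (Num.max x1 (Num.max x2 M)) => t ct td; rewrite !le_max.
have [ts1|s1t] := ltP t s1; first by rewrite (B1 t ct ts1).
have [ts2|s2t] := ltP s2 t; first by rewrite (B2 t ts2 td) orbT.
by rewrite (HM t s1t s2t) !orbT.
Unshelve. all: by end_near. Qed.

Lemma ode_balanced_primitive : exists l, balanced_primitive mu c d l h u.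
Proof.
have [M HM] := ode_bounded; apply: ode_balanced_primitive_local => //.
exact: ode_integrable HM.
Qed.

End LinearMeasureODE.

(** * A common dominating measure *)

Section DensityTransfer.
Context d (T : measurableType d) (R : realType).
Local Notation intble mu D h := (mu.-integrable D (EFin \o h)).

(** The derivative of nu with respect to lam, in real-valued form and for
    integrands of any sign. *)
Lemma density_transfer (nu lam : {finite_measure set T -> \bar R}) :
  nu `<< lam -> exists rho : T -> R,
  [/\ measurable_fun setT rho, (forall x, 0 <= rho x) &
  forall A (g : T -> R), measurable A -> intble nu A g ->
    intble lam A (fun x => g x * rho x) /\
    \int[lam]_(x in A) (g x * rho x) = \int[nu]_(x in A) g x].
Proof.
move=> nulam; pose f := Radon_Nikodym_SigmaFinite.f nu lam.
have f0 : forall x, (0 <= f x)%E := Radon_Nikodym_SigmaFinite.f_ge0 nulam.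
have ffin : forall x, f x \is a fin_num := Radon_Nikodym_SigmaFinite.f_fin_num nulam.
have fE x : f x = (fine (f x))%:E by rewrite fineK.
have fint := Radon_Nikodym_SigmaFinite.f_integrable nulam.
pose rho x := fine (f x).
have mrho : measurable_fun setT rho.
  by apply/measurable_EFinP; rewrite (_ : _ \o _ = f);
    [exact: measurable_int fint|apply/funext => x; rewrite /= -fE].
have rho0 x : 0 <= rho x by exact: fine_ge0.
have pos A (g : T -> R) : measurable A -> (forall x, 0 <= g x) -> intble nu A g ->
    intble lam A (fun x => g x * rho x) /\
    \int[lam]_(x in A) (g x * rho x) = \int[nu]_(x in A) g x.
  move=> mA g0 ig.
  have g0' x : (0 <= (EFin \o g) x)%E by rewrite lee_fin.
  have E : (EFin \o (fun x => g x * rho x)) = ((EFin \o g) \* f)%E.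
    by apply/funext => x; rewrite /= EFinM -fE.
  split.
    by rewrite E; exact: (Radon_Nikodym_SigmaFinite.integrableM nulam g0' mA ig).
  rewrite /Rintegral; congr fine.
  transitivity (\int[lam]_(x in A) ((EFin \o g) x * f x))%E.
    by apply: eq_integral => x _; rewrite /= EFinM -fE.
  apply: (Radon_Nikodym_SigmaFinite.change_of_variables nulam g0' mA).
  exact: measurable_int ig.
exists rho; split => // A g mA ig.
have [p1 p2] := pos A g^\+ mA (funrpos_ge0 g) (integrable_funrpos mA ig).
have [n1 n2] := pos A g^\- mA (funrneg_ge0 g) (integrable_funrneg mA ig).
have E : (fun x => g x * rho x) = (fun x => g^\+ x * rho x - g^\- x * rho x).
  by apply/funext => x; rewrite -mulrBl -[in LHS](funrposBneg g).
split.
  rewrite E; exact: (integrableB mA p1 n1).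
rewrite E RintegralB // p2 n2 -RintegralB //.
- by apply: eq_Rintegral => x _; rewrite -[in RHS](funrposBneg g).
- exact: integrable_funrpos.
- exact: integrable_funrneg.
Qed.

End DensityTransfer.

Section CommonDensity.
Context {R : realType}.
Local Notation T := (measurableTypeR R).
Local Notation intble mu D h := (mu.-integrable D (EFin \o h)).
Variables (mu1 mu2 : {measure set T -> \bar R}) (K : set T).
Hypotheses (mK : measurable K) (K1 : (mu1 K < +oo)%E) (K2 : (mu2 K < +oo)%E).

(** A single measure is needed because the right-hand side J^-1 (w f - q u) of
    the equation mixes the measures of q and of w. *)
Lemma common_density :
  exists (lam : {finite_measure set T -> \bar R}) (rho1 rho2 : R -> R),
  [/\ measurable_fun (setT : set T) rho1, measurable_fun (setT : set T) rho2,
  forall A (g : R -> R), measurable (A : set T) -> A `<=` K -> intble mu1 A g ->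
    intble lam A (fun x => g x * rho1 x) /\
    \int[lam]_(x in A) (g x * rho1 x) = \int[mu1]_(x in A) g x &
  forall A (g : R -> R), measurable (A : set T) -> A `<=` K -> intble mu2 A g ->
    intble lam A (fun x => g x * rho2 x) /\
    \int[lam]_(x in A) (g x * rho2 x) = \int[mu2]_(x in A) g x].
Proof.
pose m : {measure set T -> \bar R} := measure_add mu1 mu2.
have mE A : m A = (mu1 A + mu2 A)%E by exact: measure_addE.
have Km : (m K < +oo)%E by rewrite mE; exact: lte_add_pinfty.
pose lam : {finite_measure set T -> \bar R} := mfrestr mK Km.
pose nu1 : {finite_measure set T -> \bar R} := mfrestr mK K1.
pose nu2 : {finite_measure set T -> \bar R} := mfrestr mK K2.
have dom1 : nu1 `<< lam.
  apply/null_content_dominatesP => A mA; rewrite /lam /nu1 /= /mfrestr /mrestr mE.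
  move=> /eqP; rewrite padde_eq0 ?measure_ge0 //; first by move=> /andP[/eqP].
have dom2 : nu2 `<< lam.
  apply/null_content_dominatesP => A mA; rewrite /lam /nu2 /= /mfrestr /mrestr mE.
  by move=> /eqP; rewrite padde_eq0 ?measure_ge0 // => /andP[_ /eqP].
have [rho1 [m1 p1 H1]] := density_transfer dom1.
have [rho2 [m2 p2 H2]] := density_transfer dom2.
have restr (mu : {measure set T -> \bar R}) (muK : (mu K < +oo)%E) A (g : R -> R) :
    measurable (A : set T) -> A `<=` K -> intble mu A g ->
    intble (mfrestr mK muK) A g /\
    \int[mfrestr mK muK]_(x in A) g x = \int[mu]_(x in A) g x.
  move=> mA AK ig.
  have E (h : T -> \bar R) : (\int[mfrestr mK muK]_(x in A) h x = \int[mu]_(x in A) h x)%E.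
    apply: eq_measure_integral => B mB BA; rewrite /= /mfrestr /mrestr.
    by rewrite setIidl //; exact: subset_trans AK.
  split; last by rewrite /Rintegral E.
  move/integrableP: ig => [mg igoo]; apply/integrableP; split => //.
  by rewrite E.
exists lam, rho1, rho2; split => // A g mA AK ig.
- have [i1 E1] := restr _ K1 A g mA AK ig.
  by have [I1 J1] := H1 A g mA i1; rewrite J1 E1.
- have [i2 E2] := restr _ K2 A g mA AK ig.
  by have [I2 J2] := H2 A g mA i2; rewrite J2 E2.
Qed.
End CommonDensity.

(** * Signs of densities *)

Section AlmostEverywhere.
Context {R : realType} (mu : {measure set (measurableTypeR R) -> \bar R}).
Local Notation intble D h := (mu.-integrable D (EFin \o h)).
Local Notation msr D := (measurable (D : set (measurableTypeR R))).

(** A countable union of null sets is null. *)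
Lemma ae_forall_count (I : countType) (P : I -> measurableTypeR R -> Prop) :
  (forall x, {ae mu, forall t, P x t}) -> {ae mu, forall t, forall x, P x t}.
Proof.
move=> H; pose Q k t := if unpickle k is Some x then P x t else True.
have /ae_foralln : forall k, {ae mu, forall t, Q k t}.
  by move=> k; rewrite /Q; case: unpickle => [x|]; [exact: H|exact: aeW].
by apply: filterS => t Qt x; have := Qt (pickle x); rewrite /Q pickleK.
Qed.

Lemma oint_rat (a b : \bar R) t : oint a b t -> exists p q : rat,
  [/\ oint a b (ratr p), oint a b (ratr q), ratr p <= t & t <= ratr q].
Proof.
move=> [at_ tb].
have [p [ap pt]] : exists p : rat, (a < (ratr p)%:E)%E /\ ratr p < t.
  case: a at_ => [r| |]; rewrite ?lte_fin //.
    move=> /rat_in_itvoo[p]; rewrite in_itv /= => /andP[h1 h2].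
    by exists p; rewrite lte_fin.
  have : t - 1 < t by lra.
  move=> /rat_in_itvoo[p]; rewrite in_itv /= => /andP[h1 h2] _.
  by exists p; rewrite ltNyr.
have [q [qb tq]] : exists q : rat, ((ratr q)%:E < b)%E /\ t < ratr q.
  case: b tb => [r| |]; rewrite ?lte_fin //.
    move=> /rat_in_itvoo[q]; rewrite in_itv /= => /andP[h1 h2].
    by exists q; rewrite lte_fin.
  have : t < t + 1 by lra.
  move=> /rat_in_itvoo[q]; rewrite in_itv /= => /andP[h1 h2] _.
  by exists q; rewrite ltry.
exists p, q; split; try exact: ltW.
- by split => //; apply: lt_trans tb; rewrite lte_fin.
- by split => //; apply: lt_trans at_ _; rewrite lte_fin.
Qed.

Lemma oint_itv (a b : \bar R) c d t :
  oint a b c -> oint a b d -> c <= t -> t <= d -> oint a b t.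
Proof.
move=> [ac _] [_ db] ct td; split.
  by apply: lt_le_trans ac _; rewrite lee_fin.
by apply: le_lt_trans db; rewrite lee_fin.
Qed.

Lemma measurable_oint (a b : \bar R) : msr (oint a b).
Proof.
apply: is_interval_measurable => s t os ot r /andP[sr rt].
exact: oint_itv os ot sr rt.
Qed.

(** On the set where g < 0 inside a compact interval the integral of g would
    be negative unless that set is null. Intervals with rational ends suffice
    to exhaust the domain, and there are countably many of them. *)
Lemma ae_nonneg (a b : \bar R) (g : R -> R) :
  (forall c d, oint a b c -> oint a b d -> intble `[c, d] g) ->
  (forall A, bounded_borel a b A -> 0 <= \int[mu]_(t in A) g t) ->
  {ae mu, forall t, oint a b t -> 0 <= g t}.
Proof.
move=> ig g0.
have H (pq : rat * rat) : {ae mu, forall t : measurableTypeR R,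
    oint a b (ratr pq.1 : R) -> oint a b (ratr pq.2 : R) ->
    ratr pq.1 <= t -> t <= ratr pq.2 -> 0 <= g t}.
  case: pq => p q /=.
  have [op|nop] := pselect (oint a b (ratr p : R)); last by apply: aeW.
  have [oq|noq] := pselect (oint a b (ratr q : R)); last by apply: aeW.
  have mI : msr `[ratr p : R, ratr q]%classic by exact: measurable_itv.
  have ih := ig _ _ op oq.
  have mg : measurable_fun (`[ratr p : R, ratr q]%classic : set (measurableTypeR R)) g.
    by apply/measurable_EFinP; exact: measurable_int ih.
  (* The integral over the set where g < 0 is both non-negative, by
     assumption, and non-positive; hence g vanishes there almost everywhere,
     and this set is null. *)
  pose A : set (measurableTypeR R) := `[ratr p : R, ratr q]%classic `&` [set t | g t < 0].
  have mA : measurable A.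
    rewrite /A (_ : [set t | g t < 0] = g @^-1` `]-oo, 0[%classic).
      by apply: mg => //; exact: measurable_itv.
    by apply/seteqP; split => t /=; rewrite in_itv.
  have subA : A `<=` `[ratr p : R, ratr q]%classic by exact: subIsetl.
  have iA : intble A g by exact: integrableS ih.
  have bA : bounded_borel a b A.
    by split => //; exists (ratr p), (ratr q); split.
  have mgA : measurable_fun A (EFin \o g) by exact: measurable_int iA.
  have : ae_eq mu A (EFin \o g) (cst 0%E).
    apply: (ae_eq_integral_abs mu mA mgA).1.
    have E : \int[mu]_(t in A) `|g t| = 0.
      apply/eqP; rewrite eq_le Rintegral_ge0 // andbT.
      have -> : \int[mu]_(t in A) `|g t| = - \int[mu]_(t in A) g t.
        rewrite -mulN1r -RintegralZl //; apply: eq_Rintegral => t.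
        by move=> /set_mem [_ gt]; rewrite ltr0_norm // mulN1r.
      by rewrite oppr_le0 g0.
    have E' : (fine (\int[mu]_(t in A) `|g t|%:E))%:E = 0%E by congr EFin.
    rewrite -[RHS]E' fineK //.
    by apply: integrable_fin_num => //; exact: integrable_norm.
  apply: filterS => t gA _ _ pt tq; rewrite leNgt; apply/negP => gt.
  have At : A t by split => //=; rewrite in_itv /= pt.
  by have /= [E] := gA At; rewrite E ltxx in gt.
apply: filterS (ae_forall_count H) => t Ht ot.
have [p [q [op oq pt tq]]] := oint_rat ot.
exact: (Ht (p, q)).
Qed.

Lemma ae_zero (a b : \bar R) (g : R -> R) :
  (forall c d, oint a b c -> oint a b d -> intble `[c, d] g) ->
  (forall A, bounded_borel a b A -> \int[mu]_(t in A) g t = 0) ->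
  {ae mu, forall t, oint a b t -> g t = 0}.
Proof.
move=> ig g0.
have h1 := ae_nonneg ig (fun A bA => eq_ind_r (fun z => 0 <= z) (lexx 0) (g0 A bA)).
have ig' c d : oint a b c -> oint a b d -> intble `[c, d] (fun t => - g t).
  by move=> oc od; have := integrableN (ig c d oc od).
have : {ae mu, forall t, oint a b t -> 0 <= - g t}.
  apply: (ae_nonneg ig') => A [mA [c [d [oc od AI]]]].
  have iA : intble A g by apply: integrableS (ig c d oc od) => //; exact: measurable_itv.
  under eq_Rintegral do rewrite -mulN1r.
  by rewrite RintegralZl // g0 ?mulr0 //; split => //; exists c, d.
have FF : Filter (almost_everywhere mu) := ae_filter_ringOfSetsType mu.
move: h1; apply: (@filterS2 _ _ FF) => t h1 h2 ot; apply/eqP.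
by rewrite eq_le h1 // andbT -oppr_ge0 h2.
Qed.

End AlmostEverywhere.

(** * Sesquilinear forms *)

Section QuadraticForms.
Context {R : realType} {n : nat}.
Implicit Types (M : 'M[R[i]]_n) (v : 'cV[R[i]]_n).

Definition sesq M (v w : 'cV[R[i]]_n) : R[i] := (v ^t* *m M *m w) 0 0.

Lemma ctrD (p k : nat) (A B : 'M[R[i]]_(p, k)) : (A + B) ^t* = A ^t* + B ^t*.
Proof. by apply/matrixP => i j; rewrite !mxE rmorphD. Qed.

Lemma ctrN (p k : nat) (A : 'M[R[i]]_(p, k)) : (- A) ^t* = - A ^t*.
Proof. by apply/matrixP => i j; rewrite !mxE rmorphN. Qed.

Lemma ctrZ (p k : nat) (z : R[i]) (A : 'M[R[i]]_(p, k)) :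
  (z *: A) ^t* = Num.conj z *: A ^t*.
Proof. by apply/matrixP => i j; rewrite !mxE rmorphM. Qed.

Lemma ctrK (p k : nat) (A : 'M[R[i]]_(p, k)) : A ^t* ^t* = A.
Proof. by apply/matrixP => i j; rewrite !mxE conjCK. Qed.

Lemma ctrM (p k r : nat) (A : 'M[R[i]]_(p, k)) (B : 'M[R[i]]_(k, r)) :
  (A *m B) ^t* = B ^t* *m A ^t*.
Proof. by rewrite trmx_mul map_mxM. Qed.

Lemma ctr1 k : (1%:M : 'M[R[i]]_k) ^t* = 1%:M.
Proof. by rewrite trmx1 map_mx1. Qed.

Lemma sesqDl M v v' w : sesq M (v + v') w = sesq M v w + sesq M v' w.
Proof. by rewrite /sesq ctrD !mulmxDl mxE. Qed.

Lemma sesqDr M v w w' : sesq M v (w + w') = sesq M v w + sesq M v w'.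
Proof. by rewrite /sesq !mulmxDr mxE. Qed.

Lemma sesqZl M z v w : sesq M (z *: v) w = Num.conj z * sesq M v w.
Proof. by rewrite /sesq ctrZ -!scalemxAl mxE. Qed.

Lemma sesqZr M z v w : sesq M v (z *: w) = z * sesq M v w.
Proof. by rewrite /sesq -!scalemxAr mxE. Qed.

Lemma sesq_conj M v w : M ^t* = M -> sesq M w v = Num.conj (sesq M v w).
Proof.
move=> hM; have : (v ^t* *m M *m w) ^t* = w ^t* *m M *m v.
  by rewrite !ctrM ctrK hM mulmxA.
by move=> /matrixP /(_ 0 0); rewrite /sesq => <-; rewrite !mxE.
Qed.

Lemma sesq_delta M i w : sesq M (delta_mx i 0) w = (M *m w) i 0.
Proof.
rewrite /sesq -mulmxA mxE (bigD1 i) //= big1 => [|j ji].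
  by rewrite !mxE !eqxx rmorph1 mul1r addr0.
by rewrite !mxE (negbTE ji) rmorph0 mul0r.
Qed.

Lemma col_delta M i j : (M *m (delta_mx j 0 : 'cV_n)) i 0 = M i j.
Proof.
rewrite mxE (bigD1 j) //= big1 => [|k kj]; first by rewrite !mxE !eqxx mulr1 addr0.
by rewrite !mxE (negbTE kj) mulr0.
Qed.

(** Polarization: the values of the form on v + w and on v + i w determine its
    off-diagonal part. *)
Lemma nonneg_hermitian_mx M : (forall v, 0 <= sesq M v v) -> M ^t* = M.
Proof.
move=> M0.
have im0 v : complex.Im (sesq M v v) = 0.
  by have := M0 v; rewrite lecE /= => /andP[/eqP].
have key v w : sesq M v w = Num.conj (sesq M w v).
  have h1 := im0 (v + w); have h2 := im0 (v + 'i%C *: w).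
  move: h1 h2 (im0 v) (im0 w).
  rewrite !sesqDl !sesqDr !sesqZl !sesqZr.
  case: (sesq M v v) (sesq M v w) (sesq M w v) (sesq M w w) => [a a'] [b b'] [c c'] [d d'] /=.
  move=> h1 h2 h3 h4; apply: cpart_inj => -[] /=; lra.
apply/matrixP => i j.
by rewrite !mxE -[RHS](col_delta) -sesq_delta key sesq_delta col_delta.
Qed.

(** An additive form of the Cauchy-Schwarz inequality between v and the basis
    vector e_i. The form is expanded at v + z e_i for the four units z = 1,
    -1, i, -i. *)
Lemma nonneg_mulmx_le M v i b : M ^t* = M ->
  (forall v, 0 <= complex.Re (sesq M v v)) ->
  `|cpart b ((M *m v) i 0)| <= complex.Re (M i i) + complex.Re (sesq M v v).
Proof.
move=> hM M0; set e := delta_mx i 0 : 'cV[R[i]]_n.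
have H z : 0 <= complex.Re (sesq M v v) + complex.Re (z * Num.conj z * M i i) +
    2 * complex.Re (Num.conj z * (M *m v) i 0).
  have := M0 (v + z *: e).
  rewrite !sesqDl !sesqDr !sesqZl !sesqZr (sesq_conj e v hM) !sesq_delta.
  rewrite col_delta; case: (sesq M v v) ((M *m v) i 0) (M i i) z => [a a'] [b1 b2] [c c'] [z1 z2] /=.
  by move=> h; apply: le_trans h _; rewrite le_eqVlt; apply/orP; left; apply/eqP; ring.
have := M0 v; have := M0 e; rewrite sesq_delta col_delta.
have := H 1; have := H (-1); have := H 'i%C; have := H (- 'i%C).
case: (sesq M v v) ((M *m v) i 0) (M i i) => [a a'] [b1 b2] [c c'] /= h1 h2 h3 h4 h5 h6.
by case: b => /=; rewrite ler_norml; apply/andP; split; lra.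
Qed.

End QuadraticForms.

(** * Approximation by rational vectors *)

Section RationalVectors.
Context {R : realType}.

Definition mxcvgn {m k} (u : nat -> 'M[R[i]]_(m, k)) (l : 'M[R[i]]_(m, k)) :
  Prop :=
  forall i j b, cpart b (u r i j) @[r --> \oo] --> cpart b (l i j).

Lemma cvgn_sum I (s : seq I) (F : I -> nat -> R) (l : I -> R) :
  (forall x, F x r @[r --> \oo] --> l x) ->
  \sum_(x <- s) F x r @[r --> \oo] --> \sum_(x <- s) l x.
Proof.
move=> H; elim: s => [|x s ih].
  by under eq_fun do rewrite big_nil; rewrite big_nil; exact: cvg_cst.
by under eq_fun do rewrite big_cons; rewrite big_cons; exact: cvgD (H x) ih.
Qed.

Lemma mxcvgnM m k p (u : nat -> 'M[R[i]]_(m, k))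
    (v : nat -> 'M[R[i]]_(k, p)) l l' :
  mxcvgn u l -> mxcvgn v l' -> mxcvgn (fun r => u r *m v r) (l *m l').
Proof.
move=> hu hv i j b; under eq_fun do rewrite cpart_mulmx; rewrite cpart_mulmx.
apply: cvgn_sum => e; apply: cvgMr; apply: cvgM; [exact: hu|exact: hv].
Qed.

Lemma mxcvgn_ctr m k (u : nat -> 'M[R[i]]_(m, k)) l :
  mxcvgn u l -> mxcvgn (fun r => (u r) ^t*) (l ^t*).
Proof.
move=> hu i j b; under eq_fun do rewrite ctr_mxE; rewrite ctr_mxE.
by case: b; [apply: cvgN|]; exact: hu.
Qed.

(** Vectors and matrices over Q(i), as a countable family: real and imaginary
    parts are given separately. *)
Definition ratmx {m k} (p : 'M[rat]_(m, k) * 'M[rat]_(m, k)) : 'M[R[i]]_(m, k) :=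
  \matrix_(i, j) ((ratr (p.1 i j)) +i* (ratr (p.2 i j))).

Lemma ratmx_dense m k (A : 'M[R[i]]_(m, k)) :
  exists u, mxcvgn (fun r => ratmx (u r)) A.
Proof.
have H (r : nat) (y : R) : exists q : rat, `|y - ratr q| < r.+1%:R^-1.
  have e0 : 0 < r.+1%:R^-1 :> R by rewrite invr_gt0.
  have : y < y + r.+1%:R^-1 by rewrite ltrDl.
  move=> /rat_in_itvoo[q]; rewrite in_itv /= => /andP[h1 h2]; exists q.
  by rewrite ltr0_norm; move: (r.+1%:R^-1) e0 h2 => e e0 h2; lra.
pose q r y : rat := sval (cid (H r y)).
exists (fun r => (\matrix_(i, j) q r (cpart false (A i j)), \matrix_(i, j) q r (cpart true (A i j)))).
move=> i j b.
have -> : (fun r => cpart b (ratmx (\matrix_(i0, j0) q r (cpart false (A i0 j0)),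
   \matrix_(i0, j0) q r (cpart true (A i0 j0))) i j)) = (fun r => ratr (q r (cpart b (A i j)))).
  by apply/funext => r; rewrite !mxE /=; case: b; rewrite /= ?mxE.
apply/cvgrPdist_lt => e e0; near=> r.
rewrite /q; case: cid => x /= /lt_trans; apply.
near: r; exact: (near_infty_natSinv_lt (PosNum e0)).
Unshelve. all: by end_near. Qed.

(** Almost-everywhere statements can be collected over countably many vectors
    only; by density and continuity that is enough. *)
Lemma sesq_dense n (M : 'M[R[i]]_n) :
  (forall p, 0 <= complex.Re (sesq M (ratmx p) (ratmx p))) ->
  forall v, 0 <= complex.Re (sesq M v v).
Proof.
move=> H v; have [u uv] := ratmx_dense v.
have hM : mxcvgn (fun=> M) M by move=> i j b; exact: cvg_cst.
have := mxcvgnM (mxcvgnM (mxcvgn_ctr uv) hM) uv => /(_ 0 0 false) /= cv.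
have cvE := cvg_lim _ cv; rewrite /sesq -cvE //.
apply: limr_ge; first by apply/cvg_ex; eexists; exact: cv.
by near=> r; exact: H.
Unshelve. all: by end_near. Qed.

End RationalVectors.

(** * Densities of Hermitian and of non-negative measures *)

Section DensityMatrices.
Context {R : realType} {a b : \bar R} {n : nat}.
Implicit Types q w : dist0 a b n n.
Local Notation msr D := (measurable (D : set (measurableTypeR R))).
Local Notation intble mu D h := (mu.-integrable D (EFin \o h)).

Lemma bounded_borel_integrable q A : bounded_borel a b A ->
  msr A /\ mx_integrable (d0_mu q) A (d0_den q).
Proof.
move=> [mA [c [d [oc od Acd]]]]; split => //.
by apply: mx_integrableS (d0_den_integrable q oc od) => //; exact: measurable_itv.
Qed.

Lemma hermitian_density_ae q : d0_hermitian q ->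
  {ae d0_mu q, forall t, oint a b t -> (d0_den q t) ^t* = d0_den q t}.
Proof.
move=> hq.
have H (e : 'I_n * 'I_n * bool) : {ae d0_mu q, forall t : measurableTypeR R, oint a b t ->
    cpart e.2 (((d0_den q t) ^t* - d0_den q t) e.1.1 e.1.2) = 0}.
  have mI (c d : R) : msr `[c, d]%classic by exact: measurable_itv.
  apply: ae_zero => [c d oc od|A bA].
    have /mx_integrableP H := mx_integrableB (mI c d)
      (mx_integrable_ctr (mI c d) (d0_den_integrable q oc od)) (d0_den_integrable q oc od).
    exact: H.
  have [mA iA] := bounded_borel_integrable q bA.
  rewrite -cpart_mx_int mx_intB // ?mx_int_ctr //; last exact: mx_integrable_ctr.
  by have := hq A bA; rewrite /d0_val => ->; rewrite subrr mxE cpart0.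
apply: filterS (ae_forall_count H) => t Ht ot.
apply: mx_parts => i j b'; have := Ht (i, j, b') ot.
by move: (d0_den q t) => D; rewrite /= mxE cpartD [(- D) i j]mxE cpartN => /subr0_eq.
Qed.

Lemma nonneg_d0_hermitian w : d0_nonneg w -> d0_hermitian w.
Proof. by move=> hw A bA; apply: nonneg_hermitian_mx => v; exact: hw. Qed.

Lemma nonneg_density_ae w : d0_nonneg w ->
  {ae d0_mu w, forall t, oint a b t -> forall v, 0 <= complex.Re (sesq (d0_den w t) v v)}.
Proof.
move=> hw.
have H (p : 'cV[rat]_n * 'cV[rat]_n) : {ae d0_mu w, forall t : measurableTypeR R, oint a b t ->
    0 <= complex.Re (sesq (d0_den w t) (ratmx p) (ratmx p))}.
  pose g t := ((ratmx p) ^t* *m d0_den w t *m ratmx p : 'M[R[i]]_1).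
  apply: (@ae_nonneg _ _ _ _ (fun t => cpart false (g t 0 0))) => [c d oc od|A bA].
    have mI : msr `[c, d]%classic by exact: measurable_itv.
    have /mx_integrableP H := mx_integrableMr (ratmx p) mI (mx_integrableMl ((ratmx p) ^t*) mI
      (d0_den_integrable w oc od)).
    exact: H.
  have [mA iA] := bounded_borel_integrable w bA.
  rewrite -cpart_mx_int mx_intMr ?mx_intMl //; last exact: mx_integrableMl.
  by have := hw A bA (ratmx p); rewrite lecE => /andP[].
apply: filterS (ae_forall_count H) => t Ht ot.
by apply: sesq_dense => p; exact: Ht.
Qed.

(** The density D f of w f is integrable on compact intervals: its entries are
    dominated by D_ii + f^* D f, where the first term is locally integrable
    and the second is integrable because f is in L^2(w). *)
Lemma density_mul_integrable w f : d0_nonneg w -> in_L2 w f ->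
  forall c d, oint a b c -> oint a b d ->
  mx_integrable (d0_mu w) `[c, d] (fun t => d0_den w t *m f t).
Proof.
move=> hw [mf fL2] c d oc od; set mu := d0_mu w; set D := d0_den w.
have mO := measurable_oint a b.
have FF : Filter (almost_everywhere mu) := ae_filter_ringOfSetsType mu.
have mD : mx_measurable (oint a b) D by exact: d0_den_measurable.
have mI : msr `[c, d]%classic by exact: measurable_itv.
have IO : `[c, d]%classic `<=` oint a b.
  by move=> t /=; rewrite in_itv /= => /andP[ct td]; exact: oint_itv oc od ct td.
pose s t := complex.Re (sesq (D t) (f t) (f t)).
have ms : measurable_fun (oint a b : set (measurableTypeR R)) s.
  have /mx_measurableP H := mx_measurableM (mx_measurableM (mx_measurable_ctr mO mf) mD) mf.
  exact: (H 0 0 false).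
have s0 : {ae mu, forall t, oint a b t -> 0 <= s t}.
  by apply: (@filterS _ _ FF) (nonneg_density_ae hw) => t Ht ot; exact: Ht.
have is_ : intble mu (oint a b) s.
  apply/integrableP; split; first exact/measurable_EFinP.
  apply: le_lt_trans fL2; rewrite le_eqVlt; apply/orP; left; apply/eqP.
  apply: ae_eq_integral => //.
  - by apply/measurable_EFinP; exact: measurableT_comp.
  - exact/measurable_EFinP.
  - by apply: (@filterS _ _ FF) s0 => t Ht ot /=; rewrite ger0_norm // Ht.
have isI : intble mu `[c, d] s by exact: integrableS is_.
apply/mx_integrableP => i j b'; rewrite (ord1 j).
have /mx_measurableP mDf := mx_measurableM mD mf.
have mg : measurable_fun (`[c, d]%classic : set (measurableTypeR R))
    (fun t => cpart b' ((D t *m f t) i 0)).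
  by apply: measurable_funS (mDf i 0 b').
have iB : intble mu `[c, d] (fun t => complex.Re (D t i i) + s t).
  have /mx_integrableP H := d0_den_integrable w oc od.
  exact: (integrableD mI (H i i false) isI).
apply/integrableP; split; first exact/measurable_EFinP.
have /integrableP[mB] := iB; apply: le_lt_trans.
apply: ae_ge0_le_integral => //.
- by apply/measurable_EFinP; exact: measurableT_comp.
- by apply/measurable_EFinP; apply: measurableT_comp => //; apply/measurable_EFinP.
move: (nonneg_density_ae hw) (hermitian_density_ae (nonneg_d0_hermitian hw)).
apply: (@filterS2 _ _ FF) => t h1 h2 /IO ot; rewrite /= lee_fin.
apply: le_trans (ler_norm _).
by apply: nonneg_mulmx_le; [exact: h2|exact: h1].
Qed.

End DensityMatrices.

(** * Passage to a common density *)

Section Reduction.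
Context {R : realType} {a b : \bar R} {n : nat}.
Local Notation msr D := (measurable (D : set (measurableTypeR R))).
Local Notation intble mu D h := (mu.-integrable D (EFin \o h)).

Lemma mx_int_ae (mu : {measure set (measurableTypeR R) -> \bar R}) (m k : nat)
    (A : set R)
    (u v : R -> 'M[R[i]]_(m, k)) : msr A -> mx_measurable A u -> mx_measurable A v ->
  {ae mu, forall t, A t -> u t = v t} -> mx_int mu A u = mx_int mu A v.
Proof.
move=> mA /mx_measurableP hu /mx_measurableP hv uv; apply: mx_parts => i j b'.
rewrite !cpart_mx_int /Rintegral; congr fine; apply: ae_eq_integral => //.
- exact/measurable_EFinP.
- exact/measurable_EFinP.
have FF : Filter (almost_everywhere mu) := ae_filter_ringOfSetsType mu.
by apply: (@filterS _ _ FF) uv => t H At /=; rewrite H.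
Qed.

Lemma mx_measurableS (m k : nat) (A B : set R) (u : R -> 'M[R[i]]_(m, k)) :
  msr B -> A `<=` B -> mx_measurable B u -> mx_measurable A u.
Proof.
move=> mB AB mu_ i j; have [m1 m2] := mu_ i j.
by split; [exact: measurable_funS m1|exact: measurable_funS m2].
Qed.

(** Replacing the density of q by its Hermitian part changes it on a null set
    only and makes it Hermitian at every point, so that no exceptional set has
    to be carried along. *)
Definition herm_part (M : 'M[R[i]]_n) : 'M[R[i]]_n := 2^-1 *: (M + M ^t*).

Lemma herm_part_id M : M ^t* = M -> herm_part M = M.
Proof. by move=> h; rewrite /herm_part h halfD. Qed.

Lemma herm_part_ctr M : (herm_part M) ^t* = herm_part M.
Proof.
rewrite /herm_part ctrZ ctrD ctrK addrC; congr (_ *: _).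
by apply: cpart_inj => -[]; rewrite cpart_conjC half_real /= ?oppr0.
Qed.

Lemma mx_integrable_herm_part
    (mu : {measure set (measurableTypeR R) -> \bar R}) A D :
  msr A -> mx_integrable mu A D -> mx_integrable mu A (fun t => herm_part (D t)).
Proof.
move=> mA iD; have := mx_integrableMl ((2^-1)%:M : 'M[R[i]]_n) mA
  (mx_integrableD mA iD (mx_integrable_ctr mA iD)).
by apply: mx_integrable_ext => // t _; rewrite mul_scalar_mx.
Qed.

(** From here on the measures of q, w and w f enter only through the densities
    P, D and D f. Multiplication by q is stated for bounded u and integration
    against w f for bounded X, which is what makes the products integrable. *)
Lemma common_density_reduction (q w : dist0 a b n n) (f : R -> 'cV[R[i]]_n)
    (x0 x1 : R) :
  d0_hermitian q -> d0_nonneg w -> in_L2 w f ->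
  oint a b x0 -> oint a b x1 ->
  let K := `[x0, x1]%classic in
  exists (lam : {finite_measure set (measurableTypeR R) -> \bar R}) (P D : R -> 'M[R[i]]_n),
  [/\ (forall t, (P t) ^t* = P t), mx_integrable lam K P, mx_integrable lam K D &
      mx_integrable lam K (fun t => D t *m f t)] /\
  [/\ forall A, msr A -> A `<=` K -> d0_val q A = mx_int lam A P,
      forall A, msr A -> A `<=` K -> d0_val w A = mx_int lam A D,
      forall A (k : nat) (u : R -> 'M[R[i]]_(n, k)) (M : R), msr A -> A `<=` K ->
        mx_measurable A u -> (forall t, A t -> norm1 (u t) <= M) ->
        d0_mul q u A = mx_int lam A (fun t => P t *m u t) &
      forall A (k : nat) (X : R -> 'M[R[i]]_(k, n)) (M : R), msr A -> A `<=` K ->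
        mx_measurable A X -> (forall t, A t -> norm1 (X t) <= M) ->
        d0_int w A X f = mx_int lam A (fun t => X t *m (D t *m f t))].
Proof.
move=> hq hw hf o0 o1 K.
have mK : msr K by exact: measurable_itv.
have KO : K `<=` oint a b.
  by move=> t; rewrite /K /= in_itv /= => /andP[ct td]; exact: oint_itv o0 o1 ct td.
have [lam [r1 [r2 [mr1 mr2 H1 H2]]]] :=
  common_density mK (d0_mu_finite q o0 o1) (d0_mu_finite w o0 o1).
have tr (mu : {measure set (measurableTypeR R) -> \bar R}) (r : R -> R) :
    (forall A (g : R -> R), msr A -> A `<=` K -> intble mu A g ->
    intble lam A (fun x => g x * r x) /\
    \int[lam]_(x in A) (g x * r x) = \int[mu]_(x in A) g x) ->
    forall (m k : nat) A (u : R -> 'M[R[i]]_(m, k)), msr A -> A `<=` K -> mx_integrable mu A u ->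
    mx_integrable lam A (fun t => (r t)%:C *: u t) /\
    mx_int lam A (fun t => (r t)%:C *: u t) = mx_int mu A u.
  move=> H m k A u mA AK /mx_integrableP iu; split.
    apply/mx_integrableP => i j b'.
    under eq_fun do rewrite mxE cpart_real mulrC.
    exact: (H A _ mA AK (iu i j b')).1.
  apply: mx_parts => i j b'; rewrite !cpart_mx_int -(H A _ mA AK (iu i j b')).2.
  by apply: eq_Rintegral => t _; rewrite mxE cpart_real mulrC.
have trq := tr _ _ H1; have trw := tr _ _ H2; clear tr H1 H2.
(* The density of q is replaced by its Hermitian part before the transfer to
   lam, as the exceptional null set is one of the measure of q. *)
pose Dq := d0_den q; pose Dw := d0_den w; pose Dh t := herm_part (Dq t).
have iDq : mx_integrable (d0_mu q) K Dq by exact: d0_den_integrable.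
have iDh : mx_integrable (d0_mu q) K Dh by exact: mx_integrable_herm_part.
have iDw : mx_integrable (d0_mu w) K Dw by exact: d0_den_integrable.
have iDf : mx_integrable (d0_mu w) K (fun t => Dw t *m f t).
  exact: density_mul_integrable hw hf _ _ o0 o1.
have aeq : {ae d0_mu q, forall t, K t -> Dq t = Dh t}.
  have FF : Filter (almost_everywhere (d0_mu q)) := ae_filter_ringOfSetsType (d0_mu q).
  by apply: (@filterS _ _ FF) (hermitian_density_ae hq) => t H /KO ot; rewrite /Dh herm_part_id // H.
exists lam, (fun t => (r1 t)%:C *: Dh t), (fun t => (r2 t)%:C *: Dw t); split; split.
- move=> t; rewrite ctrZ herm_part_ctr; congr (_ *: _).
  by apply: cpart_inj => -[]; rewrite cpart_conjC /= ?oppr0.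
- exact: (trq _ _ K Dh mK (@subset_refl _ K) iDh).1.
- exact: (trw _ _ K Dw mK (@subset_refl _ K) iDw).1.
- have := (trw _ _ K _ mK (@subset_refl _ K) iDf).1.
  by apply: mx_integrable_ext => // t _; rewrite scalemxAl.
- move=> A mA AK.
  have iA := mx_integrableS mK mA AK iDh; have iA' := mx_integrableS mK mA AK iDq.
  rewrite (trq _ _ A Dh mA AK iA).2; apply: mx_int_ae => //.
  + exact: mx_integrable_measurable iA'.
  + exact: mx_integrable_measurable iA.
  have FF : Filter (almost_everywhere (d0_mu q)) := ae_filter_ringOfSetsType (d0_mu q).
  by apply: (@filterS _ _ FF) aeq => t H /AK /H.
- move=> A mA AK; have iA := mx_integrableS mK mA AK iDw.
  by rewrite (trw _ _ A Dw mA AK iA).2.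
- move=> A k u M mA AK mu_ bu.
  have iA := mx_integrableS mK mA AK iDh; have iA' := mx_integrableS mK mA AK iDq.
  have iu := mx_integrable_bddr mA iA mu_ bu.
  have iu' := mx_integrable_bddr mA iA' mu_ bu.
  transitivity (mx_int (d0_mu q) A (fun t => Dh t *m u t)).
    rewrite /d0_mul /d0_int; under eq_fun do rewrite mul1mx.
    apply: mx_int_ae => //.
    + exact: mx_integrable_measurable iu'.
    + exact: mx_integrable_measurable iu.
    have FF : Filter (almost_everywhere (d0_mu q)) := ae_filter_ringOfSetsType (d0_mu q).
    by apply: (@filterS _ _ FF) aeq => t H /AK /H <-.
  rewrite -(trq _ _ A _ mA AK iu).2.
  by apply: mx_int_ext => t _; rewrite scalemxAl.
- move=> A k X M mA AK mX bX.
  have iA := mx_integrableS mK mA AK iDf.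
  have iX := mx_integrable_bddl mA mX bX iA.
  rewrite /d0_int; under eq_fun do rewrite -mulmxA.
  rewrite -(trw _ _ A _ mA AK iX).2.
  by apply: mx_int_ext => t _; rewrite -scalemxAl -scalemxAr.
Qed.

End Reduction.

(** * Solutions as balanced primitives *)

Section SolutionPrimitive.
Context {R : realType} {a b : \bar R} {n : nat}.
Local Notation msr D := (measurable (D : set (measurableTypeR R))).
Variables (J : 'M[R[i]]_n) (q : dist0 a b n n).
Hypothesis J_unit : J \in unitmx.
Variables (lam : {finite_measure set (measurableTypeR R) -> \bar R}) (P : R -> 'M[R[i]]_n).
Variables (x0 x1 : R).
Let K := `[x0, x1]%classic.
Hypothesis iP : mx_integrable lam K P.
Hypothesis mulq : forall A (k : nat) (u : R -> 'M[R[i]]_(n, k)) (M : R), msr A -> A `<=` K ->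
  mx_measurable A u -> (forall t, A t -> norm1 (u t) <= M) ->
  d0_mul q u A = mx_int lam A (fun t => P t *m u t).

Let mK : msr K. Proof. exact: measurable_itv. Qed.

Lemma Iv_subK b' c t : x0 <= c -> t <= x1 -> Iv b' c t `<=` K.
Proof.
move=> xc tx s /IvE[cs st]; rewrite /K /= in_itv /=; apply/andP; split; first by lra.
by case: b' st => st; lra.
Qed.

(** The limit l at the left end exists although u is only assumed to be
    locally of bounded variation inside. *)
Lemma solution_bp (k : nat) (g : set R -> 'M[R[i]]_(n, k))
    (rg : R -> 'M[R[i]]_(n, k)) c d u :
  x0 <= c -> c < d -> d <= x1 -> mx_integrable lam K rg ->
  (forall A, msr A -> A `<=` K -> g A = mx_int lam A rg) ->
  solution J q g c d u ->
  exists l, balanced_primitive lam c d l (fun t => invmx J *m (rg t - P t *m u t)) u.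
Proof.
move=> xc cd dx ir gE [bv bal [u' [_ u'E] sol]].
have subK : Iv true c d `<=` K by exact: Iv_subK.
have mI := measurable_Iv true c d.
have iA : mx_integrable lam (Iv true c d) (fun t => invmx J *m P t).
  by apply: mx_integrableMl => //; exact: mx_integrableS iP.
have ik : mx_integrable lam (Iv true c d) (fun t => invmx J *m rg t).
  by apply: mx_integrableMl => //; exact: mx_integrableS ir.
have hE : (fun t => invmx J *m (rg t - P t *m u t)) =
    (fun t => invmx J *m rg t - (invmx J *m P t) *m u t).
  by apply/funext => t; rewrite mulmxBr mulmxA.
rewrite hE; apply: ode_balanced_primitive => // s t cs st td; rewrite -hE.
have os : oint c%:E d%:E s by split; rewrite lte_fin //; exact: le_lt_trans td.
have ot : oint c%:E d%:E t by split; rewrite lte_fin //; exact: lt_le_trans st.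
have mst : msr `[s, t[%classic by exact: measurable_itv.
have stK : `[s, t[%classic `<=` K.
  by move=> r; rewrite /K /= !in_itv /= => /andP[h1 h2]; apply/andP; split; lra.
have bb : bounded_borel c%:E d%:E `[s, t[%classic.
  split => //; exists s, t; split => // r /=.
  by rewrite !in_itv /= => /andP[-> /ltW].
rewrite -u'E //; have := sol _ bb.
have [M HM] := locally_BV_bounded bv cs st td.
have bu r : `[s, t[%classic r -> norm1 (u r) <= M.
  by rewrite /= in_itv /= => /andP[h1 /ltW h2]; exact: HM.
have mu_ : mx_measurable `[s, t[%classic u.
  apply: mx_measurableS (locally_BV_measurable bv) => //.
  by move=> r /=; rewrite in_itv /= => /andP[h1 h2]; apply/IvE; split; lra.
rewrite (mulq mst stK mu_ bu) gE // => /eqP.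
rewrite eq_sym -subr_eq => /eqP E.
have iPu : mx_integrable lam `[s, t[%classic (fun t => P t *m u t).
  by apply: mx_integrable_bddr mu_ bu => //; exact: mx_integrableS iP.
have irs : mx_integrable lam `[s, t[%classic rg by exact: mx_integrableS ir.
rewrite mx_intMl //; last exact: mx_integrableB.
by rewrite mx_intB // E mulKmx.
Qed.

(** The derivative of u, as a measure on ]c, d[, is its density times lam. *)
Lemma bp_solution (k : nat) (g : set R -> 'M[R[i]]_(n, k))
    (rg : R -> 'M[R[i]]_(n, k)) c d l u :
  x0 <= c -> c < d -> d <= x1 -> mx_integrable lam K rg ->
  (forall A, msr A -> A `<=` K -> g A = mx_int lam A rg) ->
  balanced_primitive lam c d l (fun t => invmx J *m (rg t - P t *m u t)) u ->
  solution J q g c d u.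
Proof.
move=> xc cd dx ir gE bp; set h := fun t => _ in bp.
have subK : Iv true c d `<=` K by exact: Iv_subK.
have mI := measurable_Iv true c d.
have bv := bp_locally_BV bp.
have ih : mx_integrable lam (Iv true c d) h by exact: bp.1.
have IvO : oint c%:E d%:E = Iv true c d.
  by apply/seteqP; split => t; [move=> [h1 h2]; apply/IvE|move=> /IvE[h1 h2]; split];
    rewrite ?lte_fin // in h1 h2 *.
have itvI s t : oint c%:E d%:E s -> oint c%:E d%:E t -> `[s, t]%classic `<=` Iv true c d.
  rewrite IvO => /IvE[cs _] /IvE[_ td] r /=; rewrite in_itv /= => /andP[h1 h2].
  by apply/IvE; split; lra.
split => //.
  move=> t; rewrite IvO => /IvE[ct td].
  rewrite (bp_rlim bp (ltW ct) td) (bp_llim bp ct (ltW td)) bp.2 //.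
  by rewrite addrACA scalerDr halfD /balanced_prim [prim _ _ _ true _ + _]addrC.
have den_m : mx_measurable (oint c%:E d%:E) h.
  by rewrite IvO; exact: mx_integrable_measurable ih.
have mu_fin (s t : R) : oint c%:E d%:E s -> oint c%:E d%:E t -> (lam `[s, t]%classic < +oo)%E.
  move=> _ _; rewrite -ge0_fin_numE //; apply: fin_num_measure; exact: measurable_itv.
have den_i (s t : R) : oint c%:E d%:E s -> oint c%:E d%:E t -> mx_integrable lam `[s, t] h.
  move=> os ot; apply: (mx_integrableS mI _ (itvI s t os ot) ih).
  exact: measurable_itv.
exists (@Dist0 R c%:E d%:E n k lam h den_m mu_fin den_i).
  split => // s t; rewrite {1 2}IvO => /IvE[cs sd] /IvE[ct td] st.
  rewrite /d0_val /= (bp_llim bp cs (ltW sd)) (bp_llim bp ct (ltW td)).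
  rewrite (prim_itvco bp cs st (ltW td)).
  by rewrite opprD addrACA subrr add0r addrC addKr.
move=> A [mA [s [t [os ot Ast]]]]; rewrite /d0_val /=.
have AI : A `<=` Iv true c d by apply: subset_trans Ast _; exact: itvI.
have AK : A `<=` K by exact: subset_trans subK.
have mu_ : mx_measurable A u by apply: mx_measurableS (locally_BV_measurable bv).
have bu r : A r -> norm1 (u r) <= norm1 l + \int[lam]_(s in Iv true c d) norm1 (h s).
  by move=> /AI/IvE[cr rd]; exact: bp_norm1.
have iPu : mx_integrable lam A (fun t => P t *m u t).
  by apply: mx_integrable_bddr mu_ bu => //; exact: mx_integrableS iP.
have irs : mx_integrable lam A rg by exact: mx_integrableS ir.
rewrite (mulq mA AK mu_ bu) gE // mx_intMl //; last exact: mx_integrableB.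
by rewrite mulKVmx // mx_intB // subrK.
Qed.

End SolutionPrimitive.

(** * J-unitary matrices *)

Section SkewAlgebra.
Context {R : realType} {n : nat}.
Variable J : 'M[R[i]]_n.
Hypotheses (J_unit : J \in unitmx) (J_skew : J ^t* = - J).
Local Notation V := (invmx J).

Lemma invmx_skew : V ^t* = - V.
Proof.
have : V ^t* *m J ^t* = 1%:M by rewrite -ctrM mulmxV // ctr1.
rewrite J_skew mulmxN => /eqP; rewrite eqr_oppLR => /eqP E.
by rewrite -[V ^t*](mulmxK J_unit) E mulNmx mul1mx.
Qed.

(** Inversion of X^* J X = J: a one-sided inverse of a square matrix is
    two-sided. *)
Lemma unitary_dual (X : 'M[R[i]]_n) : X ^t* *m J *m X = J -> X *m V *m X ^t* = V.
Proof.
move=> XJX; have : (V *m X ^t* *m J) *m X = 1%:M.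
  by rewrite -mulmxA -mulmxA [X ^t* *m _]mulmxA XJX mulVmx.
move=> /mulmx1C /(congr1 (mulmx^~ V)).
by rewrite mul1mx !mulmxA mulmxK.
Qed.

Lemma unitary_solve k (X : 'M[R[i]]_n) (y l r : 'M[R[i]]_(n, k)) :
  X ^t* *m J *m X = J ->
  X ^t* *m J *m y = J *m l + r -> y = X *m (l + V *m r).
Proof.
move=> XJX E; have : X *m V *m (X ^t* *m J *m y) = y.
  by rewrite !mulmxA unitary_dual // mulVmx // mul1mx.
by move=> <-; rewrite E mulmxDr -!mulmxA (mulKmx J_unit) mulmxDr.
Qed.

(** On the left, the jump of a balanced primitive at an atom; on the right,
    the same equation in terms of B_+. Since J is skew-Hermitian and D
    Hermitian, -B_- is the adjoint of B_+. *)
Lemma jump_equation k (D : 'M[R[i]]_n) (r up um : 'M[R[i]]_(n, k)) : D ^t* = D ->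
  (up - um = V *m (r - D *m (2^-1 *: (up + um)))) <->
  ((J + 2^-1 *: D) *m up + (J + 2^-1 *: D) ^t* *m um = r).
Proof.
move=> hD.
have cD : (J + 2^-1 *: D) ^t* = - J + 2^-1 *: D.
  rewrite ctrD ctrZ J_skew hD; congr (_ + _ *: _).
  by apply: cpart_inj => -[]; rewrite cpart_conjC half_real /= ?oppr0.
rewrite cD; have -> : (J + 2^-1 *: D) *m up + (- J + 2^-1 *: D) *m um =
    J *m (up - um) + D *m (2^-1 *: (up + um)).
  rewrite !mulmxDl mulNmx mulmxBr -!scalemxAl -scalemxAr mulmxDr scalerDr.
  by rewrite addrACA.
split=> [->|<-]; first by rewrite mulKVmx // subrK.
by rewrite addrK mulKmx.
Qed.

(** Product of the means versus mean of the products: the defect of the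
    Leibniz rule for balanced values at an atom. *)
Lemma quarter_jump k (A B : 'M[R[i]]_n) (C D : 'M[R[i]]_(n, k)) :
  (2^-1 *: (A + B)) *m (2^-1 *: (C + D)) + (2^-1 * 2^-1) *: ((A - B) *m (C - D)) =
  2^-1 *: (A *m C + B *m D).
Proof.
rewrite -scalemxAl -scalemxAr scalerA -scalerDr.
rewrite !mulmxDl !mulmxDr !mulNmx !mulmxN opprK.
set x := A *m C; set y := B *m C; set z := A *m D; set t := B *m D.
have -> : x + z + (y + t) + (x - z + (- y + t)) = (x + t) + (x + t).
  rewrite addrACA [x + z + _]addrACA subrr addr0 [y + t + _]addrACA subrr add0r.
  by rewrite addrACA.
by rewrite -scalerA halfD.
Qed.

(** U is the balanced value and E half of the jump of the fundamental matrix
    at an atom. Both one-sided values U + E and U - E are J-unitary, so the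
    mixed terms E V U^* + U V E^* cancel and U V U^* + E V E^* = V. The last
    hypothesis, which expresses E through the equation, rewrites the second
    term. *)
Lemma midpoint_identity (D U E : 'M[R[i]]_n) (r : R[i]) :
  (U + E) *m V *m (U + E) ^t* = V -> (U - E) *m V *m (U - E) ^t* = V ->
  E = - (r *: (V *m D *m U)) ->
  U *m V *m U ^t* + r *: (V *m D *m E *m V *m U ^t*) = V.
Proof.
move=> h1 h2 hE.
pose X := U *m V *m U ^t* + E *m V *m E ^t*.
pose Y := E *m V *m U ^t* + U *m V *m E ^t*.
have e1 : X + Y = V.
  rewrite -h1 /X /Y ctrD !mulmxDl !mulmxDr; clear.
  move: (U *m V *m U ^t*) (E *m V *m U ^t*) (U *m V *m E ^t*) (E *m V *m E ^t*).
  by move=> x y z t; apply/matrixP => i j; rewrite !mxE; ring.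
have e2 : X - Y = V.
  rewrite -[RHS]h2 /X /Y ctrD ctrN !mulmxDl !mulmxDr !mulNmx !mulmxN opprK; clear.
  move: (U *m V *m U ^t*) (E *m V *m U ^t*) (U *m V *m E ^t*) (E *m V *m E ^t*).
  by move=> x y z t; apply/matrixP => i j; rewrite !mxE; ring.
(* X + Y and X - Y are the two hypotheses, so the mixed part Y vanishes. *)
have Y0 : Y = 0.
  rewrite -[Y]halfD (_ : Y + Y = (X + Y) - (X - Y)); first by rewrite e1 e2 subrr scaler0.
  by rewrite opprB [in RHS](addrC X Y) [RHS]addrACA subrr addr0.
have EE : E *m V *m U ^t* = - (U *m V *m E ^t*) by apply/eqP; rewrite -addr_eq0 -/Y Y0.
have -> : r *: (V *m D *m E *m V *m U ^t*) = E *m V *m E ^t*.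
  have -> : V *m D *m E *m V *m U ^t* = - (V *m D *m U) *m V *m E ^t*.
    move: EE; move: V (V *m D) => V' Z EE.
    rewrite -(mulmxA Z E) -(mulmxA Z) EE mulmxN !mulNmx.
    by congr (- _); rewrite !mulmxA.
  have -> : E *m V *m E ^t* = - (r *: (V *m D *m U)) *m V *m E ^t* by rewrite -hE.
  move: (V *m D *m U) (E ^t*) => Z E'.
  by rewrite 2!mulNmx scalerN 2!mulNmx -2!scalemxAl.
by rewrite -/X -[X]addr0 -Y0 e1.
Qed.

End SkewAlgebra.

(** * Variation of constants *)

Section VariationOfConstants.
Context {R : realType} {n : nat}.
Variable lam : {finite_measure set (measurableTypeR R) -> \bar R}.
Variable J : 'M[R[i]]_n.
Hypotheses (J_unit : J \in unitmx) (J_skew : J ^t* = - J).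
Variable P : R -> 'M[R[i]]_n.
Hypothesis P_herm : forall t, (P t) ^t* = P t.
Local Notation V := (invmx J).
Variables (c d : R).

(** The density of u' when J u' + P u = g. *)
Definition ode_rhs k (g u : R -> 'M[R[i]]_(n, k)) (t : R) : 'M[R[i]]_(n, k) :=
  V *m (g t - P t *m u t).

Variable U : R -> 'M[R[i]]_n.
Let hU := ode_rhs (fun=> 0) U.
Hypothesis bpU : balanced_primitive lam c d 1%:M hU U.
Let Up (b : bool) t : 'M[R[i]]_n := 1%:M + prim lam c hU b t.

(** Leibniz rule for U^* J u. Since J is skew-Hermitian and P Hermitian, the
    two terms with P cancel and U^* g remains. *)
Lemma lagrange k (g u : R -> 'M[R[i]]_(n, k)) l (b : bool) t :
  balanced_primitive lam c d l (ode_rhs g u) u -> t < d \/ (b /\ t <= d) ->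
  (Up b t) ^t* *m J *m (l + prim lam c (ode_rhs g u) b t) =
    J *m l + prim lam c (fun s => (U s) ^t* *m g s) b t /\
  mx_integrable lam (Iv b c t) (fun s => (U s) ^t* *m g s).
Proof.
move=> bp td; have mI := measurable_Iv b c t.
have iU := bp_integrable bpU td; have iu := bp_integrable bp td.
have iUc := mx_integrable_ctr mI iU.
have iJu := mx_integrableMl J mI iu.
have [] := product_rule (1%:M : 'M[R[i]]_n) (J *m l) iUc iJu.
have E x : Iv b c t x -> (hU x) ^t* *m (J *m l + balanced_prim lam c (fun s => J *m ode_rhs g u s) x) +
    (1%:M + balanced_prim lam c (fun s => (hU s) ^t*) x) *m (J *m ode_rhs g u x) = (U x) ^t* *m g x.
  move=> /IvE[cx xt].
  have xd : x < d.
    case: td => [td|[bT td]]; last by rewrite bT in xt; lra.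
    by move: xt; case: (b) => xt; lra.
  have sub b' : Iv b' c x `<=` Iv true c d by apply: sub_IvT; left.
  have i1 b' : mx_integrable lam (Iv b' c x) (ode_rhs g u) by apply: (bp_integrable bp); left.
  have i2 b' : mx_integrable lam (Iv b' c x) hU by apply: (bp_integrable bpU); left.
  have -> : J *m l + balanced_prim lam c (fun s => J *m ode_rhs g u s) x = J *m u x.
    rewrite bp.2 // mulmxDr; congr (_ + _); rewrite /balanced_prim /prim.
    rewrite (mx_intMl J (measurable_Iv _ _ _) (i1 true)).
    by rewrite (mx_intMl J (measurable_Iv _ _ _) (i1 false)) -mulmxDr -scalemxAr.
  have -> : 1%:M + balanced_prim lam c (fun s => (hU s) ^t*) x = (U x) ^t*.
    rewrite bpU.2 // ctrD ctr1; congr (_ + _); rewrite /balanced_prim /prim.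
    rewrite !mx_int_ctr // ctrZ ctrD; congr (_ *: _).
    by apply: cpart_inj => -[]; rewrite cpart_conjC half_real /= ?oppr0.
  rewrite /hU /ode_rhs sub0r mulmxN ctrN !ctrM P_herm (invmx_skew J_unit J_skew).
  rewrite mulKVmx // mulmxBr.
  by rewrite mulmxN opprK !mulmxA (mulmxKV J_unit) addrC subrK.
move=> E1 E2; split; last by apply: mx_integrable_ext E2.
have -> : (Up b t) ^t* = 1%:M + prim lam c (fun s => (hU s) ^t*) b t.
  by rewrite /Up ctrD ctr1 /prim mx_int_ctr.
rewrite -mulmxA mulmxDr.
have -> : J *m prim lam c (ode_rhs g u) b t = prim lam c (fun s => J *m ode_rhs g u s) b t.
  by rewrite /prim mx_intMl.
by rewrite E1 mul1mx; congr (_ + _); exact: mx_int_ext.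
Qed.

(** The Lagrange identity with g = 0 and u = U: the form U^* J U is constant,
    also across atoms. *)
Lemma fundamental_unitary (b : bool) t : t < d \/ (b /\ t <= d) ->
  (Up b t) ^t* *m J *m Up b t = J.
Proof.
move=> td; have [-> _] := lagrange bpU td; rewrite mulmx1 -[RHS]addr0; congr (_ + _).
rewrite /prim (@mx_int_ext _ _ _ _ _ _ (fun=> 0)) => [|s _]; last by rewrite mulmx0.
apply: mx_parts => i j b'; rewrite cpart_mx_int mxE cpart0.
by rewrite Rintegral_cst ?mul0r //; exact: measurable_Iv.
Qed.

Lemma variation_of_constants k (g u : R -> 'M[R[i]]_(n, k)) l (b : bool) t :
  balanced_primitive lam c d l (ode_rhs g u) u -> t < d \/ (b /\ t <= d) ->
  l + prim lam c (ode_rhs g u) b t =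
  Up b t *m (l + V *m prim lam c (fun s => (U s) ^t* *m g s) b t).
Proof.
move=> bp td; have [E _] := lagrange bp td.
exact: (unitary_solve J_unit (fundamental_unitary td) E).
Qed.

Section Converse.
Context {k : nat}.
Variables (g u : R -> 'M[R[i]]_(n, k)) (l : 'M[R[i]]_(n, k)).
Hypothesis iUg : mx_integrable lam (Iv true c d) (fun s => (U s) ^t* *m g s).
Let gg s := V *m ((U s) ^t* *m g s).
Let Gp (b : bool) t := l + V *m prim lam c (fun s => (U s) ^t* *m g s) b t.
Hypothesis uE : forall t, c < t -> t < d ->
  u t = 2^-1 *: (Up false t *m Gp false t + Up true t *m Gp true t).

Let igg : mx_integrable lam (Iv true c d) gg.
Proof. by apply: mx_integrableMl => //; exact: measurable_Iv. Qed.

Let GpE (b : bool) t : t < d \/ (b /\ t <= d) -> Gp b t = l + prim lam c gg b t.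
Proof.
move=> td; have i1 := mx_integrableS (measurable_Iv true c d) (measurable_Iv b c t) (sub_IvT td) iUg.
by rewrite /Gp /prim (mx_intMl V (measurable_Iv _ _ _) i1).
Qed.

(** The Leibniz derivative of U G equals V (g - P u) where u is the balanced
    value of U G, even at atoms: there U and G enter the Leibniz rule with
    their own balanced values, and the defect (quarter_jump) is compensated by
    midpoint_identity. *)
Lemma balanced_product_rhs t : c < t -> t < d ->
  hU t *m (l + balanced_prim lam c gg t) + (1%:M + balanced_prim lam c hU t) *m gg t = ode_rhs g u t.
Proof.
move=> ct td; have tt b : t < d \/ (b /\ t <= d) by left.
pose m : R[i] := (fine (lam [set t]))%:C.
pose A := Up false t; pose B := Up true t; pose C := Gp false t; pose D := Gp true t.
have AB : A - B = m *: hU t.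
  by rewrite /A /B /Up (prim_jump bpU ct td) opprD addrACA subrr add0r [X in X - _]addrC addrK.
have bpg : balanced_primitive lam c d l gg (fun t => l + balanced_prim lam c gg t) by split.
have CD : C - D = m *: gg t.
  rewrite /C /D !GpE // (prim_jump bpg ct td).
  by rewrite opprD addrACA subrr add0r [X in X - _]addrC addrK.
have hA : A *m V *m A ^t* = V by apply: unitary_dual => //; exact: fundamental_unitary.
have hB : B *m V *m B ^t* = V by apply: unitary_dual => //; exact: fundamental_unitary.
have UE : U t = 2^-1 *: (A + B).
  rewrite bpU.2 // /A /B /Up addrACA scalerDr halfD; congr (_ + _).
  by rewrite /balanced_prim addrC.
have -> : 1%:M + balanced_prim lam c hU t = U t by rewrite -bpU.2.
have GE : l + balanced_prim lam c gg t = 2^-1 *: (C + D).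
  by rewrite /C /D !GpE // addrACA scalerDr halfD /balanced_prim [prim _ _ _ true _ + _]addrC.
(* Half of the jump of U at t; it is zero when t carries no mass. *)
pose E := 2^-1 *: (A - B).
have AE : U t + E = A.
  by rewrite UE /E -scalerDr addrACA subrr addr0 halfD.
have BE : U t - E = B.
  by rewrite UE /E -scalerBr opprB [B - A]addrC addrACA subrr add0r halfD.
have EE : E = - ((2^-1 * m) *: (V *m P t *m U t)).
  by rewrite /E AB scalerA /hU /ode_rhs sub0r mulmxN scalerN mulmxA.
have := @midpoint_identity _ _ J (P t) (U t) E (2^-1 * m).
rewrite AE BE => /(_ hA hB EE) mid.
have mE : m *: hU t = (2 : R[i]) *: E.
  by rewrite /E AB [RHS]scalerA mulfV ?scale1r // pnatr_eq0.
rewrite GE /ode_rhs uE // -/A -/B -/C -/D -quarter_jump -UE -GE AB CD mE.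
move: (l + balanced_prim lam c gg t) => Gb; clearbody E.
(* V g is expanded by the midpoint identity; afterwards both sides agree term
   by term. *)
have Vg : V *m g t = (U t *m V *m (U t) ^t* +
    (2^-1 * m) *: (V *m P t *m E *m V *m (U t) ^t*)) *m g t by rewrite mid.
rewrite mulmxBr Vg /hU /ode_rhs /gg sub0r !mulmxN mulNmx.
rewrite !mulmxDr mulmxDl -!scalemxAl -!scalemxAr !mulmxA; clear.
move: (V *m P t *m U t *m Gb) (U t *m V *m (U t) ^t* *m g t) => x y.
move: (V *m P t *m E *m V *m (U t) ^t* *m g t) => z.
rewrite !scalerA (_ : 2^-1 / 2 * 2 * m = 2^-1 * m); last by rewrite mulfVK // pnatr_eq0.
by apply/matrixP => i j; rewrite !mxE; ring.
Qed.

(** The variation of constants formula defines a solution. *)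
Lemma product_primitive (b : bool) t : t < d \/ (b /\ t <= d) ->
  Up b t *m Gp b t = l + prim lam c (ode_rhs g u) b t /\
  mx_integrable lam (Iv b c t) (ode_rhs g u).
Proof.
move=> td; have mI := measurable_Iv b c t.
have i1 := bp_integrable bpU td.
have i2 := mx_integrableS (measurable_Iv true c d) mI (sub_IvT td) igg.
have [E1 E2] := product_rule 1%:M l i1 i2.
have E x : Iv b c t x ->
    hU x *m (l + balanced_prim lam c gg x) + (1%:M + balanced_prim lam c hU x) *m gg x = ode_rhs g u x.
  by move=> /(sub_IvT td)/IvE[cx xd]; exact: balanced_product_rhs.
split; last by apply: mx_integrable_ext E2.
rewrite GpE // E1 mul1mx; congr (_ + _); exact: mx_int_ext.
Qed.

End Converse.

End VariationOfConstants.

(** * Jumps and the block system *)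

Section Jumps.
Context {R : realType} {a b : \bar R} {n : nat}.
Local Notation msr D := (measurable (D : set (measurableTypeR R))).
Variable lam : {finite_measure set (measurableTypeR R) -> \bar R}.

Lemma jump_atom (q : dist0 a b n n) (Q P : R -> 'M[R[i]]_n) (x0 x1 y : R) :
  oint a b x0 -> oint a b x1 -> mx_integrable lam `[x0, x1] P ->
  (forall A, msr A -> A `<=` `[x0, x1]%classic -> d0_val q A = mx_int lam A P) ->
  left_antiderivative q Q -> x0 < y -> y < x1 ->
  jump Q y = (fine (lam [set y]))%:C *: P y.
Proof.
move=> o0 o1 iP vE [lc [bv dQ]] xy yx.
have xx : x0 < x1 by exact: lt_trans yx.
have oI t : x0 < t -> t < x1 -> oint a b t.
  by move=> h1 h2; apply: (oint_itv o0 o1); exact: ltW.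
have iPI : mx_integrable lam (Iv true x0 x1) P.
  apply: mx_integrableS iP => //.
  by move=> t /IvE[h1 h2] /=; rewrite in_itv /= !ltW.
have [L LE] : exists L, forall t, x0 < t -> t < x1 -> Q t = L + prim lam x0 P true t.
  apply: primitive_of_increments => // s t cs st td.
  have os : oint a b s by apply: oI => //; exact: le_lt_trans td.
  have ot : oint a b t by apply: oI => //; exact: lt_le_trans st.
  rewrite -vE; last 2 first.
  - exact: measurable_itv.
  - move=> r /=; rewrite !in_itv /= => /andP[h1 h2]; apply/andP; split; lra.
  by rewrite dQ // (lc s os) (lc t ot) -!lc.
have bpP : balanced_primitive lam x0 x1 0 P (fun t => 0 + balanced_prim lam x0 P t) by split.
have lQ : llim Q y = L + prim lam x0 P true y.
  apply: cvg_mx_left_llim; apply: (@cvg_mx_left_near _ _ _ (fun t => L + prim lam x0 P true t)).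
    near=> t.
    have h1 : x0 < t by near: t; exact: nbhs_left_gt.
    have h2 : t < x1 by apply: lt_trans yx; near: t; exact: nbhs_left_lt.
    by rewrite LE.
  by apply: cvg_mx_leftD; [exact: cvg_mx_left_cst|exact: (prim_cvg_left _ xy (ltW yx) iPI)].
have rQ : rlim Q y = L + prim lam x0 P false y.
  apply: cvg_mx_right_rlim; apply: (@cvg_mx_right_near _ _ _ (fun t => L + prim lam x0 P true t)).
    near=> t.
    have h1 : x0 < t by apply: lt_trans xy _; near: t; exact: nbhs_right_gt.
    have h2 : t < x1 by near: t; exact: nbhs_right_lt.
    by rewrite LE.
  by apply: cvg_mx_rightD; [exact: cvg_mx_right_cst|exact: (prim_cvg_right _ (ltW xy) yx iPI)].
rewrite /jump lQ rQ (prim_jump bpP xy yx) opprD addrACA subrr add0r.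
by rewrite [X in X - _]addrC addrK.
Unshelve. all: by end_near. Qed.

End Jumps.

Section Blocks.
Context {R : realType} {a b : \bar R} {n : nat}.
Variables (J : 'M[R[i]]_n) (w : dist0 a b n n) (Q W : R -> 'M[R[i]]_n).
Variables (N : nat) (x : nat -> R) (U : nat -> R -> 'M[R[i]]_n).
Variable (f : R -> 'cV[R[i]]_n).
Hypothesis J_unit : J \in unitmx.

Lemma invmx_calJ : invmx (calJ J N) = \mxdiag_(i < N) invmx J.
Proof.
have E : calJ J N *m (\mxdiag_(i < N) invmx J) = 1%:M.
  rewrite /calJ [X in _ *m X]/mxdiag mul_mxdiag_mxblock -mxdiagZ [RHS]/mxdiag.
  apply: eq_mxblock => i j; case: eqP => _; last by rewrite mulmx0.
  by rewrite !conform_mx_id mulmxV.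
have [uJ _] := mulmx1_unit E.
by rewrite -[RHS](mulKmx uJ) E mulmx1.
Qed.

Lemma map_mxblock (p q : nat) (p_ : 'I_p -> nat) (q_ : 'I_q -> nat)
    (B : forall i j, 'M[R[i]]_(p_ i, q_ j)) (g : R[i] -> R[i]) :
  map_mx g (\mxblock_(i, j) B i j) = \mxblock_(i, j) map_mx g (B i j).
Proof. by apply/matrixP => s t; rewrite !mxE. Qed.

Lemma ctr_mxdiag (p : nat) (B : 'I_p -> 'M[R[i]]_n) :
  (\mxdiag_(i < p) B i) ^t* = \mxdiag_(i < p) (B i) ^t*.
Proof.
rewrite tr_mxdiag /mxdiag map_mxblock; apply: eq_mxblock => i j.
case: eqP => _; last by rewrite map_mx0.
by rewrite !conform_mx_id.
Qed.

(** Row i of the system involves only c_i and c_{i+1}: it is the jump equation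
    at x_{i+1} with the left limit there expressed through c_i. *)
Lemma block_system (c : 'I_N.+1 -> 'cV[R[i]]_n) :
  Bmx J Q N x U *m (\mxcol_(j < N.+1) c j) =
    calR W N x f - (calB J Q N x) ^t* *m calU N x U *m invmx (calJ J N) *m calI w N x U f <->
  forall i : 'I_N,
    Bplus J Q (x i.+1) *m c (lift ord0 i) +
    (Bplus J Q (x i.+1)) ^t* *m
      (Uend x U i *m (c (widen_ord (leqnSn N) i) + invmx J *m Uint w U f i `]x i, x i.+1[)) =
    jump W (x i.+1) *m f (x i.+1).
Proof.
rewrite invmx_calJ /Bmx /calB /calU /calR /calI ctr_mxdiag.
have EB : Ebot N *m (\mxcol_(j < N.+1) c j) = \mxcol_(i < N) c (widen_ord (leqnSn N) i).
  rewrite /Ebot mul_mxblock_mxrow; apply: eq_mxcol => i.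
  rewrite (bigD1 (widen_ord (leqnSn N) i)) //= eqxx mul1mx big1 ?addr0 // => j.
  by rewrite -(inj_eq val_inj) /= => /negbTE ->; rewrite mul0mx.
have ET : Etop N *m (\mxcol_(j < N.+1) c j) = \mxcol_(i < N) c (lift ord0 i).
  rewrite /Etop mul_mxblock_mxrow; apply: eq_mxcol => i.
  rewrite (bigD1 (lift ord0 i)) //= eqxx mul1mx big1 ?addr0 // => j.
  by rewrite -(inj_eq val_inj) /= => /negbTE ->; rewrite mul0mx.
rewrite mulmxDl -!mulmxA EB ET !mul_mxdiag_mxcol -mxcolD -mxcolB.
have alg (X Y Z : 'M[R[i]]_n) (c0 c1 r s : 'cV[R[i]]_n) :
    Y *m (X *m c0) + Z *m c1 = r - Y *m (X *m s) <->
    Z *m c1 + Y *m (X *m (c0 + s)) = r.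
  rewrite !mulmxDr addrA [Z *m c1 + _]addrC; split=> [->|<-]; first by rewrite subrK.
  by rewrite addrK.
split=> [/eq_mxcolP E i|E]; last apply: eq_mxcol => i.
  exact: (alg _ _ _ _ _ _ _).1 (E i).
exact: (alg _ _ _ _ _ _ _).2 (E i).
Qed.

End Blocks.

(** * Gluing along a grid *)

Section Union.
Context {R : realType} (mu : {finite_measure set (measurableTypeR R) -> \bar R}).
Local Notation intble D h := (mu.-integrable D (EFin \o h)).
Local Notation msr D := (measurable (D : set (measurableTypeR R))).

Lemma integrable_setU A B (g : R -> R) : msr A -> msr B -> [disjoint A & B] ->
  intble A g -> intble B g -> intble (A `|` B) g.
Proof.
move=> mA mB AB /integrableP[mgA iA] /integrableP[mgB iB].
have mg : measurable_fun ((A `|` B) : set (measurableTypeR R)) (EFin \o g).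
  by apply/measurable_funU.
apply/integrableP; split => //.
rewrite ge0_integral_setU //; last exact: measurableT_comp mg.
exact: lte_add_pinfty.
Qed.

Lemma mx_integrable_glue m n (c y d : R) (h : R -> 'M[R[i]]_(m, n)) :
  c < y -> y < d ->
  mx_integrable mu (Iv true c y) h -> mx_integrable mu (Iv true y d) h ->
  mx_integrable mu (Iv true c d) h.
Proof.
move=> cy yd /mx_integrableP i1 /mx_integrableP i2; apply/mx_integrableP => i j b.
have -> : Iv true c d = (Iv true c y `|` [set y]) `|` Iv true y d.
  apply/seteqP; split => t.
    move=> /IvE[ct td]; have [ty|yt|->] := ltgtP t y.
    - by left; left; apply/IvE.
    - by right; apply/IvE.
    - by left; right.
  by move=> [[/IvE[h1 h2]|->]|/IvE[h1 h2]]; apply/IvE; split; lra.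
have i3 : intble (Iv true c y `|` [set y]) (fun t => cpart b (h t i j)).
  apply: integrable_setU => //.
    apply/disj_setPS => t [/IvE[_ ty] /= E]; by rewrite E ltxx in ty.
  have : intble [set y] (fun=> cpart b (h y i j)).
    exact: finite_measure_integrable_cst.
  by apply: eq_integrable => // t; rewrite inE /= => ->.
apply: integrable_setU => //; first exact: measurableU.
by apply/disj_setPS => t [[/IvE[_ h1]|/= ->] /IvE[h2 _]]; lra.
Qed.

End Union.

Section Grid.
Context {R : realType} (N : nat) (x : nat -> R).
Hypothesis x_incr : forall i j, (i < j)%N -> (j <= N.+1)%N -> x i < x j.

Lemma grid_le i j : (i <= j)%N -> (j <= N.+1)%N -> x i <= x j.
Proof. by rewrite leq_eqVlt => /predU1P[->//|ij jN]; apply/ltW/x_incr. Qed.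

Lemma grid_cell_co M t : (M <= N.+1)%N -> x 0 <= t -> t < x M ->
  exists2 j, (j < M)%N & x j <= t /\ t < x j.+1.
Proof.
elim: M => [|M ih] MN xt tx; first by lra.
have [Mt|tM] := leP (x M) t; first by exists M.
have [j jM H] := ih (ltnW MN) xt tM.
by exists j => //; exact: ltnW.
Qed.

Lemma grid_cell_oc M t : (M <= N.+1)%N -> x 0 < t -> t <= x M ->
  exists2 j, (j < M)%N & x j < t /\ t <= x j.+1.
Proof.
elim: M => [|M ih] MN xt tx; first by lra.
have [Mt|tM] := ltP (x M) t; first by exists M.
have [j jM H] := ih (ltnW MN) xt tM.
by exists j => //; exact: ltnW.
Qed.

(** The cells [x_j, x_{j+1}[ are disjoint, so a sum over cells selects the
    piece that lives on the cell of t. *)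
Lemma grid_sum_co (V : nmodType) (v : nat -> V) t j :
    (j <= N)%N -> x j <= t -> t < x j.+1 ->
  \sum_(i < N.+1) (if (x i <= t) && (t < x i.+1) then v i else 0) = v j.
Proof.
move=> jN xt tx; rewrite (bigD1 (inord j)) //= inordK // xt tx big1 ?addr0 // => i ij.
case: ifP => // /andP[it ti].
have [h|h|h] := ltngtP i j.
- by exfalso; have := grid_le h (leqW jN); lra.
- by exfalso; have := grid_le h (ltnW (ltn_ord i)); lra.
- by move/eqP: ij; case; apply: val_inj; rewrite /= inordK.
Qed.

Lemma grid_sum_oc (V : nmodType) (v : nat -> V) t j :
    (j <= N)%N -> x j < t -> t <= x j.+1 ->
  \sum_(i < N.+1) (if (x i < t) && (t <= x i.+1) then v i else 0) = v j.
Proof.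
move=> jN xt tx; rewrite (bigD1 (inord j)) //= inordK // xt tx big1 ?addr0 // => i ij.
case: ifP => // /andP[it ti].
have [h|h|h] := ltngtP i j.
- by exfalso; have := grid_le h (leqW jN); lra.
- by exfalso; have := grid_le h (ltnW (ltn_ord i)); lra.
- by move/eqP: ij; case; apply: val_inj; rewrite /= inordK.
Qed.

End Grid.

Section Transfer.
Context {R : realType} {n : nat}.
Variable lam : {finite_measure set (measurableTypeR R) -> \bar R}.
Variable J : 'M[R[i]]_n.
Hypotheses (J_unit : J \in unitmx) (J_skew : J ^t* = - J).
Variable P : R -> 'M[R[i]]_n.
Hypothesis P_herm : forall t, (P t) ^t* = P t.
Variables (rf : R -> 'cV[R[i]]_n) (N : nat) (x : nat -> R) (U : nat -> R -> 'M[R[i]]_n).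
Local Notation V := (invmx J).
Hypothesis x_incr : forall i j, (i < j)%N -> (j <= N.+1)%N -> x i < x j.
Hypothesis bpU : forall j, (j <= N)%N ->
  balanced_primitive lam (x j) (x j.+1) 1%:M (ode_rhs J P (fun=> 0) (U j)) (U j).
Hypothesis iUf : forall j, (j <= N)%N ->
  mx_integrable lam (Iv true (x j) (x j.+1)) (fun s => (U j s) ^t* *m rf s).

Let Up j (b : bool) t : 'M[R[i]]_n :=
  1%:M + prim lam (x j) (ode_rhs J P (fun=> 0) (U j)) b t.
Let Gp (c : nat -> 'cV[R[i]]_n) j (b : bool) t :=
  c j + V *m prim lam (x j) (fun s => (U j s) ^t* *m rf s) b t.

(** The rows of the block system, solved for the jump at x_{i+1}: um is the
    left limit there that variation of constants produces from c_i. *)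
Definition jump_relations (c : nat -> 'cV[R[i]]_n) : Prop :=
  forall i, (i < N)%N ->
  let um := Up i true (x i.+1) *m Gp c i true (x i.+1) in
  c i.+1 - um = (fine (lam [set x i.+1]))%:C *:
    (V *m (rf (x i.+1) - P (x i.+1) *m (2^-1 *: (c i.+1 + um)))).

Lemma solution_jump_relations (u : R -> 'cV[R[i]]_n) l :
  balanced_primitive lam (x 0) (x N.+1) l (ode_rhs J P rf u) u ->
  jump_relations (fun j => rlim u (x j)).
Proof.
move=> bp i iN.
have xi : x i < x i.+1 by apply: x_incr => //; exact: leqW.
have x0i : x 0 <= x i by apply: (grid_le x_incr) => //; exact/leqW/ltnW.
have xiN : x i.+1 < x N.+1 by exact: x_incr.
have x0i1 : x 0 < x i.+1 by exact: le_lt_trans xi.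
have bpi := bp_restrict bp x0i (ltW xiN).
have rl : rlim u (x i) = l + prim lam (x 0) (ode_rhs J P rf u) false (x i).
  by apply: (bp_rlim bp) => //; exact: lt_trans xiN.
have td : x i.+1 < x i.+1 \/ (true /\ x i.+1 <= x i.+1) by right.
have E := variation_of_constants J_unit J_skew P_herm (bpU (ltnW iN)) bpi td.
rewrite /Gp rl -E -(bp_llim bpi xi (lexx _)) /=.
set y := x i.+1; have rly := bp_rlim bp (ltW x0i1) xiN; have lly := bp_llim bp x0i1 (ltW xiN).
have uy : u y = 2^-1 *: (rlim u y + llim u y).
  by rewrite rly lly bp.2 // addrACA scalerDr halfD /balanced_prim [prim _ _ _ true _ + _]addrC.
have -> : rlim u y - llim u y = (fine (lam [set y]))%:C *: ode_rhs J P rf u y.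
  by rewrite rly lly (prim_jump bp x0i1 xiN) opprD addrACA subrr add0r [X in X - _]addrC addrK.
by rewrite /ode_rhs -uy.
Qed.

(** Each cell carries the solution given by variation of constants; the
    relations ensure that crossing a grid point adds exactly the atom of the
    right-hand side, so the constants of integration fit together to that of
    one primitive on the whole interval. *)
Lemma jump_relations_solution (c : nat -> 'cV[R[i]]_n) : jump_relations c ->
  exists2 u : R -> 'cV[R[i]]_n,
    balanced_primitive lam (x 0) (x N.+1) (c 0) (ode_rhs J P rf u) u &
    forall j y, (j <= N)%N -> x j < y -> y < x j.+1 ->
      llim u y = Up j true y *m Gp c j true y.
Proof.
move=> rel.
have [v vdef] : exists v : nat -> bool -> R -> 'cV[R[i]]_n,
    forall j b t, v j b t = Up j b t *m Gp c j b t by eexists.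
(* The right limits are read on the cells closed on the left, the left limits
   on the cells closed on the right. At a grid point the two come from
   different cells, which gives the balanced value. *)
pose u t := 2^-1 *: (
  \sum_(j < N.+1) (if (x j <= t) && (t < x j.+1) then v j false t else 0) +
  \sum_(j < N.+1) (if (x j < t) && (t <= x j.+1) then v j true t else 0)).
pose h := ode_rhs J P rf u.
have uE j t : (j <= N)%N -> x j < t -> t < x j.+1 ->
    u t = 2^-1 *: (v j false t + v j true t).
  move=> jN xt tx; rewrite /u.
  rewrite (grid_sum_co x_incr (fun j => v j false t) jN (ltW xt) tx).
  by rewrite (grid_sum_oc x_incr (fun j => v j true t) jN xt (ltW tx)).
have PP j (b : bool) t : (j <= N)%N -> t < x j.+1 \/ (b /\ t <= x j.+1) ->
    v j b t = c j + prim lam (x j) h b t /\ mx_integrable lam (Iv b (x j) t) h.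
  move=> jN td; rewrite vdef.
  apply: (product_primitive J_unit J_skew P_herm (bpU jN) (iUf jN) _ td) => s h1 h2.
  by rewrite (uE j s jN h1 h2) !vdef.
have ih j : (j <= N)%N -> mx_integrable lam (Iv true (x 0) (x j.+1)) h.
  elim: j => [|j IH] jN.
    by have [] := PP 0%N true (x 1%N) jN; [right|].
  apply: mx_integrable_glue (IH (ltnW jN)) _.
  - by apply: x_incr => //; exact: leqW.
  - exact: x_incr.
  - by have [] := PP j.+1 true (x j.+2) jN; [right|].
have bph : balanced_primitive lam (x 0) (x N.+1) 0 h (fun t => 0 + balanced_prim lam (x 0) h t).
  by split => //; exact: ih.
have ux i : (i < N)%N -> u (x i.+1) = 2^-1 *: (c i.+1 + v i true (x i.+1)).
  move=> iN; have x1 : x i.+1 < x i.+2 by exact: x_incr.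
  have x2 : x i < x i.+1 by apply: x_incr => //; exact: leqW.
  rewrite /u (grid_sum_co x_incr (fun j => v j false (x i.+1)) iN (lexx _) x1).
  rewrite (grid_sum_oc x_incr (fun j => v j true (x i.+1)) (ltnW iN) x2 (lexx _)).
  have [-> _] := PP i.+1 false (x i.+1) iN (or_introl x1).
  by rewrite prim_cc addr0.
(* The prescribed right limits c_j are those of the primitive that starts from
   c_0: crossing x_{j+1} adds its atom by the jump relations. *)
have cE j : (j <= N)%N -> c j = c 0%N + prim lam (x 0) h false (x j).
  elim: j => [|j IH] jN; first by rewrite prim_cc addr0.
  have xj : x j < x j.+1 by apply: x_incr => //; exact: leqW.
  have x0j : x 0 <= x j by apply: (grid_le x_incr) => //; exact/leqW/ltnW.
  have xjN : x j.+1 < x N.+1 by exact: x_incr.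
  have x0j1 : x 0 < x j.+1 by exact: le_lt_trans xj.
  rewrite (prim_jump bph x0j1 xjN).
  rewrite (@prim_split _ _ _ _ _ _ _ _ _ bph true (x j) (x j.+1) x0j xj (or_introl xjN)).
  rewrite !addrA -IH ?(ltnW jN) //.
  have [<- _] := PP j true (x j.+1) (ltnW jN) (or_intror (conj isT (lexx _))).
  have := rel j jN => /= /eqP; rewrite -vdef -ux // subr_eq => /eqP ->.
  by rewrite addrC.
have vE j (b : bool) t : (j <= N)%N -> x j <= t -> (if b then x j < t else x j <= t) ->
    t < x j.+1 \/ (b /\ t <= x j.+1) -> v j b t = c 0%N + prim lam (x 0) h b t.
  move=> jN xt bt td; have [-> _] := PP j b t jN td.
  have x0j : x 0 <= x j by apply: (grid_le x_incr) => //; exact: leqW.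
  have xN : x j.+1 <= x N.+1 by exact: (grid_le x_incr).
  rewrite (@prim_split _ _ _ _ _ _ _ _ _ bph b (x j) t x0j bt); last first.
    by case: td => [td|[bT td]]; [left; exact: lt_le_trans xN|right; split => //; exact: le_trans xN].
  by rewrite addrA -cE.
have bp : balanced_primitive lam (x 0) (x N.+1) (c 0%N) h u.
  split; first exact: ih.
  move=> t xt tx.
  have [i iN [xit txi]] := grid_cell_co (leqnn _) (ltW xt) tx.
  have [j jN [xjt txj]] := grid_cell_oc (leqnn _) xt (ltW tx).
  rewrite /u (grid_sum_co x_incr (fun j => v j false t) iN xit txi).
  rewrite (grid_sum_oc x_incr (fun j => v j true t) jN xjt txj).
  rewrite vE //; last by left.
  rewrite vE //; [|exact: ltW|by right].
  by rewrite addrACA scalerDr halfD /balanced_prim [prim _ _ _ true _ + _]addrC.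
exists u => // j y jN xy yx; rewrite -vdef.
have x0j : x 0 <= x j by apply: (grid_le x_incr) => //; exact: leqW.
have xN : x j.+1 <= x N.+1 by exact: (grid_le x_incr).
rewrite (bp_llim bp); [|exact: le_lt_trans xy|exact/ltW/(lt_le_trans yx)].
by rewrite (vE j true y) //; [exact: ltW|left].
Qed.

End Transfer.

(** * The main theorem *)

Section Aux.
Context {R : realType}.
Local Notation msr D := (measurable (D : set (measurableTypeR R))).

Lemma mx_integrable0 (mu : {measure set (measurableTypeR R) -> \bar R}) m n A :
  mx_integrable mu A (fun=> 0 : 'M[R[i]]_(m, n)).
Proof.
apply/mx_integrableP => i j b; under eq_fun do rewrite mxE cpart0.
exact: integrable0.
Qed.

Lemma mx_int0 (mu : {measure set (measurableTypeR R) -> \bar R}) m n A : msr A ->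
  mx_int mu A (fun=> 0 : 'M[R[i]]_(m, n)) = 0.
Proof.
move=> mA; apply: mx_parts => i j b; rewrite cpart_mx_int mxE cpart0.
by rewrite Rintegral_cst ?mul0r.
Qed.

Lemma norm1_ctr m n (A : 'M[R[i]]_(m, n)) :
  norm1 (A ^t*) <= norm1 A *+ #|{: 'I_n * 'I_m * bool}|.
Proof.
apply: norm1_le => i j b; rewrite ctr_mxE; case: b; rewrite ?normrN; exact: le_norm1.
Qed.

End Aux.

Theorem theorem2p2 (R : realType) (n : nat) (J : 'M[R[i]]_n) (a b : \bar R)
    (q w : dist0 a b n n) (f : R -> 'cV[R[i]]_n) (Q W : R -> 'M[R[i]]_n)
    (N : nat) (x : nat -> R) (U : nat -> R -> 'M[R[i]]_n)
    (J_unit : J \in unitmx) (J_skew : J ^t* = - J)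
    (q_herm : d0_hermitian q) (w_nonneg : d0_nonneg w) (f_L2 : in_L2 w f)
    (Q_anti : left_antiderivative q Q) (W_anti : left_antiderivative w W)
    (N_ge2 : (2 <= N)%N)
    (x_incr : forall i j, (i < j)%N -> (j <= N.+1)%N -> x i < x j)
    (ax0 : (a < (x 0%N)%:E)%E) (xNb : ((x N.+1)%:E < b)%E)
    (x_sing : forall y, x 0%N < y -> y < x N.+1 ->
       ~~ ((Bplus J Q y \in unitmx) && (Bminus J Q y \in unitmx)) ->
       exists2 j, (1 <= j <= N)%N & y = x j)
    (U_sol : forall j, (j <= N)%N ->
       solution J q (fun=> 0) (x j) (x j.+1) (U j))
    (U_init : forall j, (j <= N)%N -> cvg_right (U j) (x j) 1%:M) :
  let rhs := calR W N x f
    - (calB J Q N x) ^t* *m calU N x U *m invmx (calJ J N)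
      *m calI w N x U f in
  (forall u : R -> 'cV[R[i]]_n,
     solution J q (d0_mul w f) (x 0%N) (x N.+1) u ->
     Bmx J Q N x U *m (\mxcol_(j < N.+1) rlim u (x j)) = rhs)
  /\
  (forall c : 'I_N.+1 -> 'cV[R[i]]_n,
     Bmx J Q N x U *m (\mxcol_(j < N.+1) c j) = rhs ->
     exists2 u : R -> 'cV[R[i]]_n,
       solution J q (d0_mul w f) (x 0%N) (x N.+1) u &
       forall (j : 'I_N.+1) (y : R), x j < y -> y < x j.+1 ->
         llim u y =
           llim (U j) y *m (c j + invmx J *m Uint w U f j `]x j, y[)).
Proof.
move=> rhs.
have xx : x 0%N < x N.+1 by exact: x_incr.
have o0 : oint a b (x 0%N) by split => //; apply: lt_trans xNb; rewrite lte_fin.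
have o1 : oint a b (x N.+1) by split => //; apply: lt_trans ax0 _; rewrite lte_fin.
have [lam [P [D [[Ph iP iD irf] [vq vw mq iw]]]]] := common_density_reduction q_herm w_nonneg f_L2 o0 o1.
pose rf t := D t *m f t.
set K := `[x 0%N, x N.+1]%classic in iP iD irf vq vw mq iw.
have mK : measurable (K : set (measurableTypeR R)) by exact: measurable_itv.
have x0j j : (j <= N.+1)%N -> x 0%N <= x j by move=> jN; exact: (grid_le x_incr).
have xjN j : (j <= N.+1)%N -> x j <= x N.+1 by move=> jN; exact: (grid_le x_incr).
have xjj j : (j <= N)%N -> x j < x j.+1 by move=> jN; exact: x_incr.
have subK (c : bool) j t : (j <= N)%N -> t < x j.+1 \/ (c /\ t <= x j.+1) -> Iv c (x j) t `<=` K.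
  move=> jN td; apply: Iv_subK; first exact: x0j (leqW jN).
  have h : x j.+1 <= x N.+1 by exact: xjN.
  by case: td => [/ltW td|[_ td]]; exact: le_trans h.
have bpU j : (j <= N)%N ->
    balanced_primitive lam (x j) (x j.+1) 1%:M (ode_rhs J P (fun=> 0) (U j)) (U j).
  move=> jN.
  have zE A : measurable (A : set (measurableTypeR R)) -> A `<=` K ->
      (0 : 'M[R[i]]_n) = mx_int lam A (fun=> 0) by move=> mA _; rewrite mx_int0.
  have [l bp] := solution_bp J_unit iP mq (x0j _ (leqW jN)) (xjj _ jN) (xjN j.+1 jN)
    (@mx_integrable0 R lam n n K) zE (U_sol j jN).
  (* The initial condition identifies the constant of integration of U_j. *)
  have l1 : l = 1%:M.
    rewrite -(bp_rlim_start bp (xjj _ jN)); apply: cvg_mx_right_rlim.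
    exact/cvg_mx_rightP/U_init.
  by rewrite -l1.
(* U_j^* is bounded on its whole cell, so the integrals I_j(f) may be computed
   with the common density. *)
have UX j : (j <= N)%N -> exists M : R,
    mx_measurable (Iv true (x j) (x j.+1)) (fun t => (U j t) ^t*) /\
    forall t, Iv true (x j) (x j.+1) t -> norm1 ((U j t) ^t*) <= M.
  move=> jN; have [bv _ _] := U_sol j jN.
  exists ((norm1 (1%:M : 'M[R[i]]_n) + \int[lam]_(s in Iv true (x j) (x j.+1))
    norm1 (ode_rhs J P (fun=> 0) (U j) s)) *+ #|{: 'I_n * 'I_n * bool}|); split.
    by apply: mx_measurable_ctr; [exact: measurable_Iv|exact: locally_BV_measurable bv].
  move=> t /IvE[h1 h2]; apply: le_trans (norm1_ctr _) _.
  by rewrite lerMn2r; apply/orP; right; exact: (bp_norm1 (bpU j jN) h1 h2).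
have UI j (c : bool) t : (j <= N)%N -> t < x j.+1 \/ (c /\ t <= x j.+1) ->
    Uint w U f j (Iv c (x j) t) = prim lam (x j) (fun s => (U j s) ^t* *m rf s) c t.
  move=> jN td; have [M [mX bX]] := UX j jN.
  have sub : Iv c (x j) t `<=` Iv true (x j) (x j.+1) by exact: sub_IvT.
  rewrite /Uint (iw _ _ (fun t => (U j t) ^t*) M) //.
  - exact: subK.
  - by apply: mx_measurableS mX.
  - by move=> s /sub; exact: bX.
have iUf j : (j <= N)%N ->
    mx_integrable lam (Iv true (x j) (x j.+1)) (fun s => (U j s) ^t* *m rf s).
  move=> jN; have [M [mX bX]] := UX j jN.
  apply: (mx_integrable_bddl (measurable_Iv _ _ _) mX bX).
  by apply: mx_integrableS irf => //; apply: subK => //; right.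
have wfE A : measurable (A : set (measurableTypeR R)) -> A `<=` K ->
    d0_mul w f A = mx_int lam A rf.
  move=> mA AK; rewrite /d0_mul (iw _ _ (fun=> 1%:M) (norm1 (1%:M : 'M[R[i]]_n))) //.
  by apply: mx_int_ext => t _; rewrite mul1mx.
have UendE i : (i < N)%N ->
    Uend x U i = 1%:M + prim lam (x i) (ode_rhs J P (fun=> 0) (U i)) true (x i.+1).
  by move=> iN; rewrite /Uend (bp_llim_llim (bpU i (ltnW iN)) (xjj _ (ltnW iN)) (lexx _)).
(* The rows of the block system are the jump relations at the grid points. *)
have sysE (c : nat -> 'cV[R[i]]_n) :
    Bmx J Q N x U *m (\mxcol_(j < N.+1) c j) = rhs <->
    jump_relations lam J P rf N x U c.
  rewrite /rhs (block_system w Q W x U f J_unit (fun j : 'I_N.+1 => c j)).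
  have eqv (i : 'I_N) :
      Bplus J Q (x i.+1) *m c (lift ord0 i) + (Bplus J Q (x i.+1)) ^t* *m
      (Uend x U i *m (c (widen_ord (leqnSn N) i) + invmx J *m Uint w U f i `]x i, x i.+1[)) =
      jump W (x i.+1) *m f (x i.+1) <->
      c i.+1 - (1%:M + prim lam (x i) (ode_rhs J P (fun=> 0) (U i)) true (x i.+1)) *m
        (c i + invmx J *m prim lam (x i) (fun s => (U i s) ^t* *m rf s) true (x i.+1)) =
      (fine (lam [set x i.+1]))%:C *: (invmx J *m (rf (x i.+1) - P (x i.+1) *m
       (2^-1 *: (c i.+1 + (1%:M + prim lam (x i) (ode_rhs J P (fun=> 0) (U i)) true (x i.+1)) *m
        (c i + invmx J *m prim lam (x i) (fun s => (U i s) ^t* *m rf s) true (x i.+1)))))).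
    have iN := ltn_ord i; have iN' := ltnW iN.
    have y0 : x 0%N < x i.+1 by exact: x_incr.
    have y1 : x i.+1 < x N.+1 by exact: x_incr.
    rewrite lift0 /= (UendE i iN).
    have -> : Uint w U f i `]x i, x i.+1[ = prim lam (x i) (fun s => (U i s) ^t* *m rf s) true (x i.+1).
      by apply: (UI i true) => //; right.
    set um := (1%:M + _) *m _.
    have Qj := jump_atom o0 o1 iP vq Q_anti y0 y1.
    have Wj := jump_atom o0 o1 iD vw W_anti y0 y1.
    have hQ : (jump Q (x i.+1)) ^t* = jump Q (x i.+1).
      rewrite Qj ctrZ Ph; congr (_ *: _).
      by apply: cpart_inj => -[]; rewrite cpart_conjC /= ?oppr0.
    rewrite /Bplus -(jump_equation J_unit J_skew _ _ _ hQ) Qj Wj.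
    by rewrite -!scalemxAl -scalerBr -scalemxAr.
  by split=> [E i iN|E i]; [exact/(eqv (Ordinal iN))/E|apply/eqv/E].
split.
- move=> u usol; apply/(sysE (fun j => rlim u (x j))).
  have [l bp] := solution_bp J_unit iP mq (lexx _) xx (lexx _) irf wfE usol.
  exact: (solution_jump_relations J_unit J_skew Ph x_incr bpU bp).
- move=> c.
  have -> : \mxcol_(j < N.+1) c j = \mxcol_(j < N.+1) c (inord j).
    by apply: eq_mxcol => j; rewrite inord_val.
  move=> /(sysE (fun j => c (inord j))) rel.
  have [u bp uE] := jump_relations_solution J_unit J_skew Ph x_incr bpU iUf rel.
  exists u; first exact: (bp_solution J_unit iP mq (lexx _) xx (lexx _) irf wfE bp).
  move=> j y xy yx; have jN : (j <= N)%N by rewrite -ltnS.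
  rewrite (uE j y jN xy yx) inord_val (bp_llim (bpU j jN) xy (ltW yx)).
  by rewrite (UI j true y jN) //; left.
Qed.
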